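(* Let $k$ be an algebraically closed field of characteristic $p>2$, let $G=SL_2$ over $k$ with maximal torus $T$, and let $\mathcal{P}_1(0)$ be the principal (regular) block of the category $\mathcal{P}_1$ of finite dimensional projective $G_1T$-modules. Let $u_0$ be a basis element of $\mathrm{Hom}_{G_1T}(T_1(0),T_1(2p-2))$ and $u_1$ a basis element of $\mathrm{Hom}_{G_1T}(T_1(2p-2),T_1(2p))$ (both spaces are one-dimensional), and let $d_0$, $d_1$ be their duals. Then the two homomorphisms $u_0$ and $u_1$ generate via formation of direct sums, compositions, taking duals, and tensoring by $\pm2p$ all morphisms in $\mathcal{P}_1(0)$. The relations satisfied by these generators are $$u_1u_0=0=(u_0\otimes2p)u_1\quad\text{and}\quad u_0d_0=d_1u_1,\qquad u_1d_1=(d_0u_0)\otimes2p.$$ Here $u_0\otimes2p=u_2$, $d_0\otimes2p=d_2$, and hence $(d_0u_0)\otimes2p=d_2u_2$.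
   Context: For $G=SL_2$ one has $X(T)=\mathbb{Z}$, the positive root is $2$ and $\rho=1$. $F$ is the Frobenius endomorphism of $G$, $G_1=\ker F$ and $G_1T=F^{-1}(T)$. For $m\in\mathbb{Z}$, $T_1(m)$ is the indecomposable projective (equivalently indecomposable tilting) $G_1T$-module with highest weight $m$. The affine Weyl group $W_p$ is the infinite dihedral group acting on $\mathbb{Z}$ by the dot action, generated by the reflections in $-1$ and $p-1$; $W_p\cdot0=2p\mathbb{Z}\cup(-2+2p\mathbb{Z})$. $\mathcal{P}_1(0)$ is the subcategory of $\mathcal{P}_1$ whose indecomposable objects are the $T_1(m)$ with $m\in W_p\cdot0$; these are $P_m=T_1(0)\otimes2pm$ and $Q_m=T_1(2p-2)\otimes2pm$, $m\in\mathbb{Z}$, where $2pm\in\mathbb{Z}=X(T)$ is viewed as a one-dimensional $G_1T$-module. In particular $P_0=T_1(0)$, $Q_0=T_1(2p-2)$ and $P_1=T_1(2p)$. For $m\in\mathbb{Z}$ set $u_{2m}=u_0\otimes2pm\in\mathrm{Hom}_{G_1T}(P_m,Q_m)$ and $u_{2m+1}=u_1\otimes2pm\in\mathrm{Hom}_{G_1T}(Q_m,P_{m+1})$, and let $d_{2m}$ and $d_{2m+1}$ denote their duals. Duals: for a finite dimensional $G_1T$-module $M$, ${}^\tau M$ is $M^*$ with action twisted by the involutive anti-automorphism $\tau$ which is the identity on $T$ and interchanges the two root subgroups. Choosing symmetric isomorphisms $T_1(m)\to{}^\tau T_1(m)$ on indecomposables and extending additively gives isomorphisms $\phi_Q:Q\to{}^\tau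 Q$ for $Q\in\mathcal{P}_1$, and the dual of $f:Q\to P$ is $f^\dagger=\phi_Q^{-1}\circ f^*\circ\phi_P:P\to Q$, where $f^*$ is the linear dual of $f$.
   Formalization: The relations need normalization (scaling u_0 by a scales u_0d_0 by a² but not d_1u_1): they are stated for a suitable choice of symmetric isomorphisms, or after rescaling u_0; relations and d_0⊗2p=d_2 assume isomorphisms compatible with tensoring by 2p. *)

(* Defs.v *)
From HB Require Import structures.
From mathcomp Require Import all_boot all_order all_algebra.
From mathcomp Require Import mpoly.
Set Implicit Arguments.
Unset Strict Implicit.
Unset Printing Implicit Defensive.
Import GRing.Theory.
Local Open Scope ring_scope.

(* The matrix coordinates of SL_2, numbered 0, 1, 2, 3 = a, b, c, d.          *)
Definition coord (R : Type) (g : 'M[R]_2) (i : 'I_4) : R :=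
  g (inord (i %/ 2)) (inord (i %% 2)).

Section Points.
Variable k : closedFieldType.

Definition generic_mx : 'M[{mpoly k[4]}]_2 :=
  \matrix_(i, j) 'X_(inord (2 * i + j)).

(* The value of a polynomial in the matrix coordinates at an R-point.         *)
Definition eval_at (R : comAlgType k) (g : 'M[R]_2) : {mpoly k[4]} -> R :=
  mmap (in_alg R) (coord g).

HB.instance Definition _ (R : comAlgType k) (g : 'M[R]_2) :=
  GRing.RMorphism.copy (eval_at g) (mmap (in_alg R) (coord g)).

Lemma eval_atC (R : comAlgType k) (g : 'M[R]_2) c :
  eval_at g c%:MP = c%:A.
Proof. exact: mmapC. Qed.

Lemma coord_generic i : coord generic_mx i = 'X_i.
Proof.
rewrite /coord mxE; congr ('X_ _); apply: val_inj.
by case: i => -[|[|[|[|//]]]] ? /=; rewrite !inordK ?inordK.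
Qed.

Lemma eval_at_generic (R : comAlgType k) (g : 'M[R]_2) :
  map_mx (eval_at g) generic_mx = g.
Proof.
apply/matrixP => i j; rewrite !mxE /eval_at mmapX mmap1U /coord.
by congr (g _ _); apply: val_inj; case: i => -[|[|//]] ?;
  case: j => -[|[|//]] ? /=; rewrite !inordK ?inordK.
Qed.

Lemma eval_at_comp (R : comAlgType k) (g : 'M[R]_2) (h : 'M[{mpoly k[4]}]_2) q :
  eval_at g (eval_at h q) = eval_at (map_mx (eval_at g) h) q.
Proof.
rewrite [eval_at h q]/eval_at /mmap rmorph_sum; apply: eq_bigr => m _.
rewrite rmorphM; congr (_ * _); first by rewrite /= alg_mpolyC eval_atC.
rewrite /mmap1 rmorph_prod; apply: eq_bigr => i _.
by rewrite rmorphXn /= /coord mxE.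
Qed.

End Points.

Section G1T.
Variables (k : closedFieldType) (p : nat).

(* T is the diagonal torus of SL_2, F raises matrix entries to the p-th power *)
(* and G_1T = F^{-1}(T), all as group functors on commutative k-algebras.     *)
Definition in_T (R : comAlgType k) (g : 'M[R]_2) : Prop :=
  \det g = 1 /\ is_diag_mx g.

Definition Frob (R : comAlgType k) (g : 'M[R]_2) : 'M[R]_2 :=
  map_mx (fun x => x ^+ p) g.

Definition in_G1T (R : comAlgType k) (g : 'M[R]_2) : Prop :=
  \det g = 1 /\ in_T (Frob g).

(* The character diag(t, t^-1) |-> t^m of T; it only uses diagonal entries,   *)
(* so that it makes sense as a function on all 2 x 2 matrices.                *)
Definition chi (R : nzRingType) (m : int) (g : 'M[R]_2) : R :=
  match m with
  | Posz n => g 0 0 ^+ n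
  | Negz n => g 1 1 ^+ n.+1
  end.

(* G_1T is closed in the affine space of 2 x 2 matrices, so the matrix        *)
(* coefficients of a finite dimensional (rational) G_1T-module on k^dim are   *)
(* restrictions of polynomials in the coordinates. The group acts on column   *)
(* vectors. Different polynomial matrices may define the same module.         *)
Record G1Tmod := MkG1Tmod {
  dim : nat;
  act : 'M[{mpoly k[4]}]_dim;
  act1 : forall R : comAlgType k, map_mx (eval_at (1%:M : 'M[R]_2)) act = 1%:M;
  actM : forall (R : comAlgType k) (g h : 'M[R]_2), in_G1T g -> in_G1T h ->
    map_mx (eval_at (g *m h)) act
      = map_mx (eval_at g) act *m map_mx (eval_at h) act
}.

Definition act_at (R : comAlgType k) (M : G1Tmod) (g : 'M[R]_2) :
  'M[R]_(dim M) :=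
  map_mx (eval_at g) (act M).

(* Linear maps M -> N are matrices acting on column vectors.                  *)
Definition lin (M N : G1Tmod) := 'M[k]_(dim N, dim M).

Definition is_hom (M N : G1Tmod) (f : lin M N) : Prop :=
  forall (R : comAlgType k) (g : 'M[R]_2), in_G1T g ->
    map_mx (in_alg R) f *m act_at M g = act_at N g *m map_mx (in_alg R) f.

Definition isomorphic (M N : G1Tmod) : Prop :=
  exists f : lin M N, exists g : lin N M,
    [/\ is_hom f, is_hom g, g *m f = 1%:M & f *m g = 1%:M].

Definition projective (P : G1Tmod) : Prop :=
  forall (M N : G1Tmod) (f : lin M N) (h : lin P N),
    is_hom f -> \rank f = dim N -> is_hom h ->
    exists2 l : lin P M, is_hom l & f *m l = h.

Definition has_weight (M : G1Tmod) (m : int) : Prop :=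
  exists2 v : 'cV[k]_(dim M), v != 0 &
    forall (R : comAlgType k) (t : 'M[R]_2), in_T t ->
      act_at M t *m map_mx (in_alg R) v = chi m t *: map_mx (in_alg R) v.

(* The positive root is 2.                                                    *)
Definition highest_weight (M : G1Tmod) (m : int) : Prop :=
  has_weight M m /\
  forall m', has_weight M m' -> exists n : nat, m = m' + (2 * n)%:Z.

(* Direct sums                                                                *)

Section DirectSum.
Variables (r : nat) (M : 'I_r -> G1Tmod).

Let dsum_act : 'M[{mpoly k[4]}]_(\sum_i dim (M i)) := \mxdiag_i act (M i).

Lemma map_dsum_act (R : comAlgType k) (g : 'M[R]_2) :
  map_mx (eval_at g) dsum_act = \mxdiag_i act_at (M i) g.
Proof.
apply/mxblockP => i j; rewrite mxblockK.
rewrite /submxblock -map_mxsub -/(submxblock _ i j) mxblockK.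
have [<-|_] := eqVneq i j; first by rewrite !conform_mx_id.
by apply/matrixP => a b; rewrite !mxE rmorph0.
Qed.

Lemma dsum_act1 (R : comAlgType k) :
  map_mx (eval_at (1%:M : 'M[R]_2)) dsum_act = 1%:M.
Proof.
by rewrite map_dsum_act -mxdiagZ; apply: eq_mxdiag => i; exact: act1.
Qed.

Lemma dsum_actM (R : comAlgType k) (g h : 'M[R]_2) : in_G1T g -> in_G1T h ->
  map_mx (eval_at (g *m h)) dsum_act
    = map_mx (eval_at g) dsum_act *m map_mx (eval_at h) dsum_act.
Proof.
move=> gG hG; rewrite !map_dsum_act {3}/mxdiag mul_mxdiag_mxblock.
rewrite {1}/mxdiag; apply: eq_mxblock => i j.
have [<-|_] := eqVneq i j; last by rewrite mulmx0.
by rewrite !conform_mx_id; exact: actM.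
Qed.

Definition dsum : G1Tmod := MkG1Tmod dsum_act1 dsum_actM.

End DirectSum.

Definition indecomposable (M : G1Tmod) : Prop :=
  (0 < dim M)%N /\
  forall N : 'I_2 -> G1Tmod, isomorphic M (dsum N) -> exists i, dim (N i) = 0%N.

(* N is (a model of) T_1(m).                                                  *)
Definition is_T1 (m : int) (N : G1Tmod) : Prop :=
  [/\ projective N, indecomposable N & highest_weight N m].

(* The orbit W_p . 0; the generating reflections fix -1 and p - 1.            *)
Inductive Wp_dot_0 : int -> Prop :=
| Wp_0 : Wp_dot_0 0
| Wp_refl0 m : Wp_dot_0 m -> Wp_dot_0 (- 2 - m)
| Wp_reflp m : Wp_dot_0 m -> Wp_dot_0 ((2 * p)%:Z - 2 - m).

(* Objects of P_1(0).                                                         *)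
Definition in_P10 (M : G1Tmod) : Prop :=
  exists r : nat, exists N : 'I_r -> G1Tmod,
    isomorphic M (dsum N) /\
    forall i, exists2 m, Wp_dot_0 m & is_T1 m (N i).

(* The dual tau M. The anti-automorphism tau of SL_2 is transposition; tau M  *)
(* is written in the basis dual to the standard basis of k^dim, so that the   *)
(* linear dual of a linear map has the transposed matrix.                     *)

Section TauDual.
Variable M : G1Tmod.

Let tau_act := (act_at M (generic_mx k)^T)^T.

Lemma map_tau_act (R : comAlgType k) (g : 'M[R]_2) :
  map_mx (eval_at g) tau_act = (act_at M g^T)^T.
Proof.
apply/matrixP => i j; rewrite !mxE eval_at_comp; congr (eval_at _ _).
by rewrite -map_trmx eval_at_generic.
Qed.

Lemma tr_in_G1T (R : comAlgType k) (g : 'M[R]_2) : in_G1T g -> in_G1T g^T.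
Proof.
case=> dg [dF /is_diag_mxP diagF]; split; first by rewrite det_tr.
rewrite /Frob -map_trmx; split; first by rewrite det_tr.
by apply/is_diag_mxP => i j ij; rewrite mxE; apply: diagF; rewrite eq_sym.
Qed.

Lemma tau_act1 (R : comAlgType k) :
  map_mx (eval_at (1%:M : 'M[R]_2)) tau_act = 1%:M.
Proof. by rewrite map_tau_act trmx1 /act_at act1 trmx1. Qed.

Lemma tau_actM (R : comAlgType k) (g h : 'M[R]_2) : in_G1T g -> in_G1T h ->
  map_mx (eval_at (g *m h)) tau_act
    = map_mx (eval_at g) tau_act *m map_mx (eval_at h) tau_act.
Proof.
move=> /tr_in_G1T gG /tr_in_G1T hG.
by rewrite !map_tau_act -trmx_mul [(g *m h)^T]trmx_mul /act_at actM.
Qed.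

Definition tau : G1Tmod := MkG1Tmod tau_act1 tau_actM.

End TauDual.

(* Tensoring with one-dimensional modules. A character p l of T extends to    *)
(* G_1T through F, and is then given by the same formula chi (p l).           *)

Hypothesis pchark : p \in [pchar k].

Lemma chi_frob (R : nzRingType) (l : int) (g : 'M[R]_2) :
  chi (p%:Z * l) g = chi l (map_mx (fun x => x ^+ p) g).
Proof.
have p_gt0 := prime_gt0 (pcharf_prime pchark).
case: l => n; first by rewrite -PoszM /= mxE exprM.
rewrite NegzE mulrN -PoszM /= mxE -exprM.
by rewrite -(@prednK (p * n.+1)) ?muln_gt0 ?p_gt0 // -NegzE.
Qed.

Lemma chi_frobM (R : comAlgType k) (l : int) (g h : 'M[R]_2) :
  in_G1T g -> in_G1T h ->
  chi (p%:Z * l) (g *m h) = chi (p%:Z * l) g * chi (p%:Z * l) h.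
Proof.
have pR : p \in [pchar R] by rewrite pchar_lalg.
case=> _ [_ /is_diag_mxP gF] [_ [_ /is_diag_mxP hF]].
rewrite !chi_frob.
have E i : ((g *m h) i i) ^+ p = (g i i) ^+ p * (h i i) ^+ p.
  rewrite mxE -(pFrobenius_autE pR) rmorph_sum (bigD1 i) //= big1 ?addr0.
    by rewrite rmorphM /= !pFrobenius_autE.
  move=> j ji; rewrite rmorphM /= !pFrobenius_autE.
  by have := gF i j; rewrite mxE eq_sym => -> //; rewrite mul0r.
by case: l => n; rewrite /= !mxE -exprMn -E mxE.
Qed.

Section Twist.
Variables (l : int) (M : G1Tmod).

Let twist_act := chi (p%:Z * l) (generic_mx k) *: act M.

Lemma map_twist_act (R : comAlgType k) (g : 'M[R]_2) :
  map_mx (eval_at g) twist_act = chi (p%:Z * l) g *: act_at M g.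
Proof.
have E i j : eval_at g (generic_mx k i j) = g i j.
  by have /matrixP/(_ i j) := eval_at_generic g; rewrite mxE.
by rewrite map_mxZ; case: (p%:Z * l) => n; rewrite /= rmorphXn /= E.
Qed.

Lemma twist_act1 (R : comAlgType k) :
  map_mx (eval_at (1%:M : 'M[R]_2)) twist_act = 1%:M.
Proof.
rewrite map_twist_act /act_at act1.
by case: (p%:Z * l) => n; rewrite /= mxE expr1n scale1r.
Qed.

Lemma twist_actM (R : comAlgType k) (g h : 'M[R]_2) : in_G1T g -> in_G1T h ->
  map_mx (eval_at (g *m h)) twist_act
    = map_mx (eval_at g) twist_act *m map_mx (eval_at h) twist_act.
Proof.
move=> gG hG; rewrite !map_twist_act chi_frobM // /act_at actM //.
by rewrite -scalemxAl -scalemxAr scalerA.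
Qed.

(* M tensored with p l; the underlying vector space is still k^(dim M).       *)
Definition twist : G1Tmod := MkG1Tmod twist_act1 twist_actM.

End Twist.

End G1T.

Section Block.
Variables (k : closedFieldType) (p : nat) (pchark : p \in [pchar k]).
Variables P0 Q0 : G1Tmod k p.

(* (true, m) and (false, m) label P_m and Q_m.                                *)
Definition vertex : Type := bool * int.
Definition vP (m : int) : vertex := (true, m).
Definition vQ (m : int) : vertex := (false, m).
Definition shift (n : int) (v : vertex) : vertex := (v.1, v.2 + n).

Definition vmod (v : vertex) : G1Tmod k p :=
  twist pchark (2 * v.2) (if v.1 then P0 else Q0).

Definition vertex_sum (r : nat) (x : 'I_r -> vertex) : G1Tmod k p :=
  dsum (fun i => vmod (x i)).

Definition one (v : vertex) (_ : 'I_1) : vertex := v.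

(* Tensoring with 2pn changes neither vector spaces nor linear maps.          *)
Definition tens (n : int) (v w : vertex) (f : lin (vmod v) (vmod w)) :
  lin (vmod (shift n v)) (vmod (shift n w)) := f.

Definition tens_sum (n : int) (r s : nat) (x : 'I_r -> vertex)
    (y : 'I_s -> vertex) (f : lin (vertex_sum x) (vertex_sum y)) :
  lin (vertex_sum (fun i => shift n (x i)))
      (vertex_sum (fun j => shift n (y j))) := f.

Definition single (v w : vertex) (f : lin (vmod v) (vmod w)) :
  lin (vertex_sum (one v)) (vertex_sum (one w)) := \mxblock_(_ < 1, _ < 1) f.

Definition incl (r : nat) (x : 'I_r -> vertex) (i : 'I_r) :
  lin (vertex_sum (one (x i))) (vertex_sum x) :=
  \mxrow_(_ < 1) submxrow (1%:M : 'M[k]_(dim (vertex_sum x))) i.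

Definition proj (r : nat) (x : 'I_r -> vertex) (i : 'I_r) :
  lin (vertex_sum x) (vertex_sum (one (x i))) :=
  \mxcol_(_ < 1) submxcol (1%:M : 'M[k]_(dim (vertex_sum x))) i.

(* A choice of symmetric isomorphisms phi_v : vmod v -> tau (vmod v).         *)
Definition iso_family : Type := forall v : vertex, 'M[k]_(dim (vmod v)).

Definition symmetric_isos (phi : iso_family) : Prop :=
  forall v, [/\ is_hom (phi v : lin (vmod v) (tau (vmod v))),
                phi v \in unitmx & (phi v)^T = phi v].

(* phi_(v (x) 2pn) = phi_v (x) 2pn                                            *)
Definition tens_compatible (phi : iso_family) : Prop :=
  forall n v, phi (shift n v) = phi v.

Definition dagger (phi : iso_family) (v w : vertex)
    (f : lin (vmod v) (vmod w)) :
  lin (vmod w) (vmod v) := invmx (phi v) *m f^T *m phi w.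

Definition iso_sum (phi : iso_family) (r : nat) (x : 'I_r -> vertex) :
  'M[k]_(dim (vertex_sum x)) := \mxdiag_i phi (x i).

Definition dagger_sum (phi : iso_family) (r s : nat) (x : 'I_r -> vertex)
    (y : 'I_s -> vertex) (f : lin (vertex_sum x) (vertex_sum y)) :
  lin (vertex_sum y) (vertex_sum x) :=
  invmx (iso_sum phi x) *m f^T *m iso_sum phi y.

Section Generators.
Variables (phi : iso_family).
Variables (u0 : lin P0 Q0) (u1 : lin Q0 (twist pchark 2 P0)).

Definition u_even (m : int) : lin (vmod (vP m)) (vmod (vQ m)) :=
  tens m (v := vP 0) (w := vQ 0) u0.
Definition u_odd (m : int) : lin (vmod (vQ m)) (vmod (vP (m + 1))) :=
  tens m (v := vQ 0) (w := vP 1) u1.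
Definition d_even (m : int) : lin (vmod (vQ m)) (vmod (vP m)) :=
  dagger phi (u_even m).
Definition d_odd (m : int) : lin (vmod (vP (m + 1))) (vmod (vQ m)) :=
  dagger phi (v := vQ m) (w := vP (m + 1)) (u_odd m).

(* The class of morphisms between finite direct sums of P_m's and Q_m's that  *)
(* u0 and u1 generate as a k-linear additive category, with duals and         *)
(* tensoring by 2pn.                                                          *)
Inductive generated : forall (r s : nat) (x : 'I_r -> vertex)
    (y : 'I_s -> vertex), lin (vertex_sum x) (vertex_sum y) -> Prop :=
| Gen_u0 : generated (x := one (vP 0)) (y := one (vQ 0))
    (single (v := vP 0) (w := vQ 0) u0)
| Gen_u1 : generated (x := one (vQ 0)) (y := one (vP 1))
    (single (v := vQ 0) (w := vP 1) u1)
| Gen_id r (x : 'I_r -> vertex) : generated (x := x) (y := x) 1%:M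
| Gen_comp r s t (x : 'I_r -> vertex) (y : 'I_s -> vertex) (z : 'I_t -> vertex)
    (f : lin (vertex_sum x) (vertex_sum y))
    (g : lin (vertex_sum y) (vertex_sum z)) :
    generated f -> generated g -> generated (x := x) (y := z) (g *m f)
| Gen_zero r s (x : 'I_r -> vertex) (y : 'I_s -> vertex) :
    generated (x := x) (y := y) 0
| Gen_lin r s (x : 'I_r -> vertex) (y : 'I_s -> vertex)
    (a : k) (f g : lin (vertex_sum x) (vertex_sum y)) :
    generated f -> generated g -> generated (x := x) (y := y) (a *: f + g)
| Gen_incl r (x : 'I_r -> vertex) i : generated (incl x i)
| Gen_proj r (x : 'I_r -> vertex) i : generated (proj x i)
| Gen_dual r s (x : 'I_r -> vertex) (y : 'I_s -> vertex)
    (f : lin (vertex_sum x) (vertex_sum y)) :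
    generated f -> generated (dagger_sum phi f)
| Gen_tens r s (x : 'I_r -> vertex) (y : 'I_s -> vertex) (n : int)
    (f : lin (vertex_sum x) (vertex_sum y)) :
    generated f -> generated (tens_sum n f).

Definition relations : Prop :=
  let d0 : lin Q0 P0 := d_even 0 in
  let d1 : lin (twist pchark 2 P0) Q0 := d_odd 0 in
  [/\ u1 *m u0 = 0,
      tens 1 (v := vP 0) (w := vQ 0) u0 *m u1 = 0,
      u0 *m d0 = d1 *m u1 &
      u1 *m d1 = tens 1 (v := vP 0) (w := vP 0) (d0 *m u0)].

(* Formal k-linear combinations of composites of the u_i and d_i ...          *)
Inductive arrow : vertex -> vertex -> Type :=
| U_even m : arrow (vP m) (vQ m)
| U_odd m : arrow (vQ m) (vP (m + 1))
| D_even m : arrow (vQ m) (vP m)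
| D_odd m : arrow (vP (m + 1)) (vQ m).

Inductive expr : vertex -> vertex -> Type :=
| Eid v : expr v v
| Egen v w : arrow v w -> expr v w
| Ecomp v w z : expr w z -> expr v w -> expr v z
| Ezero v w : expr v w
| Eadd v w : expr v w -> expr v w -> expr v w
| Escale v w : k -> expr v w -> expr v w.

Definition eval_arrow (v w : vertex) (a : arrow v w) : lin (vmod v) (vmod w) :=
  match a in arrow v w return lin (vmod v) (vmod w) with
  | U_even m => u_even m
  | U_odd m => u_odd m
  | D_even m => d_even m
  | D_odd m => d_odd m
  end.

Fixpoint eval_expr (v w : vertex) (e : expr v w) : lin (vmod v) (vmod w) :=
  match e in expr v w return lin (vmod v) (vmod w) with
  | Eid v => 1%:M
  | Egen _ _ a => eval_arrow a
  | Ecomp _ _ _ e1 e2 => eval_expr e1 *m eval_expr e2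
  | Ezero _ _ => 0
  | Eadd _ _ e1 e2 => eval_expr e1 + eval_expr e2
  | Escale _ _ a e1 => a *: eval_expr e1
  end.

Local Notation UE m := (Egen (U_even m)).
Local Notation UO m := (Egen (U_odd m)).
Local Notation DE m := (Egen (D_even m)).
Local Notation DO m := (Egen (D_odd m)).

(* ... and the congruence on them generated by the four relations, closed     *)
(* under tensoring by 2pn and under duality (which exchanges u_i and d_i and  *)
(* reverses composites; the last two relations are self-dual).                *)
Inductive expr_equiv : forall v w : vertex, expr v w -> expr v w -> Prop :=
| Q_refl v w (a : expr v w) : expr_equiv a a
| Q_sym v w (a b : expr v w) : expr_equiv a b -> expr_equiv b a
| Q_trans v w (a b c : expr v w) :
    expr_equiv a b -> expr_equiv b c -> expr_equiv a c
| Q_comp v w z (a a' : expr w z) (b b' : expr v w) :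
    expr_equiv a a' -> expr_equiv b b' -> expr_equiv (Ecomp a b) (Ecomp a' b')
| Q_add v w (a a' b b' : expr v w) :
    expr_equiv a a' -> expr_equiv b b' -> expr_equiv (Eadd a b) (Eadd a' b')
| Q_scale v w c (a a' : expr v w) :
    expr_equiv a a' -> expr_equiv (Escale c a) (Escale c a')
| Q_idl v w (a : expr v w) : expr_equiv (Ecomp (Eid w) a) a
| Q_idr v w (a : expr v w) : expr_equiv (Ecomp a (Eid v)) a
| Q_compA v w z t (a : expr z t) (b : expr w z) (c : expr v w) :
    expr_equiv (Ecomp a (Ecomp b c)) (Ecomp (Ecomp a b) c)
| Q_addA v w (a b c : expr v w) :
    expr_equiv (Eadd a (Eadd b c)) (Eadd (Eadd a b) c)
| Q_addC v w (a b : expr v w) : expr_equiv (Eadd a b) (Eadd b a)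
| Q_add0 v w (a : expr v w) : expr_equiv (Eadd (Ezero v w) a) a
| Q_scale0 v w (a : expr v w) : expr_equiv (Escale 0 a) (Ezero v w)
| Q_scale1 v w (a : expr v w) : expr_equiv (Escale 1 a) a
| Q_scaleA v w c d (a : expr v w) :
    expr_equiv (Escale c (Escale d a)) (Escale (c * d) a)
| Q_scaleDl v w c d (a : expr v w) :
    expr_equiv (Escale (c + d) a) (Eadd (Escale c a) (Escale d a))
| Q_scaleDr v w c (a b : expr v w) :
    expr_equiv (Escale c (Eadd a b)) (Eadd (Escale c a) (Escale c b))
| Q_compDl v w z (a b : expr w z) (c : expr v w) :
    expr_equiv (Ecomp (Eadd a b) c) (Eadd (Ecomp a c) (Ecomp b c))
| Q_compDr v w z (a : expr w z) (b c : expr v w) :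
    expr_equiv (Ecomp a (Eadd b c)) (Eadd (Ecomp a b) (Ecomp a c))
| Q_compZl v w z c (a : expr w z) (b : expr v w) :
    expr_equiv (Ecomp (Escale c a) b) (Escale c (Ecomp a b))
| Q_compZr v w z c (a : expr w z) (b : expr v w) :
    expr_equiv (Ecomp a (Escale c b)) (Escale c (Ecomp a b))
| Q_uu_even m : expr_equiv (Ecomp (UO m) (UE m)) (Ezero _ _)
| Q_uu_odd m : expr_equiv (Ecomp (UE (m + 1)) (UO m)) (Ezero _ _)
| Q_dd_even m : expr_equiv (Ecomp (DE m) (DO m)) (Ezero _ _)
| Q_dd_odd m : expr_equiv (Ecomp (DO m) (DE (m + 1))) (Ezero _ _)
| Q_ud_even m : expr_equiv (Ecomp (UE m) (DE m)) (Ecomp (DO m) (UO m))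
| Q_ud_odd m :
    expr_equiv (Ecomp (UO m) (DO m)) (Ecomp (DE (m + 1)) (UE (m + 1))).

End Generators.
End Block.

(* Main.v *)
(** A G_1T-module is determined by its weight projections and the operators E
    and F of the two root subgroups, and EF - FE = n on weight vectors of weight
    n. A projective module P is a summand of P (x) St (x) St^*, so that it is
    free over k[E] / (E^p). Hence a highest weight vector v of T_1(la), la = r
    mod p with r <= p - 2, has the form v = E^(r+1) z for a vector z that can be
    adjusted to satisfy E z = (r!)^-2 F^r v. The vectors F^i v and F^i z, i < p,
    are then linearly independent: this is seen by pairing them with the same
    vectors for tau T_1(la). They span a summand, hence all of T_1(la), so the
    action is explicit and a homomorphism f from T_1(la) is determined by f z.

    For weight reasons, the only nonzero spaces of homomorphisms between the P_m
    and Q_m are End(P_m) and End(Q_m), spanned by the identity and an element of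
    square zero, and the lines between neighbours in ... P_m, Q_m, P_(m+1) ....
    Evaluating u_i and d_i on the generators z, the last two relations become
    one and the same equation between nonzero scalars, which holds after
    rescaling u_0, or the form on Q_0, by a square root. Conversely, these
    relations reduce every formal expression to a multiple of an arrow or to a
    combination of an identity and a loop, and those are linearly
    independent. *)

Require Import Defs.
From HB Require Import structures.
From Corelib Require Import Setoid Morphisms.
From mathcomp Require Import all_boot all_order all_algebra.
From mathcomp Require Import mpoly qpoly ring zify mxtens.
Require Import Defs.
Set Implicit Arguments.
Unset Strict Implicit.
Unset Printing Implicit Defensive.
Import GRing.Theory.
Local Open Scope ring_scope.

(** A module is a polynomial matrix evaluated at points over all commutative algebras. Identities
    between operators come from identities in G_1T over k[s, t] / (s^2, t^p): comparing the
    coefficient of one monomial replaces differentiation, and s^p = t^p = 0 is what puts the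
    unipotent points into G_1T. The lowering operator is by definition a transpose of the raising
    operator of the dual, so its properties are obtained by transposing.

    In the structure theory projectivity enters only through a lift of the identity along the
    evaluation P (x) St (x) St^* -> P. Freeness over k[E] / (E^p) is recorded by a linear map D with
    D E - E D = 1; it passes to a summand by compression, although D is no homomorphism.

    The condition p > 2 serves to symmetrize: a homomorphism into the dual and its transpose have
    the same decisive pairing, which doubles in their sum.

    Duals depend on the forms. Multiplying the form on Q_0 by c multiplies d_0 by c and d_1 by c^-1;
    multiplying u_0 by c also multiplies d_0 by c. In both cases the relations become one quadratic
    equation for c, which is why k algebraically closed provides a solution. *)

Local Notation "A ^R" := (map_mx (in_alg _) A) (at level 2).

(** * Test algebras and points of G_1T *)

Section DualNumbers.
Variables (k : closedFieldType) (S : comAlgType k).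

(** A separate type for the algebra S + S eps with eps^2 = 0, since pairs already carry the
    componentwise product. *)
Definition dual : Type := (S * S)%type.
HB.instance Definition _ := GRing.Lmodule.copy dual (S * S)%type.

Definition dual_one : dual := (1, 0).
Definition dual_mul (x y : dual) : dual := (x.1 * y.1, x.1 * y.2 + x.2 * y.1).

Fact dual_mulA : associative dual_mul.
Proof. by move=> x y z; congr pair; rewrite /=; ring. Qed.
Fact dual_mulC : commutative dual_mul.
Proof. by move=> x y; congr pair; rewrite /=; ring. Qed.
Fact dual_mul1 : left_id dual_one dual_mul.
Proof. by case=> x y; congr pair; rewrite /=; ring. Qed.
Fact dual_mulD : left_distributive dual_mul +%R.
Proof. by move=> x y z; congr pair; rewrite /=; ring. Qed.
Fact dual_one_neq0 : dual_one != 0.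
Proof. by apply/eqP => -[/eqP]; rewrite oner_eq0. Qed.

HB.instance Definition _ := GRing.Zmodule_isComNzRing.Build dual
  dual_mulA dual_mulC dual_mul1 dual_mulD dual_one_neq0.

Fact dual_scaleAl (a : k) (x y : dual) : a *: (x * y : dual) = (a *: x : dual) * y.
Proof.
have scaleE (z : dual) : a *: z = (a *: z.1, a *: z.2) by [].
have mulE (u v : dual) : u * v = (u.1 * v.1, u.1 * v.2 + u.2 * v.1) by [].
rewrite mulE !scaleE mulE; congr pair; rewrite /= ?scalerAl //.
by rewrite scalerDr !scalerAl.
Qed.

HB.instance Definition _ := GRing.Lmodule_isLalgebra.Build k dual dual_scaleAl.
HB.instance Definition _ := GRing.Lalgebra_isComAlgebra.Build k dual.

Definition deps (x : S) : dual := (0, x).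
Definition dcst (x : S) : dual := (x, 0).

Lemma dual_mulE (x y : dual) :
  x * y = (x.1 * y.1, x.1 * y.2 + x.2 * y.1) :> dual.
Proof. by []. Qed.

Lemma dual_expE (x : dual) n :
  x ^+ n = (x.1 ^+ n, (x.1 ^+ n.-1 * x.2) *+ n) :> dual.
Proof.
elim: n => [|n IH]; first by rewrite !expr0 mulr0n.
rewrite exprS IH dual_mulE /=; congr pair; rewrite ?exprS //.
rewrite [in RHS]mulrS addrC [x.2 * _]mulrC; congr (_ + _).
by case: n {IH} => [|n]; rewrite ?mulr0n ?mulr0 // mulrnAr mulrA -exprS.
Qed.

End DualNumbers.

Definition mk2 (R : Type) (a b c d : R) : 'M[R]_2 :=
  \matrix_(i, j) if i == 0 then (if j == 0 then a else b)
                 else (if j == 0 then c else d).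

Lemma mk2E (R : Type) (g : 'M[R]_2) : g = mk2 (g 0 0) (g 0 1) (g 1 0) (g 1 1).
Proof.
apply/matrixP => i j; rewrite !mxE.
have o2 (l : 'I_2) : l = if l == 0 then 0 else 1.
  by case: l => -[|[|//]] ?; apply: val_inj.
by rewrite [in LHS](o2 i) [in LHS](o2 j); case: eqP; case: eqP.
Qed.

Lemma map_mk2 (R S : Type) (f : R -> S) a b c d :
  map_mx f (mk2 a b c d) = mk2 (f a) (f b) (f c) (f d).
Proof. by apply/matrixP => i j; rewrite !mxE; case: eqP; case: eqP. Qed.

Lemma tr_mk2 (R : Type) (a b c d : R) : (mk2 a b c d)^T = mk2 a c b d.
Proof. by apply/matrixP => i j; rewrite !mxE; case: eqP; case: eqP. Qed.

Lemma mul_mk2 (R : pzRingType) (a b c d a' b' c' d' : R) :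
  mk2 a b c d *m mk2 a' b' c' d' =
  mk2 (a * a' + b * c') (a * b' + b * d') (c * a' + d * c') (c * b' + d * d').
Proof.
apply/matrixP => i j; rewrite !mxE !big_ord_recl big_ord0 !mxE /= addr0.
by case: eqP; case: eqP.
Qed.

Lemma mk2_1 (R : pzRingType) : mk2 1 0 0 1 = 1%:M :> 'M[R]_2.
Proof.
apply/matrixP => i j; rewrite !mxE.
by case: i => -[|[|//]] ?; case: j => -[|[|//]] ?.
Qed.

Lemma det_mk2 (R : comPzRingType) (a b c d : R) :
  \det (mk2 a b c d) = a * d - b * c.
Proof.
rewrite (expand_det_row _ 0) !big_ord_recl big_ord0 /cofactor !det_mx11 !mxE /=.
by ring.
Qed.

Section Evaluation.
Variables (k : closedFieldType) (R : comAlgType k) (x : R).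

(* [horner_alg x], with the scaling law that makes it a morphism of algebras *)
Definition peval : {poly k} -> R := horner_alg x.

Fact peval_linear : linear peval.
Proof.
by move=> a P Q; rewrite /peval linearP /= mulr_algl.
Qed.
HB.instance Definition _ := GRing.RMorphism.copy peval (horner_alg x).
HB.instance Definition _ := GRing.isLinear.Build k {poly k} R _ peval
  peval_linear.

Lemma pevalX : peval 'X = x. Proof. exact: horner_algX. Qed.

Lemma pevalE (P : {poly k}) K :
  (size P <= K)%N -> peval P = \sum_(n < K) P`_n *: x ^+ n.
Proof.
move=> sP; rewrite /peval /horner_alg /horner_morph.
rewrite (horner_coef_wide _ (n := K)); last first.
  by rewrite (leq_trans (size_poly _ _)).
by apply: eq_bigr => i _; rewrite coef_map /= -scalerAl mul1r.
Qed.

End Evaluation.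

Section Points.
Variables (k : closedFieldType) (p : nat).
Hypothesis pchark : p \in [pchar k].

Let p_gt0 : (0 < p)%N := prime_gt0 (pcharf_prime pchark).

Lemma in_G1T_mk2 (R : comAlgType k) (a b c d : R) :
  in_G1T p (mk2 a b c d) <->
  [/\ a * d - b * c = 1, a ^+ p * d ^+ p = 1, b ^+ p = 0 & c ^+ p = 0].
Proof.
rewrite /in_G1T /in_T /Frob map_mk2 !det_mk2; split.
  case=> D [D' /is_diag_mxP H].
  have := H 0 1 isT; have := H 1 0 isT; rewrite !mxE /= => c0 b0.
  by split=> //; rewrite -D' b0 mul0r subr0.
case=> D D' b0 c0; rewrite b0 c0 mul0r subr0; split=> //; split=> //.
apply/is_diag_mxP => i j; rewrite mxE.
by case: i => -[|[|//]] ?; case: j => -[|[|//]] ?.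
Qed.

Lemma in_T_mk2 (R : comAlgType k) (a d : R) : a * d = 1 -> in_T (mk2 a 0 0 d).
Proof.
move=> ad; split; first by rewrite det_mk2 mul0r subr0.
apply/is_diag_mxP => i j; rewrite mxE.
by case: i => -[|[|//]] ?; case: j => -[|[|//]] ?.
Qed.

Lemma in_T_mk2E (R : comAlgType k) (g : 'M[R]_2) : in_T g ->
  g = mk2 (g 0 0) 0 0 (g 1 1) /\ g 0 0 * g 1 1 = 1.
Proof.
case=> D /is_diag_mxP H; have := mk2E g; rewrite (H 0 1) // (H 1 0) // => gE.
by split=> //; move: D; rewrite [in \det _]gE det_mk2 mul0r subr0.
Qed.

Lemma in_G1T_diag (R : comAlgType k) (a d : R) :
  a * d = 1 -> in_G1T p (mk2 a 0 0 d).
Proof.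
move=> ad; apply/in_G1T_mk2; split.
- by rewrite mul0r subr0.
- by rewrite -exprMn ad expr1n.
- by rewrite expr0n eqn0Ngt p_gt0.
by rewrite expr0n eqn0Ngt p_gt0.
Qed.

Definition up (R : pzRingType) (x : R) : 'M[R]_2 := mk2 1 x 0 1.

Lemma map_up (R S : pzRingType) (f : {rmorphism R -> S}) x :
  map_mx f (up x) = up (f x).
Proof. by rewrite map_mk2 !rmorph0 !rmorph1. Qed.

Lemma in_G1T_up (R : comAlgType k) (x : R) : x ^+ p = 0 -> in_G1T p (up x).
Proof.
move=> x0; apply/in_G1T_mk2; split=> //.
- by rewrite mulr0 subr0 mul1r.
- by rewrite !expr1n mulr1.
by rewrite expr0n eqn0Ngt p_gt0.
Qed.

Lemma eval_at_morph (R S : comAlgType k) (f : {lrmorphism R -> S})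
  (g : 'M[R]_2) q : f (eval_at g q) = eval_at (map_mx f g) q.
Proof.
rewrite /eval_at /mmap rmorph_sum; apply: eq_bigr => m _.
rewrite rmorphM /= linearZ /= rmorph1; congr (_ * _).
rewrite /mmap1 rmorph_prod; apply: eq_bigr => i _.
by rewrite rmorphXn /= /coord mxE.
Qed.

Lemma act_at_morph (R S : comAlgType k) (f : {lrmorphism R -> S})
  (M : G1Tmod k p) (g : 'M[R]_2) :
  map_mx f (act_at M g) = act_at M (map_mx f g).
Proof. by apply/matrixP => i j; rewrite !mxE eval_at_morph. Qed.

Lemma act_atM (R : comAlgType k) (M : G1Tmod k p) (g h : 'M[R]_2) :
  in_G1T p g -> in_G1T p h -> act_at M (g *m h) = act_at M g *m act_at M h.
Proof. exact: actM. Qed.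

Lemma act_at1 (R : comAlgType k) (M : G1Tmod k p) :
  act_at M (1%:M : 'M[R]_2) = 1%:M.
Proof. exact: act1. Qed.

Section Unipotent.
Variable M : G1Tmod k p.

(* [ecoef n] is the action of the divided power E^n / n!. *)
Definition ecoef n : 'M[k]_(dim M) :=
  \matrix_(i, j) (act_at M (up ('X : {poly k})) i j)`_n.

(** Every [up x] is a specialization of the universal point [up 'X] over k[X]. The bound K dominates
    the degrees of its finitely many matrix entries, and p <= K allows the sum to be cut at p when
    x^p = 0. *)
Lemma act_up_bound : exists K, (p <= K)%N /\
  forall (R : comAlgType k) (x : R),
  act_at M (up x) = \sum_(n < K) x ^+ n *: (ecoef n)^R.
Proof.
set A := act_at M (up ('X : {poly k})).
exists (maxn p (\max_i \max_j size (A i j))); split; first exact: leq_maxl.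
move=> R x; have -> : up x = map_mx (peval x) (up 'X).
  by rewrite map_up /= pevalX.
rewrite -(act_at_morph (peval x)); apply/matrixP => i j; rewrite mxE /= -/A summxE.
rewrite (@pevalE _ _ _ _ (maxn p (\max_i \max_j size (A i j)))).
  by apply: eq_bigr => n _; rewrite !mxE mulr_algr.
by rewrite leq_max (leq_trans _ (leq_bigmax i)) ?orbT // (leq_bigmax j).
Qed.

Lemma act_up (R : comAlgType k) (x : R) : x ^+ p = 0 ->
  act_at M (up x) = \sum_(n < p) x ^+ n *: (ecoef n)^R.
Proof.
move=> x0; have [K [pK ->]] := act_up_bound.
rewrite -(big_mkord xpredT (fun n => x ^+ n *: (ecoef n)^R)).
rewrite (big_cat_nat (leq0n p) pK) /= big_mkord.
rewrite [X in _ + X]big_nat_cond [X in _ + X]big1 ?addr0 // => n.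
by rewrite andbT => /andP[pn _]; rewrite -(subnK pn) exprD x0 mulr0 scale0r.
Qed.

End Unipotent.

End Points.

(** * Root vectors and weight projections *)

Section Coefficients.
Variables (k : closedFieldType) (R : comAlgType k).

Lemma map_lin_scale (f : {linear R -> k^o}) m n (z : R) (A : 'M[k]_(m, n)) :
  map_mx f (z *: A^R) = f z *: A :> 'M[k]_(m, n).
Proof.
by apply/matrixP => i j; rewrite !mxE mulr_algr linearZ /= [RHS]mulrC.
Qed.

Lemma map_lin_sum (f : {linear R -> k^o}) m n I (r : seq I) (P : pred I)
    (z : I -> R) (A : I -> 'M[k]_(m, n)) :
  map_mx f (\sum_(i <- r | P i) z i *: (A i)^R)
    = \sum_(i <- r | P i) f (z i) *: A i :> 'M[k]_(m, n).
Proof. by rewrite map_mx_sum; apply: eq_bigr => i _; rewrite map_lin_scale. Qed.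

Lemma alg_mxM m n l (A : 'M[k]_(m, n)) (B : 'M[k]_(n, l)) :
  (A *m B)^R = A^R *m B^R :> 'M[R]_(m, l).
Proof. exact: map_mxM. Qed.

End Coefficients.

Lemma sum_ord1 (V : nmodType) n j (F : nat -> V) : (j < n)%N ->
  (forall i, (i < n)%N -> i != j -> F i = 0) -> \sum_(i < n) F i = F j.
Proof.
move=> jn F0; rewrite (bigD1 (Ordinal jn)) //= big1 ?addr0 // => i ij.
by apply: F0 => //; apply: contra ij => /eqP ij; apply/eqP/val_inj.
Qed.

Lemma fact_neq0 (k : fieldType) p n : p \in [pchar k] -> (n < p)%N ->
  n`!%:R != 0 :> k.
Proof.
move=> pchark; elim: n => [|n IH] np; first by rewrite oner_eq0.
rewrite factS natrM mulf_neq0 ?IH 1?ltnW //.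
by rewrite -(dvdn_pcharf pchark) gtnNdvd.
Qed.

Section TestAlgebra.
Variables (k : closedFieldType) (p : nat).
Hypothesis pchark : p \in [pchar k].

Let p_gt1 : (1 < p)%N := prime_gt1 (pcharf_prime pchark).

Definition trunc : comAlgType k := {poly %/ ('X^p : {poly k})}.
Definition tx : trunc := in_qpoly 'X^p 'X.

Definition tcoef (j : nat) (z : trunc) : k^o := (polyn z)`_j.
Fact tcoef_linear j : linear (tcoef j).
Proof. by move=> a x y; rewrite /tcoef /= coefD coefZ. Qed.
HB.instance Definition _ j := GRing.isLinear.Build k trunc k^o _ (tcoef j)
  (tcoef_linear j).

Lemma txX n : tx ^+ n = in_qpoly 'X^p 'X^n.
Proof. by rewrite /tx -rmorphXn. Qed.

Lemma mk_monicXp : mk_monic 'X^p = 'X^p :> {poly k}.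
Proof. by rewrite mk_monic_Xn prednK // ltnW. Qed.

Lemma tcoefX j n : (n < p)%N -> tcoef j (tx ^+ n) = (j == n)%:R.
Proof.
move=> np; rewrite /tcoef txX in_qpoly_small ?coefXn //.
by rewrite mk_monicXp !size_polyXn.
Qed.

Lemma tx_nilp : tx ^+ p = 0.
Proof.
rewrite txX; apply: val_inj; rewrite /= mk_monicXp.
by rewrite Pdiv.RingMonic.rmodpp ?monicXn.
Qed.

(* W = k[s, t] / (s^2, t^p) *)
Local Notation W := (dual trunc).
Definition ws : W := deps 1.
Definition wt : W := dcst tx.

(** The linear form that reads off the coefficient of s^b t^j. *)
Definition wcoef (b : bool) (j : nat) (z : W) : k^o :=
  tcoef j (if b then z.2 else z.1).
Fact wcoef_linear b j : linear (wcoef b j).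
Proof. by move=> a x y; rewrite /wcoef; case: b; rewrite linearP. Qed.
HB.instance Definition _ b j := GRing.isLinear.Build k W k^o _ (wcoef b j)
  (wcoef_linear b j).

Lemma ws2 : ws ^+ 2 = 0.
Proof. by rewrite expr2 dual_mulE /= !mulr0 mul0r addr0. Qed.

Lemma wt_nilp : wt ^+ p = 0.
Proof. by rewrite dual_expE /= tx_nilp mulr0 mul0rn. Qed.

Lemma wsX_nilp n : (1 < n)%N -> ws ^+ n = 0.
Proof. by move=> n1; rewrite -(subnK n1) exprD ws2 mulr0. Qed.

Lemma wcoef_st b j m n : (n < p)%N ->
  wcoef b j (ws ^+ m * wt ^+ n) = ((m == b) && (j == n))%:R.
Proof.
move=> np; have wtE : wt ^+ n = (tx ^+ n, 0) by rewrite dual_expE mulr0 mul0rn.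
case: m => [|[|m]]; last by rewrite wsX_nilp // mul0r linear0; case: b.
  rewrite expr0 mul1r wtE /wcoef; case: b => /=; first by rewrite linear0.
  by rewrite tcoefX.
rewrite expr1 dual_mulE wtE /wcoef mul0r mulr0 add0r mul1r.
by case: b => /=; rewrite ?linear0 ?tcoefX.
Qed.

(** The interface through which k[s, t] / (s^2, t^p) is used from here on. Exponents m > 1 of s are
    covered as well: both sides are then 0, as b is 0 or 1. *)
Lemma test_algebra : exists (R : comAlgType k) (s t : R)
    (c : bool -> nat -> {linear R -> k^o}),
  [/\ s ^+ 2 = 0, t ^+ p = 0 & forall b j m n, (n < p)%N ->
      c b j (s ^+ m * t ^+ n) = ((m == b) && (j == n))%:R].
Proof.
exists W, ws, wt, (fun b j => wcoef b j : {linear _ -> _}).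
split; [exact: ws2 | exact: wt_nilp | exact: wcoef_st].
Qed.

Lemma expr_nilp (R : pzRingType) (x : R) m n :
  x ^+ m = 0 -> (m <= n)%N -> x ^+ n = 0.
Proof. by move=> x0 mn; rewrite -(subnK mn) exprD x0 mulr0. Qed.

Lemma exprD_square0 (R : comPzRingType) (s t : R) n : s ^+ 2 = 0 ->
  (s + t) ^+ n.+1 = t ^+ n.+1 + s * t ^+ n *+ n.+1.
Proof.
move=> s2; elim: n => [|n IH]; first by rewrite !expr1 expr0 mulr1 addrC.
have ss : s * s = 0 by rewrite -expr2.
rewrite exprS IH -[s * t ^+ n *+ _]mulr_natr -[s * _ *+ n.+2]mulr_natr.
rewrite [n.+2%:R]mulrS !exprS; set N := n.+1%:R.
by rewrite -[RHS]addr0 -(mul0r (t ^+ n * N)) -ss; ring.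
Qed.

End TestAlgebra.

(** * Divided powers of the raising operator *)

Section Raising.
Variables (k : closedFieldType) (p : nat).
Hypothesis pchark : p \in [pchar k].
Let p_gt1 : (1 < p)%N := prime_gt1 (pcharf_prime pchark).
Variable M : G1Tmod k p.
Local Notation W := (dual (trunc k p)).

Definition Eop : 'M[k]_(dim M) := ecoef M 1.

Lemma up0 (R : pzRingType) : up 0 = 1%:M :> 'M[R]_2.
Proof. exact: mk2_1. Qed.

Lemma ecoef0 : ecoef M 0 = 1%:M.
Proof.
have := act_at1 (k^o : comAlgType k) M; rewrite -up0 => act0.
have x0 : (0 : k^o) = peval (0 : k^o) 'X by rewrite pevalX.
have E0 P : peval (0 : k^o) P = P`_0.
  rewrite (pevalE _ (leqnSn (size P))) big_ord_recl expr0 big1 ?addr0.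
    by rewrite /GRing.scale /= mulr1.
  by move=> i _; rewrite exprS mul0r scaler0.
apply/matrixP => i j; have := congr1 (fun A : 'M[k^o]_(dim M) => A i j) act0.
rewrite {1}x0 -(map_up (peval (0 : k^o))) -(act_at_morph (peval (0 : k^o))).
by rewrite [in LHS]mxE /= E0 => <-; rewrite !mxE.
Qed.

Lemma upD (R : pzRingType) (x y : R) : up (x + y) = up x *m up y.
Proof. by rewrite mul_mk2 !(mul1r, mulr1, mul0r, mulr0, addr0, add0r) addrC. Qed.

(** Compare the coefficients of s t^j in [up (s + t) = up s *m up t]. For j = p - 1 the scalar on
    the right is p = 0, and this is the source of E^p = 0. *)
Lemma ecoefS j : (j < p)%N -> Eop *m ecoef M j = j.+1%:R *: ecoef M j.+1.
Proof.
move=> jp; have [R [s [t [c [s2 tp cE]]]]] := test_algebra pchark.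
have sp : s ^+ p = 0 by apply: expr_nilp s2 _.
(* The power equals t^p + p s t^(p-1), and p = 0 in k. *)
have stp : (s + t) ^+ p = 0.
  rewrite -(ltn_predK p_gt1) exprD_square0 // (ltn_predK p_gt1) tp add0r.
  by rewrite -mulr_natr -scaler_nat (pcharf0 pchark) scale0r mulr0.
have cst n : (n < p)%N -> c true j ((s + t) ^+ n) = ((j.+1 == n) * n)%:R.
  case: n => [|n] np.
    by have := cE true j 0 0 np; rewrite expr0 mul1r expr0.
  rewrite exprD_square0 // linearD linearMn /= -[t ^+ n.+1]mul1r -(expr0 s).
  rewrite cE // -[s in s * _]expr1 cE 1?ltnW //= add0r eqSS.
  by case: eqP => _; rewrite ?mul1n ?mul0n ?mul0rn.
have := act_atM M (in_G1T_up pchark sp) (in_G1T_up pchark tp).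
rewrite -upD !act_up //.
set A := RHS; have -> : A = \sum_(m < p) \sum_(n < p)
    (s ^+ m * t ^+ n) *: (ecoef M m *m ecoef M n)^R.
  rewrite /A mulmx_suml; apply: eq_bigr => m _; rewrite mulmx_sumr.
  by apply: eq_bigr => n _; rewrite alg_mxM -scalemxAl -scalemxAr scalerA.
move/(congr1 (map_mx (c true j))); rewrite map_lin_sum map_mx_sum /=.
under eq_bigr => n _ do rewrite cst //.
under [RHS]eq_bigr => m _ do rewrite map_lin_sum.
rewrite [RHS](sum_ord1 (j := 1) _ (F := fun m => \sum_(n < p)
  c true j (s ^+ m * t ^+ n) *: (ecoef M m *m ecoef M n))) //;
  last first.
  move=> m _ m1; apply: big1 => n _; rewrite cE //.
  by rewrite (negPf m1) scale0r.
rewrite [RHS](sum_ord1 jp (F := fun n =>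
  c true j (s ^+ 1 * t ^+ n) *: (ecoef M 1 *m ecoef M n)));
  last first.
  by move=> n np nj; rewrite cE // [j == n]eq_sym (negPf nj) andbF scale0r.
rewrite cE // !eqxx scale1r => <-.
have [jp1|] := ltnP j.+1 p.
  rewrite (sum_ord1 jp1 (F := fun n => ((j.+1 == n) * n)%:R *: ecoef M n)).
    by rewrite eqxx mul1n.
  by move=> n _ nj; rewrite eq_sym (negPf nj) scale0r.
move=> pj; have -> : j.+1 = p by apply/eqP; rewrite eqn_leq jp.
rewrite (pcharf0 pchark) scale0r big1 // => n _.
by rewrite gtn_eqF ?scale0r.
Qed.

Lemma Eop_exp n : (n <= p)%N -> Eop ^+ n = n`!%:R *: ecoef M n.
Proof.
elim: n => [|n IH] np; first by rewrite expr0 ecoef0 scale1r.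
rewrite exprS IH 1?ltnW // -mulmxE -scalemxAr ecoefS //.
by rewrite scalerA -natrM mulnC.
Qed.

Lemma Eop_nilp : Eop ^+ p = 0.
Proof.
rewrite Eop_exp // (_ : p`!%:R = 0) ?scale0r //; apply/eqP.
by rewrite -(dvdn_pcharf pchark) dvdn_fact // ltnW //=.
Qed.

Lemma ecoefE n : (n < p)%N -> ecoef M n = n`!%:R^-1 *: Eop ^+ n.
Proof. by move=> np; rewrite Eop_exp 1?ltnW // scalerK ?(fact_neq0 pchark). Qed.

End Raising.

(** * Weight spaces from the torus action *)

Section Torus.
Variables (k : closedFieldType) (p : nat).
Variable M : G1Tmod k p.

Local Notation mn m i := ((m : 'X_{1..4}) (inord i)).

Definition laurent N (q : {mpoly k[4]}) : {poly k} :=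
  \sum_(m <- msupp q)
    (q@_m *+ (((mn m 1 == 0) && (mn m 2 == 0))%N)) *: 'X^(N + mn m 0 - mn m 3).

Lemma mnm_le (m : 'X_{1..4}) i : (m i <= mdeg m)%N.
Proof. by rewrite mdegE (bigD1 i) //= leq_addr. Qed.

Lemma size_laurent N q : (msize q <= N)%N ->
  (size (laurent N q) <= N.*2.+1)%N.
Proof.
move=> qN; rewrite /laurent big_seq; apply: (leq_trans (size_sum _ _ _)).
apply/bigmax_leqP_seq => m mq _; apply: leq_trans (size_scale_leq _ _) _.
rewrite size_polyXn ltnS -addnn.
by have := leq_trans (msize_mdeg_lt mq) qN; have := mnm_le m (inord 0); lia.
Qed.

Lemma prod4 (R : comPzRingType) (F : 'I_4 -> R) :
  \prod_i F i = F (inord 0) * F (inord 1) * F (inord 2) * F (inord 3).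
Proof.
rewrite !big_ord_recl big_ord0 mulr1 !mulrA.
by do !congr (_ * _); congr (F _); apply: val_inj; rewrite /= inordK.
Qed.

Lemma eval_at_diag (R : comAlgType k) (a d : R) N q :
  a * d = 1 -> (msize q <= N)%N ->
  eval_at (mk2 a 0 0 d) q = d ^+ N * peval a (laurent N q).
Proof.
move=> ad qN; rewrite /laurent linear_sum mulr_sumr /eval_at /mmap.
apply: eq_big_seq => m mq; rewrite /mmap1 prod4 linearZ rmorphXn /= pevalX.
rewrite /coord !mxE !inordK //=.
have o (i j : 'I_2) : (i == j) = (i == j :> nat) by [].
rewrite !o !inordK //=.
have m3 : (mn m 3 <= N)%N.
  apply: leq_trans (mnm_le _ _) (ltnW (leq_trans (msize_mdeg_lt mq) qN)).
rewrite !expr0n; case: eqP => _; last by rewrite mulr0n !(mulr0, mul0r) scale0r mulr0.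
case: eqP => _; last by rewrite mulr0n !(mulr0, mul0r) scale0r mulr0.
rewrite !mulr1 mulr1n mulr_algl -scalerAr; congr (_ *: _).
rewrite [(N + _)%N]addnC -addnBA // exprD -[in d ^+ N](subnK m3) exprD.
have adX : a ^+ (N - mn m 3) * d ^+ (N - mn m 3) = 1.
  by rewrite -exprMn ad expr1n.
by rewrite -[LHS]mulr1 -adX; ring.
Qed.

Definition tdeg : nat := \max_i \max_j msize (act M i j).

Lemma tdegP i j : (msize (act M i j) <= tdeg)%N.
Proof. by rewrite (leq_trans _ (leq_bigmax i)) // (leq_bigmax j). Qed.

(* The projection of M onto its weight space of weight n. *)
Definition wp (n : int) : 'M[k]_(dim M) := \matrix_(i, j)
  if n + tdeg%:Z is Posz l then (laurent tdeg (act M i j))`_l else 0.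

Lemma act_diag (R : comAlgType k) (a d : R) : a * d = 1 ->
  act_at M (mk2 a 0 0 d) = \sum_(l < tdeg.*2.+1)
    (a ^+ l * d ^+ tdeg) *: (wp (l%:Z - tdeg%:Z))^R.
Proof.
move=> ad; apply/matrixP => i j; rewrite mxE (eval_at_diag ad (tdegP i j)).
rewrite (pevalE _ (size_laurent (tdegP i j))) mulr_sumr summxE.
by apply: eq_bigr => l _; rewrite !mxE subrK mulr_algr -scalerAr mulrC.
Qed.

Lemma chi_diag (R : comAlgType k) (a d : R) l : a * d = 1 ->
  a ^+ l * d ^+ tdeg = chi (l%:Z - tdeg%:Z) (mk2 a 0 0 d).
Proof.
move=> ad; have adX n : a ^+ n * d ^+ n = 1 by rewrite -exprMn ad expr1n.
have [le_l|lt_l] := leqP tdeg l.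
  rewrite -[in LHS](subnK le_l) exprD -mulrA adX mulr1 subzn //.
  by rewrite /chi mxE.
have -> : l%:Z - tdeg%:Z = Negz (tdeg - l).-1 by lia.
rewrite /chi prednK ?subn_gt0 // mxE /= -[in LHS](subnK (ltnW lt_l)) exprD.
by rewrite mulrCA adX mulr1.
Qed.

Lemma wp_bound n : (tdeg < `|n|)%N -> wp n = 0.
Proof.
move=> nN; apply/matrixP => i j; rewrite !mxE.
case E : (n + tdeg%:Z) => [l|//]; rewrite nth_default //.
by apply: leq_trans (size_laurent (tdegP i j)) _; lia.
Qed.

Definition wts : seq int := [seq l%:Z - tdeg%:Z | l <- index_iota 0 tdeg.*2.+1].

Lemma wts_uniq : uniq wts.
Proof. by rewrite map_inj_uniq ?iota_uniq // => l m /addIr [->]. Qed.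

Lemma mem_wts n : (n \in wts) = (`|n| <= tdeg)%N.
Proof.
apply/mapP/idP => [[l] | nN]; first by rewrite mem_index_iota => lN ->; lia.
by exists (absz (n + tdeg%:Z)); [rewrite mem_index_iota; lia | lia].
Qed.

Lemma act_torus (R : comAlgType k) (a d : R) : a * d = 1 ->
  act_at M (mk2 a 0 0 d) = \sum_(n <- wts) chi n (mk2 a 0 0 d) *: (wp n)^R.
Proof.
move=> ad; rewrite act_diag // big_map big_mkord.
by apply: eq_bigr => l _; rewrite chi_diag.
Qed.

End Torus.

Lemma sum_uniq1 (V : nmodType) (T : eqType) (s : seq T) n (F : T -> V) :
  uniq s -> n \in s -> (forall x, x != n -> F x = 0) -> \sum_(x <- s) F x = F n.
Proof.
move=> Us ns F0; rewrite (perm_big _ (perm_to_rem ns)) big_cons.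
rewrite big_seq big1 /= ?addr0 // => x.
by rewrite mem_rem_uniq // inE => /andP[/F0].
Qed.

(** Multiplication by t^N, with N a bound for all exponents, turns each entry of the relation into a
    polynomial vanishing at all t != 0, hence zero over an infinite field. *)
Lemma laurent_indep (k : closedFieldType) m n (s : seq int)
    (A : int -> 'M[k]_(m, n)) : uniq s ->
  (forall t : k, t != 0 -> \sum_(l <- s) t ^ l *: A l = 0) ->
  forall l, l \in s -> A l = 0.
Proof.
move=> Us H l ls; apply/matrixP => i j; rewrite mxE.
pose N := \max_(x <- s) `|x|%N.
have Ns x : x \in s -> (`|x| <= N)%N by move=> xs; rewrite /N leq_bigmax_seq.
pose e (x : int) := absz (x + N%:Z).
have es x : x \in s -> (e x)%:Z = x + N%:Z.
  by move=> /Ns xN; rewrite /e; lia.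
pose P : {poly k} := \sum_(x <- s) A x i j *: 'X^(e x).
have P0 : P = 0.
  apply/eqP; apply: contraT => Pn0.
  (* The factor X forces the chosen nonroot t to be different from 0. *)
  have /closed_nonrootP[t] : P * 'X != 0 by rewrite mulf_neq0 ?polyX_eq0.
  rewrite rootM rootX negb_or => /andP[Pt t0]; case/negP: Pt; apply/rootP.
  have /matrixP/(_ i j) := H t t0; rewrite summxE !mxE => E.
  rewrite -[RHS](mulr0 (t ^+ N)) -E mulr_sumr /P horner_sum.
  apply: eq_big_seq => x xs; rewrite !hornerE !mxE [RHS]mulrA [RHS]mulrC.
  congr (_ * _).
  by rewrite [t ^+ e x]exprnP es // exprzDr ?unitfE // mulrC.
have := coef0 k (e l); rewrite -P0 /P coef_sum (big_rem l) //= big_seq big1.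
  by rewrite addr0 coefZ coefXn eqxx mulr1.
move=> x; rewrite mem_rem_uniq // inE => /andP[xl xs].
rewrite coefZ coefXn (_ : (_ == _) = false) ?mulr0 //.
by apply: contraNF xl; rewrite -eqz_nat !es // => /eqP /addIr ->.
Qed.

Section Weights.
Variables (k : closedFieldType) (p : nat).
Hypothesis pchark : p \in [pchar k].

Definition tor (M : G1Tmod k p) (t : k) : 'M[k]_(dim M) :=
  act_at (R := k^o) M (mk2 t 0 0 t^-1).

Lemma chi_expz (t : k) n : chi n (mk2 (t : k^o) 0 0 t^-1) = t ^ n.
Proof.
by case: n => n /=; rewrite mxE //= exprVn.
Qed.

Section OneModule.
Variable M : G1Tmod k p.
Local Notation tor := (tor M).
Local Notation wp := (wp M).
Local Notation wts := (wts M).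

Lemma alg_mx_id m n (A : 'M[k]_(m, n)) : map_mx (in_alg k^o) A = A.
Proof. by apply/matrixP => i j; rewrite mxE /= /GRing.scale /= mulr1. Qed.

Lemma torE t : t != 0 -> tor t = \sum_(n <- wts) t ^ n *: wp n.
Proof.
move=> t0; rewrite /tor act_torus; last exact: mulfV.
by apply: eq_bigr => n _; rewrite chi_expz alg_mx_id.
Qed.

Lemma torM t s : t != 0 -> s != 0 -> tor (t * s) = tor t *m tor s.
Proof.
move=> t0 s0.
have G u : u != 0 -> in_G1T p (mk2 (u : k^o) 0 0 u^-1).
  by move=> u0; apply: in_G1T_diag => //; exact: mulfV.
apply: etrans (act_atM M (G t t0) (G s s0)).
by rewrite mul_mk2 !(mulr0, mul0r, addr0, add0r) /tor invfM.
Qed.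

Lemma wp_notin n : n \notin wts -> wp n = 0.
Proof. by rewrite mem_wts -ltnNge => /wp_bound. Qed.

(** Compare the coefficients of the powers of t in [tor (t * s) = tor t *m tor s], for fixed s. *)
Lemma wp_tor n s : s != 0 -> wp n *m tor s = s ^ n *: wp n.
Proof.
move=> s0; have [nw|/wp_notin->] := boolP (n \in wts); last first.
  by rewrite mul0mx scaler0.
apply/eqP; rewrite -subr_eq0; apply/eqP.
apply: (laurent_indep (wts_uniq M)
  (A := fun n => wp n *m tor s - s ^ n *: wp n)) nw => t t0.
apply/eqP; under eq_bigr do rewrite scalerBr; rewrite sumrB subr_eq0.
apply/eqP; transitivity (tor t *m tor s).
  by rewrite (torE t0) mulmx_suml; apply: eq_bigr => l _; rewrite scalemxAl.
rewrite -torM // torE ?mulf_neq0 //; apply: eq_bigr => l _.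
by rewrite expfzMl scalerA.
Qed.

Lemma tor_wp n s : s != 0 -> tor s *m wp n = s ^ n *: wp n.
Proof.
move=> s0; have [nw|/wp_notin->] := boolP (n \in wts); last first.
  by rewrite mulmx0 scaler0.
apply/eqP; rewrite -subr_eq0; apply/eqP.
apply: (laurent_indep (wts_uniq M)
  (A := fun n => tor s *m wp n - s ^ n *: wp n)) nw => t t0.
apply/eqP; under eq_bigr do rewrite scalerBr; rewrite sumrB subr_eq0.
apply/eqP; transitivity (tor s *m tor t).
  by rewrite (torE t0) mulmx_sumr; apply: eq_bigr => l _; rewrite scalemxAr.
rewrite -torM // torE ?mulf_neq0 //; apply: eq_bigr => l _.
by rewrite expfzMl scalerA mulrC.
Qed.

Lemma expz_sep (m n : int) : m != n -> exists2 t : k, t != 0 & t ^ m != t ^ n.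
Proof.
move=> mn; pose P : {poly k} := 'X^(absz (m - n)) - 1.
have e0 : absz (m - n) != 0%N by rewrite absz_eq0 subr_eq0.
have P0 : P != 0 by rewrite -size_poly_eq0 size_XnsubC ?lt0n.
have /closed_nonrootP[t] : P * 'X != 0 by rewrite mulf_neq0 ?polyX_eq0.
rewrite rootM rootX negb_or /root !hornerE subr_eq0 => /andP[Pt t0].
exists t => //; apply: contraNneq Pt => tmn.
have tx : t ^ (m - n) = 1 by rewrite expfzDr // tmn -expfzDr // subrr.
move: tx; case: (m - n) => l /=; first by rewrite -exprnP => ->.
by rewrite NegzE /= => /(congr1 GRing.inv); rewrite invrK invr1 => ->.
Qed.

(** For m != n, evaluating [wp m *m tor t *m B] in two ways gives t^m = t^n unless the product of
    [wp m] and B is 0, and t can be chosen to separate the two powers. The case m = n follows since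
    the projections add up to the identity. *)
Lemma wp_eigen n r (B : 'M[k]_(dim M, r)) :
  (forall t, t != 0 -> tor t *m B = t ^ n *: B) ->
  forall m, wp m *m B = if m == n then B else 0.
Proof.
move=> HB.
have H0 m : m != n -> wp m *m B = 0.
  move=> /expz_sep[t t0 tmn]; have := congr1 (mulmx (wp m)) (HB t t0).
  rewrite mulmxA wp_tor // -scalemxAl -scalemxAr => /eqP.
  by rewrite -subr_eq0 -scalerBl scaler_eq0 subr_eq0 (negPf tmn) => /eqP.
move=> m; have [->|/H0//] := eqVneq m n.
have := HB 1 (oner_neq0 _); rewrite exp1rz scale1r torE ?oner_neq0 // mulmx_suml.
under eq_bigr do rewrite exp1rz scale1r.
have [nw|nw] := boolP (n \in wts).
  by rewrite (sum_uniq1 (wts_uniq M) nw).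
rewrite big_seq big1 => [<-|x xw]; first by rewrite mulmx0.
by apply: H0; apply: contraNneq nw => <-.
Qed.

Lemma wpM m n : wp m *m wp n = if m == n then wp n else 0.
Proof. by apply: wp_eigen => t t0; exact: tor_wp. Qed.

Lemma wp_sum : \sum_(n <- wts) wp n = 1%:M.
Proof.
have <- : tor 1 = 1%:M.
  by rewrite /tor invr1 mk2_1 act_at1.
by rewrite torE ?oner_neq0 //; apply: eq_bigr => n _; rewrite exp1rz scale1r.
Qed.

Lemma act_diag_wp (R : comAlgType k) (a d : R) n : a * d = 1 ->
  act_at M (mk2 a 0 0 d) *m (wp n)^R = chi n (mk2 a 0 0 d) *: (wp n)^R.
Proof.
move=> ad; rewrite act_torus // mulmx_suml.
have [nw|/wp_notin->] := boolP (n \in wts); last first.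
  by rewrite map_mx0 scaler0 big1 // => x _; rewrite mulmx0.
rewrite (sum_uniq1 (wts_uniq M) nw) => [|x xn].
  by rewrite -scalemxAl -alg_mxM wpM eqxx.
by rewrite -scalemxAl -alg_mxM wpM (negPf xn) map_mx0 scaler0.
Qed.

(** Serves to identify the weight projections of duals and of twists, whose polynomial matrices, and
    hence whose degree bounds [tdeg], differ from those of M. *)
Lemma wp_uniq (s : seq int) (B : int -> 'M[k]_(dim M)) : uniq s ->
  \sum_(n <- s) B n = 1%:M ->
  (forall n, n \notin s -> B n = 0) ->
  (forall n t, t != 0 -> tor t *m B n = t ^ n *: B n) -> forall n, wp n = B n.
Proof.
move=> Us sB B0 HB n; rewrite -[LHS]mulmx1 -sB mulmx_sumr.
have [ns|ns] := boolP (n \in s).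
  rewrite (sum_uniq1 Us ns) => [|x xn].
    by rewrite (wp_eigen (HB n)) eqxx.
  by rewrite (wp_eigen (HB x)) eq_sym (negPf xn).
rewrite B0 // big_seq big1 // => x xs; rewrite (wp_eigen (HB x)).
by case: eqP => // nx; rewrite nx xs in ns.
Qed.

End OneModule.

End Weights.

(** * Root subgroups, torus and the dual module *)

Section Operators.
Variables (k : closedFieldType) (p : nat).
Hypothesis pchark : p \in [pchar k].
Let p_gt1 : (1 < p)%N := prime_gt1 (pcharf_prime pchark).
Local Notation W := (dual (trunc k p)).

Lemma wp_ext (M : G1Tmod k p) m (A B : 'M[k]_(m, dim M)) :
  (forall n, A *m wp M n = B *m wp M n) -> A = B.
Proof.
move=> AB; rewrite -[A]mulmx1 -[B]mulmx1 -wp_sum !mulmx_sumr.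
by apply: eq_bigr => n _; exact: AB.
Qed.

Lemma alg_mxZ (R : comAlgType k) m n c (A : 'M[k]_(m, n)) :
  (c *: A)^R = c%:A *: A^R :> 'M[R]_(m, n).
Proof. by apply/matrixP => i j; rewrite !mxE /= mulr_algl scalerA. Qed.

Lemma algX (R : comAlgType k) (t : k) n : (t ^+ n)%:A = t%:A ^+ n :> R.
Proof. exact: (rmorphXn (in_alg R) n t). Qed.

Lemma act_tor (R : comAlgType k) (M : G1Tmod k p) t : t != 0 ->
  act_at M (mk2 (t%:A : R) 0 0 (t^-1)%:A) = (tor M t)^R.
Proof.
move=> t0; have tR : t%:A * t^-1%:A = 1 :> R.
  by rewrite mulr_algl scalerA mulfV // scale1r.
rewrite (act_torus M tR) torE // map_mx_sum; apply: eq_bigr => n _.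
rewrite alg_mxZ; congr (_ *: _).
case: n => n /=; rewrite mxE /=; first by rewrite -exprnP algX.
by have -> : t ^ Negz n = t^-1 ^+ n.+1; rewrite ?algX ?exprVn.
Qed.

Section OneModule.
Variable M : G1Tmod k p.
Local Notation E := (Eop M).

(** The coefficient of s in diag(t, t^-1) [up s] = [up (t^2 s)] diag(t, t^-1). *)
Lemma tor_E t : t != 0 -> tor M t *m E = t ^+ 2 *: (E *m tor M t).
Proof.
move=> t0; have [R [s [z [c [s2 _ cE]]]]] := test_algebra pchark.
have tW : t%:A * t^-1%:A = 1 :> R.
  by rewrite mulr_algl scalerA mulfV // scale1r.
have s0 : s ^+ p = 0 by apply: expr_nilp s2 _.
have ts0 : (t%:A ^+ 2 * s) ^+ p = 0 by rewrite exprMn s0 mulr0.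
have c0 n : c true 0 (s ^+ n) = (n == 1)%:R.
  by rewrite -[s ^+ n]mulr1 -(expr0 z) cE 1?ltnW // andbT.
have := act_atM M (in_G1T_diag pchark tW) (in_G1T_up pchark s0).
have := act_atM M (in_G1T_up pchark ts0) (in_G1T_diag pchark tW).
rewrite !mul_mk2 !(mulr0, mul0r, mulr1, mul1r, addr0, add0r).
rewrite (_ : _ * _ * t^-1%:A = t%:A * s); last first.
  have ab1 (a b : R) : a * b = 1 -> a ^+ 2 * s * b = a * s.
    by move=> ab; rewrite -[RHS]mulr1 -ab; ring.
  exact: ab1.
rewrite !act_up // act_tor // => ->.
move/(congr1 (map_mx (c true 0))).
rewrite mulmx_suml mulmx_sumr !map_mx_sum.
under eq_bigr => n _.
  rewrite exprMn -scalemxAl -alg_mxM -exprM -algX mulr_algl.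
  rewrite map_lin_scale linearZ /= c0; over.
under [RHS]eq_bigr => n _.
  rewrite -scalemxAr -alg_mxM map_lin_scale c0; over.
rewrite (sum_ord1 p_gt1 (F := fun n =>
  (t ^+ (2 * n) * (n == 1)%:R) *: (ecoef M n *m tor M t))); last first.
  by move=> n _ n1; rewrite (negPf n1) mulr0 scale0r.
rewrite (sum_ord1 p_gt1 (F := fun n =>
  (n == 1)%:R *: (tor M t *m ecoef M n))); last first.
  by move=> n _ n1; rewrite (negPf n1) scale0r.
by rewrite scale1r mulr1.
Qed.

Lemma E_wp n : E *m wp M n = wp M (n + 2) *m E.
Proof.
have H m l : wp M m *m (E *m wp M l) = if m == l + 2 then E *m wp M l else 0.
  apply: wp_eigen => // t t0.
  rewrite mulmxA tor_E // -scalemxAl -mulmxA tor_wp // -scalemxAr scalerA.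
  by rewrite [(l + 2)%R]addrC exprzDr ?unitfE // -exprnP.
apply: (@wp_ext M) => l; rewrite -!mulmxA wpM // H (inj_eq (addIr 2)).
by case: eqP => _; rewrite ?mulmx0.
Qed.

End OneModule.

Lemma act_tau (R : comAlgType k) (M : G1Tmod k p) (g : 'M[R]_2) :
  act_at (tau M) g = (act_at M g^T)^T.
Proof. by rewrite -map_tau_act. Qed.

Lemma tor_tau (M : G1Tmod k p) t : tor (tau M) t = (tor M t)^T.
Proof. by rewrite /tor act_tau tr_mk2. Qed.

Lemma wp_tau (M : G1Tmod k p) n : wp (tau M) n = (wp M n)^T.
Proof.
apply: (wp_uniq pchark (M := tau M) (wts_uniq M) (B := fun n => (wp M n)^T)).
- transitivity ((\sum_(m <- wts M) wp M m)^T); first by rewrite linear_sum.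
  by rewrite wp_sum // trmx1.
- by move=> m /wp_notin->; rewrite trmx0.
move=> m t t0; rewrite tor_tau.
by apply: (etrans (esym (trmx_mul (wp M m) (tor M t)))); rewrite wp_tor // linearZ.
Qed.

(** Transposition exchanges the root subgroups, so this is the linear coefficient of the action of
    the lower one. Defined in this way, F on M inherits its properties from E on [tau M]. *)
Definition Fop (M : G1Tmod k p) : 'M[k]_(dim M) := (Eop (tau M))^T.

Lemma E_tau (M : G1Tmod k p) : Eop (tau M) = (Fop M)^T.
Proof. by rewrite trmxK. Qed.

Lemma F_tau (M : G1Tmod k p) : Fop (tau M) = (Eop M)^T.
Proof.
congr (_^T); apply/matrixP => i j; rewrite [LHS]mxE [RHS]mxE.
by rewrite !act_tau !trmxK.
Qed.

Lemma trmxX n m (A : 'M[k]_n) : (A ^+ m)^T = A^T ^+ m.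
Proof.
elim: m => [|m IH]; first by rewrite !expr0 trmx1.
by rewrite exprS exprSr -!mulmxE trmx_mul IH.
Qed.

Lemma Fop_nilp (M : G1Tmod k p) : Fop M ^+ p = 0.
Proof.
rewrite -trmxX.
exact: (etrans (congr1 trmx (Eop_nilp pchark (tau M))) (trmx0 _ _ _)).
Qed.

Lemma F_wp (M : G1Tmod k p) n : Fop M *m wp M n = wp M (n - 2) *m Fop M.
Proof.
have := E_wp (tau M) (n - 2); rewrite subrK !wp_tau E_tau => H.
by apply: trmx_inj; rewrite !trmx_mul; exact: esym H.
Qed.

Definition lo (R : pzRingType) (x : R) : 'M[R]_2 := mk2 1 0 x 1.

Lemma tr_lo (R : pzRingType) (x : R) : (lo x)^T = up x.
Proof. exact: tr_mk2. Qed.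

Lemma in_G1T_lo (R : comAlgType k) (x : R) : x ^+ p = 0 -> in_G1T p (lo x).
Proof. by move=> /(in_G1T_up pchark)/tr_in_G1T; rewrite tr_mk2. Qed.

Definition fcoef (M : G1Tmod k p) n : 'M[k]_(dim M) := (ecoef (tau M) n)^T.

Lemma act_lo (R : comAlgType k) (M : G1Tmod k p) (x : R) : x ^+ p = 0 ->
  act_at M (lo x) = \sum_(n < p) x ^+ n *: (fcoef M n)^R.
Proof.
move=> x0; rewrite -[LHS]trmxK -[lo x]trmxK -act_tau tr_lo act_up //.
rewrite linear_sum; apply: eq_bigr => n _.
by rewrite linearZ /= map_trmx.
Qed.

End Operators.

(** * The commutator of the root vectors *)

Section Relations.
Variables (k : closedFieldType) (p : nat).
Hypothesis pchark : p \in [pchar k].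
Let p_gt1 : (1 < p)%N := prime_gt1 (pcharf_prime pchark).

Lemma expr1D_square0 (R : comPzRingType) (e : R) n : e * e = 0 ->
  (1 + e) ^+ n = 1 + e *+ n.
Proof.
move=> ee; elim: n => [|n IH]; first by rewrite expr0 mulr0n addr0.
rewrite exprS IH mulrDr mulr1 mulrDl mul1r mulrnAr ee mul0rn addr0.
by rewrite mulrS !addrA.
Qed.

Lemma chi_square0 (R : comAlgType k) (e : R) l : e * e = 0 ->
  chi l (mk2 (1 + e) 0 0 (1 - e)) = 1 + (l%:~R : k) *: e.
Proof.
move=> ee; case: l => n /=; rewrite mxE /=.
  by rewrite expr1D_square0 // scaler_nat.
rewrite expr1D_square0 ?mulrNN // NegzE.
by rewrite mulrNz scaleNr mulNrn scaler_nat.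
Qed.

(** Put e = s t and y = t (1 - e). Then [up s *m lo t] equals the product of [lo y], diag(1 + e, 1 -
    e) and [up s]; the coefficient of s t is E F on one side, and on the other F E plus the
    contribution n of the torus, whose character of weight n takes the value 1 + n e. *)
Lemma EF_comm (M : G1Tmod k p) n :
  Eop M *m Fop M *m wp M n = Fop M *m Eop M *m wp M n + n%:~R *: wp M n.
Proof.
have [R [s [t [c [s2 tp cE]]]]] := test_algebra pchark.
have ss : s * s = 0 by rewrite -expr2.
have sp : s ^+ p = 0 by apply: expr_nilp s2 _.
pose e := s * t; pose y := t * (1 - e).
have ee : e * e = 0 by rewrite /e mulrACA ss mul0r.
have ad : (1 + e) * (1 - e) = 1.
  by rewrite -[RHS]subr0 -ee; ring.
have yp : y ^+ p = 0 by rewrite exprMn tp mul0r.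
have := act_atM M (in_G1T_up pchark sp) (in_G1T_lo pchark tp).
have := act_atM M (in_G1T_diag pchark ad) (in_G1T_up pchark sp).
have Gdu : in_G1T p (mk2 (1 + e) 0 0 (1 - e) *m up s).
  rewrite mul_mk2; apply/in_G1T_mk2; split.
  - by rewrite -[RHS]ad; ring.
  - by rewrite !(mulr0, mul0r, mulr1, addr0, add0r) -exprMn ad expr1n.
  - by rewrite mul0r addr0 exprMn sp mulr0.
  by rewrite mul0r mulr0 addr0 expr0n eqn0Ngt ltnW.
have := act_atM M (in_G1T_lo pchark yp) Gdu.
have -> : lo y *m (mk2 (1 + e) 0 0 (1 - e) *m up s) = up s *m lo t.
  have sse u : s * (s * u) = 0 by rewrite mulrA ss mul0r.
  rewrite !mul_mk2; congr mk2.
  - by rewrite -/e; ring.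
  - transitivity (s + s * (s * t)); first by rewrite /e; ring.
    by rewrite sse addr0 mulr1 mulr0 add0r.
  - transitivity (t - s * (s * (t * t * t))); first by rewrite /y /e; ring.
    by rewrite sse subr0 mul0r add0r mul1r.
  transitivity (1 - s * (s * (s * (t * t * t)))); first by rewrite /y /e; ring.
  by rewrite sse subr0 mul0r add0r mulr1.
move=> -> ->; rewrite !act_up // !act_lo // act_torus // => EQ.
have c11 m l : (m < p)%N -> (l < p)%N ->
    c true 1 (s ^+ m * t ^+ l) = ((m == 1) && (1 == l))%:R.
  by move=> mp lp; rewrite cE.
have {}EQ : \sum_(m < p) \sum_(l < p)
      (s ^+ m * t ^+ l) *: (ecoef M m *m fcoef M l)^R =
    \sum_(m < p) \sum_(l < p) \sum_(n <- wts M)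
      (y ^+ l * (chi n (mk2 (1 + e) 0 0 (1 - e)) * s ^+ m)) *:
        (fcoef M l *m (wp M n *m ecoef M m))^R.
  transitivity ((\sum_(n1 < p) y ^+ n1 *: (fcoef M n1)^R) *m
     ((\sum_(n1 <- wts M) chi n1 (mk2 (1 + e) 0 0 (1 - e)) *: (wp M n1)^R) *m
      (\sum_(n1 < p) s ^+ n1 *: (ecoef M n1)^R))).
    rewrite EQ; rewrite mulmx_suml; apply: eq_bigr => m _; rewrite mulmx_sumr.
    by apply: eq_bigr => l _; rewrite alg_mxM -scalemxAl -scalemxAr scalerA.
  rewrite !mulmx_sumr; apply: eq_bigr => m _.
  rewrite mulmx_suml; apply: eq_bigr => l _.
  rewrite mulmx_suml mulmx_sumr; apply: eq_bigr => x _.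
  by rewrite !alg_mxM -!scalemxAl -!scalemxAr !scalerA mulrA.
have es : e * s = 0 by rewrite mulrC /e mulrA ss mul0r.
(* The monomial s t arises in two ways: from e alone (m = l = 0), with the weight as coefficient, or
   from the linear terms of both root subgroups (m = l = 1). *)
have cy m l x : (m < p)%N -> (l < p)%N ->
    c true 1 (y ^+ l * (chi x (mk2 (1 + e) 0 0 (1 - e)) * s ^+ m))
      = ((m == 0) && (l == 0))%:R * x%:~R + ((m == 1) && (l == 1))%:R.
  move=> mp lp; rewrite chi_square0 // /y exprMn.
  rewrite expr1D_square0 ?mulrNN // mulNrn.
  case: m mp => [|[|m]] mp /=; last first.
  - rewrite (expr_nilp s2) // !mulr0 linear0 mul0r addr0 //.
  - have e1 : (1 + (x%:~R : k) *: e) * s = s.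
      by rewrite mulrDl mul1r -scalerAl es scaler0 addr0.
    have e2 : (1 - e *+ l) * s = s.
      by rewrite mulrDl mul1r mulNr mulrnAl es mul0rn subr0.
    rewrite expr1 e1 -mulrA e2 mulrC -[s in s * _]expr1 c11 //=.
    by rewrite mul0r add0r eq_sym.
  rewrite expr0 mulr1 addr0.
  have -> : t ^+ l * (1 - e *+ l) * (1 + (x%:~R : k) *: e)
       = s ^+ 0 * t ^+ l + (x%:~R - l%:R : k) *: (s ^+ 1 * t ^+ l.+1).
    have e3 : (1 - e *+ l) * (1 + (x%:~R : k) *: e)
        = 1 + (x%:~R - l%:R : k) *: e.
      have -> : (x%:~R - l%:R : k) *: e = (x%:~R : k) *: e - e *+ l.
        by rewrite scalerBl scaler_nat.
      rewrite mulrDl mul1r mulNr [e *+ l * _]mulrDr mulr1 -scalerAr mulrnAl ee.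
      by rewrite mul0rn scaler0 addr0 addrA.
    rewrite -mulrA e3 mulrDr mulr1 -scalerAr expr0 mul1r expr1 exprS /e.
    by congr (_ + _ *: _); ring.
  have cD (u v : R) (z : k) :
      c true 1 (u + z *: v) = (c true 1 u : k) + z * (c true 1 v : k).
    by rewrite linearD linearZ.
  rewrite cD c11 //= add0r.
  have [lp1|pl] := ltnP l.+1 p.
    rewrite c11 //= eqSS eq_sym; case: eqP => [->|_]; last by rewrite mul0r mulr0.
    by rewrite subr0 mul1r mulr1.
  (* Here l = p - 1, which is not 0 because p > 1, so the expected value is 0 too. *)
  have -> : t ^+ l.+1 = 0 by apply: expr_nilp tp _.
  rewrite mulr0 linear0 mulr0; case: l lp pl => [|l] lp pl.
    by move: p_gt1; rewrite ltnNge pl.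
  by rewrite mul0r.
have := congr1 (map_mx (c true 1)) EQ; rewrite !map_mx_sum.
under eq_bigr => m _.
  rewrite map_mx_sum; under eq_bigr => l _ do rewrite map_lin_scale c11 //.
  over.
rewrite (sum_ord1 (j := 1) p_gt1 (F := fun m => \sum_(l < p)
  ((m == 1)%N && (1 == l)%N)%:R *: (ecoef M m *m fcoef M l))); last first.
  move=> m _ m1; rewrite big1 // => l _; by rewrite (negPf m1) scale0r.
rewrite (sum_ord1 (j := 1) p_gt1 (F := fun l =>
  ((1 == 1)%N && (1 == l)%N)%:R *: (ecoef M 1 *m fcoef M l))); last first.
  by move=> l _ l1; rewrite [(1 == l)%N]eq_sym (negPf l1) andbF scale0r.
rewrite !eqxx scale1r => EFE.
have {EFE} : ecoef M 1 *m fcoef M 1 =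
    \sum_(x <- wts M) (x%:~R : k) *: wp M x + fcoef M 1 *m ecoef M 1.
  rewrite EFE; pose G m l x := fcoef M l *m (wp M x *m ecoef M m).
  transitivity (\sum_(m < p) \sum_(l < p)
     ((((m == 0 :> nat)%N && (l == 0 :> nat)%N)%:R : k) *: (\sum_(x <- wts M) (x%:~R : k) *: G m l x)
       + (((m == 1 :> nat)%N && (l == 1 :> nat)%N)%:R : k) *: (\sum_(x <- wts M) G m l x))).
    apply: eq_bigr => m _; rewrite map_mx_sum; apply: eq_bigr => l _.
    rewrite map_mx_sum !scaler_sumr -big_split; apply: eq_bigr => x _.
    by rewrite map_lin_scale cy // scalerDl scalerA.
  under eq_bigr do rewrite big_split.
  rewrite big_split; congr (_ + _).
    rewrite (sum_ord1 (j := 0) (ltnW p_gt1) (F := fun m => \sum_(l < p)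
      (((m == 0 :> nat)%N && (l == 0 :> nat)%N)%:R : k)
        *: (\sum_(x <- wts M) (x%:~R : k) *: G m l x))); last first.
      by move=> m _ m0; rewrite big1 // => l _; rewrite (negPf m0) scale0r.
    rewrite (sum_ord1 (j := 0) (ltnW p_gt1) (F := fun l =>
      ((true && (l == 0 :> nat)%N)%:R : k)
        *: (\sum_(x <- wts M) (x%:~R : k) *: G 0 l x))); last first.
      by move=> l _ l0; rewrite (negPf l0) scale0r.
    rewrite scale1r; apply: eq_bigr => x _.
    by rewrite /G /fcoef !ecoef0 // trmx1 mulmx1 mul1mx.
  rewrite (sum_ord1 (j := 1) p_gt1 (F := fun m => \sum_(l < p)
    (((m == 1 :> nat)%N && (l == 1 :> nat)%N)%:R : k) *: (\sum_(x <- wts M) G m l x))); last first.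
    by move=> m _ m0; rewrite big1 // => l _; rewrite (negPf m0) scale0r.
  rewrite (sum_ord1 (j := 1) p_gt1 (F := fun l =>
    ((true && (l == 1 :> nat)%N)%:R : k) *: (\sum_(x <- wts M) G 1 l x))); last first.
    by move=> l _ l0; rewrite (negPf l0) scale0r.
  by rewrite scale1r /G -mulmx_sumr -mulmx_suml wp_sum // mul1mx.
move/(congr1 (mulmxr (wp M n))); rewrite /= mulmxDl addrC.
rewrite -/(Eop M) -/(Fop M) => ->; congr (_ + _); rewrite mulmx_suml.
have [nw|/wp_notin->] := boolP (n \in wts M); last first.
  by rewrite scaler0 big1 // => x _; rewrite mulmx0.
rewrite (sum_uniq1 (wts_uniq M) nw) => [|x xn]; rewrite -scalemxAl wpM //.
  by rewrite eqxx.
by rewrite (negPf xn) scaler0.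
Qed.

End Relations.

(** * Homomorphisms as intertwiners *)

Section Homs.
Variables (k : closedFieldType) (p : nat).
Hypothesis pchark : p \in [pchar k].
Let p_gt1 : (1 < p)%N := prime_gt1 (pcharf_prime pchark).
Implicit Types M N : G1Tmod k p.

Lemma is_hom_tr M N (f : lin M N) : is_hom f -> is_hom (f^T : lin (tau N) (tau M)).
Proof.
move=> hf R g /tr_in_G1T gG; rewrite !act_tau -map_trmx.
apply: (etrans (esym (trmx_mul (act_at N g^T) (f^R)))).
by rewrite -hf // trmx_mul.
Qed.

Definition intertwines M N (f : lin M N) : Prop :=
  [/\ f *m Eop M = Eop N *m f, f *m Fop M = Fop N *m f &
      forall n, f *m wp M n = wp N n *m f].

Lemma is_hom_E M N (f : lin M N) : is_hom f -> f *m Eop M = Eop N *m f.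
Proof.
move=> hf; have [R [s [z [c [s2 _ cE]]]]] := test_algebra pchark.
have s0 : s ^+ p = 0 by apply: expr_nilp s2 _.
have c0 n : c true 0 (s ^+ n) = (n == 1)%:R.
  by rewrite -[s ^+ n]mulr1 -(expr0 z) cE 1?ltnW // andbT.
have := hf R (up s) (in_G1T_up pchark s0); rewrite !act_up //.
move/(congr1 (map_mx (c true 0))).
rewrite mulmx_suml mulmx_sumr !map_mx_sum.
under eq_bigr => n _.
  rewrite -scalemxAr -alg_mxM map_lin_scale c0; over.
under [RHS]eq_bigr => n _.
  rewrite -scalemxAl -alg_mxM map_lin_scale c0; over.
rewrite (sum_ord1 p_gt1 (F := fun n =>
  (n == 1)%:R *: (f *m ecoef M n))); last first.
  by move=> n _ n1; rewrite (negPf n1) scale0r.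
rewrite (sum_ord1 p_gt1 (F := fun n =>
  (n == 1)%:R *: (ecoef N n *m f))); last first.
  by move=> n _ n1; rewrite (negPf n1) scale0r.
by rewrite !scale1r.
Qed.

Lemma is_hom_tor M N (f : lin M N) t : is_hom f -> t != 0 ->
  f *m tor M t = tor N t *m f.
Proof.
move=> hf t0; have tt : (t : k^o) * t^-1 = 1 by exact: mulfV.
by have := hf k^o _ (in_G1T_diag pchark tt); rewrite alg_mx_id.
Qed.

Lemma is_hom_intertwines M N (f : lin M N) : is_hom f -> intertwines f.
Proof.
move=> hf; split; first exact: is_hom_E.
  apply: trmx_inj; rewrite !trmx_mul !trmxK.
  by rewrite (is_hom_E (is_hom_tr hf)).
move=> n; have H m l : wp N m *m (f *m wp M l) = if m == l then f *m wp M l else 0.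
  apply: wp_eigen => // t t0.
  by rewrite mulmxA -is_hom_tor // -mulmxA tor_wp // scalemxAr.
apply: wp_ext => l; rewrite -!mulmxA wpM // H.
by case: eqP => _; rewrite ?mulmx0 //.
Qed.

(** The equation a^p d^p = 1 makes a invertible, with inverse a^(p-1) d^p, so every point of G_1T
    has a triangular decomposition, without localization. *)
Lemma big_cell (R : comAlgType k) (g : 'M[R]_2) : in_G1T p g ->
  exists x y a d : R, [/\ x ^+ p = 0, y ^+ p = 0, a * d = 1 &
    forall M, act_at M g =
      act_at M (lo x) *m (act_at M (mk2 a 0 0 d) *m act_at M (up y))].
Proof.
rewrite [g]mk2E; set a := g 0 0; set b := g 0 1; set c := g 1 0.
set d := g 1 1 => /in_G1T_mk2 [D adp bp cp].
pose a' := a ^+ p.-1 * d ^+ p.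
have aa' : a * a' = 1 by rewrite mulrA -exprS prednK // ltnW.
have xp : (c * a') ^+ p = 0 by rewrite exprMn cp mul0r.
have yp : (a' * b) ^+ p = 0 by rewrite exprMn bp mulr0.
have Gdu : in_G1T p (mk2 a 0 0 a' *m up (a' * b)).
  rewrite mul_mk2 !(mulr0, mul0r, mulr1, addr0, add0r); apply/in_G1T_mk2.
  split=> //; rewrite ?mulr0 ?subr0 -?exprMn ?aa' ?expr1n //.
    by rewrite mulrA aa' mul1r.
  by rewrite expr0n eqn0Ngt ltnW.
exists (c * a'), (a' * b), a, a'; split=> // M.
rewrite -(act_atM M (in_G1T_diag pchark aa') (in_G1T_up pchark yp)).
rewrite -(act_atM M (in_G1T_lo pchark xp) Gdu); congr (act_at M _).
rewrite !mul_mk2 !(mulr0, mul0r, mulr1, mul1r, addr0, add0r); congr mk2.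
- by rewrite mulrA aa' mul1r.
- by rewrite -mulrA [a' * a]mulrC aa' mulr1.
suff <- : c * a' * (a * (a' * b)) + a' = d by [].
transitivity (a * a' * (a' * (b * c)) + a'); first by ring.
rewrite aa' mul1r -[X in _ + X]mulr1 -D -mulrDr addrC subrK.
by rewrite mulrA [a' * a]mulrC aa' mul1r.
Qed.

Lemma intertwines_ecoef M N (f : lin M N) n : (n < p)%N ->
  f *m Eop M = Eop N *m f -> f *m ecoef M n = ecoef N n *m f.
Proof.
move=> np fE; rewrite !ecoefE // -scalemxAl -scalemxAr; congr (_ *: _).
elim: n {np} => [|n IH]; first by rewrite !expr0 mulmx1 mul1mx.
by rewrite exprS (exprS (Eop N)) -!mulmxE mulmxA fE -!mulmxA IH.
Qed.

(** By [big_cell] it suffices to treat the three factors. The upper one is a polynomial in E, the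
    torus acts through the weight projections, and the lower one is the upper one for the transposed
    map between the duals. *)
Lemma intertwines_hom M N (f : lin M N) : intertwines f -> is_hom f.
Proof.
move=> [fE fF fw] R g /big_cell [x [y [a [d [xp yp ad gE]]]]].
have up_f : f^R *m act_at M (up y) = act_at N (up y) *m f^R.
  rewrite !act_up // mulmx_sumr mulmx_suml; apply: eq_bigr => n _.
  by rewrite -scalemxAl -scalemxAr -!alg_mxM intertwines_ecoef.
have lo_f : f^R *m act_at M (lo x) = act_at N (lo x) *m f^R.
  rewrite !act_lo // mulmx_sumr mulmx_suml; apply: eq_bigr => n _.
  rewrite -scalemxAl -scalemxAr -!alg_mxM; congr (_ *: _^R).
  have fE' : f^T *m Eop (tau N) = Eop (tau M) *m f^T.
    rewrite !E_tau; apply: trmx_inj; rewrite !trmx_mul !trmxK.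
    exact: esym fF.
  have := intertwines_ecoef (M := tau N) (N := tau M) (ltn_ord n) fE'.
  move/(congr1 trmx); rewrite !trmx_mul !trmxK => H; exact: esym H.
have d_f : f^R *m act_at M (mk2 a 0 0 d) = act_at N (mk2 a 0 0 d) *m f^R.
  rewrite -[f in RHS]mulmx1 -(wp_sum M) mulmx_sumr map_mx_sum.
  rewrite act_torus // !mulmx_sumr; apply: eq_bigr => n _.
  rewrite -scalemxAr -alg_mxM fw alg_mxM mulmxA act_diag_wp // -alg_mxM.
  by rewrite -scalemxAl -alg_mxM.
rewrite !gE [LHS]mulmxA lo_f -[LHS]mulmxA -[RHS]mulmxA; congr (_ *m _).
by rewrite [LHS]mulmxA d_f -[LHS]mulmxA up_f mulmxA.
Qed.

Lemma is_homP M N (f : lin M N) : is_hom f <-> intertwines f.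
Proof. by split; [exact: is_hom_intertwines | exact: intertwines_hom]. Qed.

End Homs.

(** * Symmetric powers and the Steinberg module *)

Section SymmetricPower.
Variable n : nat.

Section OneRing.
Variable R : comNzRingType.
Implicit Types (u v : R) (f al be : {poly R}).

Definition affine u v : {poly R} := u%:P + v *: 'X.

(** The value at (al, be) of the binary form of degree m whose dehomogenization is f. *)
Definition heval m al be f := \sum_(i < m.+1) f`_i *: (al ^+ (m - i) * be ^+ i).

Lemma heval_affine m al be u v f : (size f <= m.+1)%N ->
  heval m.+1 al be (affine u v * f) = (u *: al + v *: be) * heval m al be f.
Proof.
move=> sf; have cE i : (affine u v * f)`_i
    = u * f`_i + (if i is j.+1 then v * f`_j else 0).
  rewrite mulrDl coefD coefCM -scalerAl coefZ coefXM.
  by case: i => //=; rewrite mulr0.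
rewrite /heval; under eq_bigr => i _ do rewrite cE scalerDl.
rewrite big_split mulrDl /=; congr (_ + _).
  rewrite big_ord_recr /= [f`_m.+1]nth_default // mulr0 scale0r addr0.
  rewrite mulr_sumr; apply: eq_bigr => i _.
  by rewrite subSn -1?ltnS // exprS -scalerAl -scalerAr scalerA mulrA.
rewrite big_ord_recl scale0r add0r mulr_sumr; apply: eq_bigr => i _.
rewrite /= /bump /= add1n subSS exprS -scalerAl -scalerAr scalerA.
by rewrite mulrCA.
Qed.

Lemma size_affine u v : (size (affine u v) <= 2)%N.
Proof.
apply: leq_trans (size_polyD _ _) _; rewrite geq_max.
rewrite (leq_trans (size_polyC_leq1 _)) //.
by rewrite (leq_trans (size_scale_leq _ _)) // size_polyX.
Qed.

Lemma size_affineX u v m : (size (affine u v ^+ m) <= m.+1)%N.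
Proof.
apply: leq_trans (size_poly_exp_leq _ _) _; rewrite ltnS.
by have := size_affine u v; nia.
Qed.

(** Evaluation of forms is multiplicative on products of linear forms. The columns of [sym] are such
    products, and this is what makes [sym] multiplicative. *)
Lemma heval_affineX a b al be u v u' v' :
  heval (a + b) al be (affine u v ^+ a * affine u' v' ^+ b)
    = (u *: al + v *: be) ^+ a * (u' *: al + v' *: be) ^+ b.
Proof.
elim: a => [|a IH].
  rewrite !expr0 !mul1r; elim: b => [|b IH].
    by rewrite /heval big_ord1 !expr0 coef1 mulr1 scale1r.
  by rewrite !exprS heval_affine ?IH // size_affineX.
rewrite !exprS -!mulrA addSn heval_affine ?IH //.
apply: leq_trans (size_polyMleq _ _) _.
by have := size_affineX u v a; have := size_affineX u' v' b; lia.
Qed.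

(* The action on Sym^n of the natural module, in the basis x^(n - j) y^j,
   dehomogenized at x = 1. *)
Definition sym (g : 'M[R]_2) : 'M[R]_n.+1 := \matrix_(i, j)
  (affine (g 0 0) (g 1 0) ^+ (n - j) * affine (g 0 1) (g 1 1) ^+ j)`_i.

Lemma mulmx2E (g h : 'M[R]_2) i j :
  (g *m h) i j = g i 0 * h 0 j + g i 1 * h 1 j.
Proof.
rewrite mxE !big_ord_recl big_ord0 addr0.
by congr (_ + g i _ * h _ j); apply: val_inj.
Qed.

Lemma symM g h : sym (g *m h) = sym g *m sym h.
Proof.
apply/matrixP => i j; rewrite [LHS]mxE [RHS]mxE.
have E l : affine ((g *m h) 0 l) ((g *m h) 1 l) = h 0 l *: affine (g 0 0) (g 1 0)
    + h 1 l *: affine (g 0 1) (g 1 1).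
  by rewrite !mulmx2E /affine -!mul_polyC !polyCD !polyCM; ring.
rewrite !E -heval_affineX subnK -1?ltnS // /heval coef_sum.
by apply: eq_bigr => l _; rewrite coefZ !mxE mulrC.
Qed.

(** The first order term is the derivation x d/dy, which sends x^(n-j) y^j to j x^(n-j+1) y^(j-1);
    for [lo] it is y d/dx. *)
Lemma sym_up s : s * s = 0 ->
  sym (up s) = 1%:M + s *: \matrix_(i, j) (((i.+1 == j)%N * j)%:R).
Proof.
move=> ss; apply/matrixP => i j.
rewrite !mxE /= /affine scale0r addr0 expr1n mul1r scale1r.
case: j => -[|j] jn /=; first by rewrite expr0 coef1 muln0 mulr0 addr0.
rewrite exprD_square0 ?expr2 -?polyCM ?ss // coefD coefXn coefMn coefCM coefXn.
by rewrite eqSS mulrnA -mulrnAr.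
Qed.

Lemma sym_lo s : s * s = 0 ->
  sym (lo s) = 1%:M + s *: \matrix_(i, j) (((i == j.+1 :> nat)%N * (n - j))%:R).
Proof.
move=> ss; apply/matrixP => i j.
rewrite !mxE /= /affine polyC0 add0r scale1r.
rewrite expr1D_square0; last first.
  by rewrite -scalerAl -scalerAr scalerA ss scale0r.
rewrite mulrDl mul1r coefD coefXn mulrnAl coefMn -scalerAl coefZ -exprS coefXn. by rewrite mulrnA -mulrnAr.
Qed.

Lemma sym1 : sym 1%:M = 1%:M.
Proof.
have := sym_up (mul0r 0); rewrite scale0r addr0 => <-; congr sym.
by rewrite -mk2_1.
Qed.

End OneRing.

Lemma map_sym (R S : comNzRingType) (f : {rmorphism R -> S}) (g : 'M[R]_2) :
  map_mx f (sym g) = sym (map_mx f g).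
Proof.
apply/matrixP => i j; rewrite !mxE -coef_map rmorphM !rmorphXn /=.
have E u v : map_poly f (affine u v) = affine (f u) (f v).
  by rewrite rmorphD /= map_polyC map_polyZ map_polyX.
by rewrite !E.
Qed.

End SymmetricPower.

(** * Tensor products of matrices and the evaluation map *)

Section TensorMatrices.
Variable R : comNzRingType.

Lemma sum_mxtens (V : nmodType) m n (F : 'I_(m * n) -> V) :
  \sum_x F x = \sum_i \sum_j F (mxtens_index (i, j)).
Proof.
rewrite pair_big; rewrite (reindex (@mxtens_index m n)) /=.
  by apply: eq_bigr => -[].
by exists (@mxtens_unindex m n) => x _; rewrite (mxtens_indexK, mxtens_unindexK).
Qed.

Lemma tens1 m n : (1%:M : 'M[R]_m) *t (1%:M : 'M[R]_n) = 1%:M.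
Proof.
apply/matrixP => x y; case: (mxtens_indexP x) => i j.
case: (mxtens_indexP y) => i' j'; rewrite tensmxE !mxE.
by rewrite (inj_eq (can_inj (@mxtens_indexK m n))) xpair_eqE -natrM mulnb.
Qed.

Lemma tens_square0 m n (s : R) (A : 'M_m) (B : 'M_n) : s * s = 0 ->
  (1%:M + s *: A) *t (1%:M + s *: B) = 1%:M + s *: (A *t 1%:M + 1%:M *t B).
Proof.
move=> ss; rewrite -tens1; apply/matrixP => x y.
case: (mxtens_indexP x) => i j; case: (mxtens_indexP y) => i' j'.
rewrite tensmxE !mxE !mxtens_indexK /=.
set a := _%:R; set b := _%:R.
transitivity (a * b + s * (A i i' * b + a * B j j') + s * s * (A i i' * B j j')).
  by ring.
by rewrite ss mul0r addr0.
Qed.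

Lemma tensmxDl m n m' n' (A B : 'M[R]_(m, n)) (C : 'M_(m', n')) :
  (A + B) *t C = A *t C + B *t C.
Proof. by apply/matrixP => i j; rewrite !mxE mulrDl. Qed.

Lemma tensmxDr m n m' n' (A B : 'M[R]_(m, n)) (C : 'M_(m', n')) :
  C *t (A + B) = C *t A + C *t B.
Proof. by apply/matrixP => i j; rewrite !mxE mulrDr. Qed.

(** The evaluation V (x) W (x) W^* -> V in coordinates: pairs the last two factors. *)
Definition contr d n : 'M[R]_(d, d * (n * n)) := \matrix_(i, x)
  ((i == (mxtens_unindex x).1) &&
   let y := mxtens_unindex (mxtens_unindex x).2 in y.1 == y.2)%:R.

(** Equivariance of the evaluation: if B is the action on W, its inverse C acts on the dual through
    the transpose, and the two cancel. *)
Lemma contr_tens d n (A : 'M_d) (B C : 'M_n) : C *m B = 1%:M ->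
  contr d n *m (A *t (B *t C^T)) = A *m contr d n.
Proof.
move=> CB; apply/matrixP => i x; case: (mxtens_indexP x) => j yz.
case: (mxtens_indexP yz) => y z {x yz}.
rewrite !mxE sum_mxtens (bigD1 i) //= [X in _ + X]big1 ?addr0 => [|l li].
  rewrite sum_mxtens [RHS](bigD1 j) //= [X in _ = _ + X]big1 ?addr0 => [|l lj].
    rewrite mxE !mxtens_indexK /= eqxx mulr_natr -mulr_natr.
    have /matrixP/(_ z y) := CB; rewrite !mxE eq_sym => <-.
    rewrite mulr_sumr; apply: eq_bigr => l _.
    rewrite (bigD1 l) //= big1 ?addr0 => [|l' l'l].
      by rewrite !tensmxE !mxE !mxtens_indexK /= !eqxx mul1r [C _ _ * _]mulrC.
    by rewrite mxE !mxtens_indexK /= eq_sym (negPf l'l) andbF mul0r.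
  by rewrite mxE !mxtens_indexK /= (negPf lj) mulr0.
by rewrite big1 // => y' _; rewrite !mxE mxtens_indexK /= eq_sym (negPf li) mul0r.
Qed.

Lemma contr_free d n : (0 < n)%N ->
  exists B : 'M[R]_(d * (n * n), d), contr d n *m B = 1%:M.
Proof.
case: n => // n _.
exists (\matrix_(x, i) (x == mxtens_index (i, mxtens_index (0, 0)))%:R).
apply/matrixP => i j; rewrite mxE (bigD1 (mxtens_index (j, mxtens_index (0, 0)))) //=.
rewrite big1 ?addr0 => [|x xj]; last by rewrite !mxE (negPf xj) mulr0.
by rewrite !mxE !mxtens_indexK /= !eqxx andbT mulr1.
Qed.

End TensorMatrices.

Lemma map_contr (R S : comNzRingType) (f : {rmorphism R -> S}) d n :
  map_mx f (contr R d n) = contr S d n.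
Proof. by apply/matrixP => i j; rewrite !mxE rmorph_nat. Qed.

(** * The Steinberg module and freeness of projectives *)

Section Steinberg.
Variables (k : closedFieldType) (p : nat).
Hypothesis pchark : p \in [pchar k].
Let p_gt1 : (1 < p)%N := prime_gt1 (pcharf_prime pchark).

Local Notation n := p.-1.
Local Notation St := (sym n).

Section Tensor.
Variable M : G1Tmod k p.

(** On points of determinant 1 the adjugate is the inverse, so the action on the dual of St =
    Sym^(p-1) has polynomial entries. *)
Definition St2_act : 'M[{mpoly k[4]}]_(dim M * (n.+1 * n.+1)) :=
  act M *t (St (generic_mx k) *t (St (\adj (generic_mx k)))^T).

Lemma map_St2_act (R : comAlgType k) (g : 'M[R]_2) :
  map_mx (eval_at g) St2_act = act_at M g *t (St g *t (St (\adj g))^T).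
Proof.
rewrite /St2_act !map_mxT; congr (_ *t (_ *t _)).
  by rewrite map_sym eval_at_generic.
by rewrite -map_trmx map_sym map_mx_adj eval_at_generic.
Qed.

Lemma adj_G1T (R : comAlgType k) (g : 'M[R]_2) : in_G1T p g ->
  g *m \adj g = 1%:M /\ \adj g *m g = 1%:M.
Proof. by case=> D _; rewrite mul_mx_adj mul_adj_mx D. Qed.

Lemma adj1 (R : comAlgType k) : \adj (1%:M : 'M[R]_2) = 1%:M.
Proof. by have := mul_mx_adj (1%:M : 'M[R]_2); rewrite mul1mx det1. Qed.

Lemma adjM (R : comAlgType k) (g h : 'M[R]_2) : in_G1T p g -> in_G1T p h ->
  \adj (g *m h) = \adj h *m \adj g.
Proof.
move=> gG hG; have [gK Kg] := adj_G1T gG; have [hK Kh] := adj_G1T hG.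
have D : \det (g *m h) = 1 by rewrite det_mulmx gG.1 hG.1 mulr1.
have E : \adj (g *m h) *m (g *m h) = 1%:M by rewrite mul_adj_mx D.
have E' : g *m h *m (\adj h *m \adj g) = 1%:M.
  by rewrite mulmxA -(mulmxA g) hK mulmx1 gK.
by rewrite -[LHS]mulmx1 -E' mulmxA E mul1mx.
Qed.

Lemma St2_act1 (R : comAlgType k) :
  map_mx (eval_at (1%:M : 'M[R]_2)) St2_act = 1%:M.
Proof. by rewrite map_St2_act adj1 sym1 act_at1 trmx1 !tens1. Qed.

Lemma St2_actM (R : comAlgType k) (g h : 'M[R]_2) : in_G1T p g -> in_G1T p h ->
  map_mx (eval_at (g *m h)) St2_act
    = map_mx (eval_at g) St2_act *m map_mx (eval_at h) St2_act.
Proof.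
move=> gG hG; rewrite !map_St2_act !tensmx_mul -trmx_mul -!symM adjM //.
by rewrite act_atM.
Qed.

(* M (x) St (x) St^* *)
Definition St2 : G1Tmod k p := MkG1Tmod St2_act1 St2_actM.

Definition St2_contr : lin St2 M := contr k (dim M) n.+1.

Lemma St2_contr_hom : is_hom St2_contr.
Proof.
move=> R g gG; rewrite map_contr /act_at map_St2_act.
apply: contr_tens; rewrite -symM.
by have [_ ->] := adj_G1T gG; rewrite sym1.
Qed.

End Tensor.

Section SquareZero.
Variable M : G1Tmod k p.

Lemma act_up_square0 (R : comAlgType k) (s : R) : s * s = 0 ->
  act_at M (up s) = 1%:M + s *: (Eop M)^R.
Proof.
rewrite -expr2 => s2; rewrite act_up; last by apply: expr_nilp s2 _.
rewrite -(big_mkord xpredT (fun n => s ^+ n *: (ecoef M n)^R)).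
rewrite big_ltn 1?ltnW // big_ltn // big_nat_cond big1 => [|i].
  by rewrite addr0 expr0 scale1r ecoef0 // map_mx1 expr1.
by rewrite andbT => /andP[i1 _]; rewrite (expr_nilp s2) // scale0r.
Qed.

(** Determines E from points with s^2 = 0 only, so that on tensor products and twists no divided
    powers have to be computed. *)
Lemma Eop_unique (A : 'M[k]_(dim M)) :
  (forall (R : comAlgType k) (s : R), s * s = 0 ->
    act_at M (up s) = 1%:M + s *: A^R) -> Eop M = A.
Proof.
move=> H; have [R [s [z [c [s2 _ cE]]]]] := test_algebra pchark.
have ss : s * s = 0 by rewrite -expr2.
have := H R s ss; rewrite act_up_square0 // => /addrI.
move/(congr1 (map_mx (c true 0))); rewrite !map_lin_scale.
have := cE true 0 1 0 (ltnW p_gt1).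
by rewrite expr1 expr0 mulr1 => ->; rewrite !scale1r.
Qed.

End SquareZero.

Lemma act_lo_square0 (M : G1Tmod k p) (R : comAlgType k) (s : R) : s * s = 0 ->
  act_at M (lo s) = 1%:M + s *: (Fop M)^R.
Proof.
move=> ss; rewrite -[LHS]trmxK -[lo s]trmxK tr_mk2 -act_tau.
by rewrite act_up_square0 // linearD /= linearZ /= trmx1 map_trmx.
Qed.

Lemma Fop_unique (M : G1Tmod k p) (A : 'M[k]_(dim M)) :
  (forall (R : comAlgType k) (s : R), s * s = 0 ->
    act_at M (lo s) = 1%:M + s *: A^R) -> Fop M = A.
Proof.
move=> H; apply: trmx_inj; rewrite -E_tau.
apply: (@Eop_unique (tau M) A^T) => R s ss.
by rewrite act_tau tr_mk2 H // linearD /= linearZ /= trmx1 map_trmx.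
Qed.

Definition symE : 'M[k]_n.+1 := \matrix_(i, j) (((i.+1 == j)%N * j)%:R).
Definition symF : 'M[k]_n.+1 :=
  \matrix_(i, j) (((i == j.+1 :> nat)%N * (n - j))%:R).
(** For x = 1, [symE] is d/dy on polynomials of degree less than p, and this is multiplication by -y
    with y^p set to 0. *)
Definition symDE : 'M[k]_n.+1 := \matrix_(i, j) - ((i == j.+1 :> nat)%N)%:R.
(** For y = 1, [symF] is d/dx, and this is multiplication by -x with x^p set to 0. *)
Definition symDF : 'M[k]_n.+1 := \matrix_(i, j) - ((i.+1 == j)%N)%:R.

Lemma natr_n1 : n.+1%:R = 0 :> k.
Proof. by rewrite prednK ?(pcharf0 pchark) // ltnW. Qed.

(** This is [d/dy, y] = 1. It survives at y^(p-1), where truncation loses y^p, because the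
    derivative of y^p has the factor p = 0; this is where n = p - 1 matters. *)
Lemma symDE_comm : symDE *m symE = symE *m symDE + 1%:M.
Proof.
apply/matrixP => i j; rewrite !mxE.
have -> : \sum_l symDE i l * symE l j = - (i == j)%:R * j%:R.
  case: j => -[|j] jn /=; first by rewrite mulr0 big1 // => l _; rewrite !mxE muln0 mulr0.
  rewrite (bigD1 (Ordinal (ltnW jn))) //= big1 => [|l lj]; rewrite !mxE /=.
    by rewrite eqxx mul1n addr0.
  rewrite eqSS (_ : (l == j :> nat) = false) ?mul0n ?mulr0 //.
  by apply: contraNF lj => /eqP lj; apply/eqP/val_inj.
have -> : \sum_l symE i l * symDE l j = - (i == j)%:R * j.+1%:R.
  have [jn|jn] := ltnP j.+1 n.+1.
    rewrite (bigD1 (Ordinal jn)) //= big1 => [|l lj]; rewrite !mxE /=.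
      by rewrite eqxx eqSS natrM addr0 mulrN mulr1 mulNr.
    rewrite (_ : (l == _ :> nat) = false) ?oppr0 ?mulr0 //.
    by apply: contraNF lj => /eqP lj; apply/eqP/val_inj.
  have jE : j = n :> nat by apply/eqP; rewrite eqn_leq -ltnS ltn_ord -ltnS.
  rewrite jE natr_n1 mulr0 big1 // => l _; rewrite !mxE jE.
  by rewrite (ltn_eqF (ltn_ord l)) oppr0 mulr0.
by rewrite [j.+1%:R]mulrS; set a := _%:R; set b := _%:R; ring.
Qed.

Lemma symDF_comm : symDF *m symF = symF *m symDF + 1%:M.
Proof.
apply/matrixP => i j; rewrite !mxE.
have -> : \sum_l symDF i l * symF l j = - (i == j)%:R * (n - j)%:R.
  have [jn|jn] := ltnP j.+1 n.+1.
    rewrite (bigD1 (Ordinal jn)) //= big1 => [|l lj]; rewrite !mxE /=.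
      by rewrite eqxx eqSS mul1n addr0.
    rewrite (_ : (l == _ :> nat) = false) ?mul0n ?mulr0 //.
    by apply: contraNF lj => /eqP lj; apply/eqP/val_inj.
  have jE : j = n :> nat by apply/eqP; rewrite eqn_leq -ltnS ltn_ord -ltnS.
  rewrite jE subnn mulr0 big1 // => l _; rewrite !mxE jE.
  by rewrite subnn muln0 mulr0.
have -> : \sum_l symF i l * symDF l j = - (i == j)%:R * (n - j).+1%:R.
  case: j => -[|j] jn /=.
    rewrite subn0 natr_n1 mulr0 big1 // => l _.
    by rewrite !mxE /= oppr0 mulr0.
  rewrite (bigD1 (Ordinal (ltnW jn))) //= big1 => [|l lj]; rewrite !mxE /=.
    by rewrite eqxx addr0 subnSK // natrM mulrN mulr1 mulNr.
  rewrite eqSS (_ : (l == _ :> nat) = false) ?oppr0 ?mulr0 //.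
  by apply: contraNF lj => /eqP lj; apply/eqP/val_inj.
by rewrite [(n - j).+1%:R]mulrS; set a := _%:R; set b := _%:R; ring.
Qed.

Lemma adj_up (R : comAlgType k) (s : R) : \adj (up s) = up (- s).
Proof.
have E : up s *m up (- s) = 1%:M by rewrite -upD subrr up0.
by rewrite -[LHS]mulmx1 -E mulmxA mul_adj_mx det_mk2 mulr0 subr0 mul1r mul1mx.
Qed.

Lemma adj_lo (R : comAlgType k) (s : R) : \adj (lo s) = lo (- s).
Proof.
have E : lo s *m lo (- s) = 1%:M.
  by rewrite mul_mk2 !(mulr0, mul0r, mulr1, mul1r, addr0, add0r) subrr mk2_1.
by rewrite -[LHS]mulmx1 -E mulmxA mul_adj_mx det_mk2 mul0r subr0 mul1r mul1mx.
Qed.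

Lemma Eop_St2 (M : G1Tmod k p) :
  Eop (St2 M) = Eop M *t 1%:M + 1%:M *t (symE *t 1%:M + 1%:M *t (- symE^T)).
Proof.
apply: Eop_unique => R s ss; rewrite /act_at map_St2_act adj_up.
have symER : symE^R = \matrix_(i, j) (((i.+1 == j)%N * j)%:R) :> 'M[R]_n.+1.
  by apply/matrixP => i j; rewrite !mxE rmorph_nat.
rewrite act_up_square0 // !sym_up ?mulrNN // -symER.
rewrite linearD /= linearZ /= trmx1 scaleNr -scalerN.
rewrite tens_square0 // tens_square0 // !map_mxD !map_mxT map_mx1 !map_mxD.
by rewrite !map_mxT map_mxN map_trmx !map_mx1.
Qed.

Lemma Fop_St2 (M : G1Tmod k p) :
  Fop (St2 M) = Fop M *t 1%:M + 1%:M *t (symF *t 1%:M + 1%:M *t (- symF^T)).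
Proof.
apply: Fop_unique => R s ss; rewrite /act_at map_St2_act adj_lo.
have symFR : symF^R
    = \matrix_(i, j) (((i == j.+1 :> nat)%N * (n - j))%:R) :> 'M[R]_n.+1.
  by apply/matrixP => i j; rewrite !mxE rmorph_nat.
rewrite act_lo_square0 // !sym_lo ?mulrNN // -symFR.
rewrite linearD /= linearZ /= trmx1 scaleNr -scalerN.
rewrite tens_square0 // tens_square0 // !map_mxD !map_mxT map_mx1 !map_mxD.
by rewrite !map_mxT map_mxN map_trmx !map_mx1.
Qed.

(** D' acts on the middle factor only and commutes with the summands of X' on the other two. *)
Lemma tens_comm m (X : 'M[k]_m) (A D : 'M[k]_n.+1) : D *m A = A *m D + 1%:M ->
  let X' := X *t 1%:M + 1%:M *t (A *t 1%:M + 1%:M *t (- A^T)) in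
  let D' := 1%:M *t (D *t 1%:M) in D' *m X' = X' *m D' + 1%:M.
Proof.
move=> DA X' D'; rewrite /X' /D' !mulmxDr !mulmxDl !tensmx_mul.
rewrite !mulmxDr !mulmxDl !tensmx_mul !mul1mx !mulmx1 DA.
by rewrite tensmxDl !tensmxDr !tens1 -!addrA; congr (_ + (_ + _)); rewrite addrC.
Qed.

(* St is free over k[E] / (E^p), by D = - d/dE, and hence so is P, which is a
   summand of P (x) St (x) St^*. *)
Lemma projective_Efree (P : G1Tmod k p) : projective P ->
  exists D : 'M[k]_(dim P), D *m Eop P = Eop P *m D + 1%:M.
Proof.
move=> projP; have h1 : is_hom (1%:M : lin P P).
  by move=> R g _; rewrite map_mx1 mul1mx mulmx1.
have rk : \rank (St2_contr P) = dim P.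
  apply/eqP; rewrite -/(row_free _); apply/row_freeP.
  exact: contr_free.
have [l lh fl] := projP _ _ _ _ (St2_contr_hom P) rk h1.
pose D : 'M_(dim (St2 P)) := 1%:M *t (symDE *t 1%:M).
have DE : D *m Eop (St2 P) = Eop (St2 P) *m D + 1%:M.
  by rewrite Eop_St2; exact: tens_comm symDE_comm.
exists (St2_contr P *m D *m l).
have [lE _ _] := is_hom_intertwines pchark lh.
have [fE _ _] := is_hom_intertwines pchark (St2_contr_hom P).
rewrite -!mulmxA lE [D *m _]mulmxA DE mulmxDl mul1mx mulmxDr fl; congr (_ + _).
by rewrite !mulmxA fE.
Qed.

(** Needed because [tau P] is not known to be projective: transposed, this gives the freeness of
    [tau P] over E. *)
Lemma projective_Ffree (P : G1Tmod k p) : projective P ->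
  exists D : 'M[k]_(dim P), D *m Fop P = Fop P *m D + 1%:M.
Proof.
move=> projP; have h1 : is_hom (1%:M : lin P P).
  by move=> R g _; rewrite map_mx1 mul1mx mulmx1.
have rk : \rank (St2_contr P) = dim P.
  apply/eqP; rewrite -/(row_free _); apply/row_freeP.
  exact: contr_free.
have [l lh fl] := projP _ _ _ _ (St2_contr_hom P) rk h1.
pose D : 'M_(dim (St2 P)) := 1%:M *t (symDF *t 1%:M).
have DE : D *m Fop (St2 P) = Fop (St2 P) *m D + 1%:M.
  by rewrite Fop_St2; exact: tens_comm symDF_comm.
exists (St2_contr P *m D *m l).
have [_ lE _] := is_hom_intertwines pchark lh.
have [_ fE _] := is_hom_intertwines pchark (St2_contr_hom P).
rewrite -!mulmxA lE [D *m _]mulmxA DE mulmxDl mul1mx mulmxDr fl; congr (_ + _).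
by rewrite !mulmxA fE.
Qed.

End Steinberg.

(** * The structure of T_1 *)

Section MatrixPowers.
Variables (k : fieldType) (d : nat).
Implicit Types A D : 'M[k]_d.

Lemma mxpow0 A n (z : 'M_(d, n)) : A ^+ 0 *m z = z.
Proof. by rewrite expr0 mul1mx. Qed.

Lemma mxpowSl A m n (z : 'M_(d, n)) : A ^+ m.+1 *m z = A *m (A ^+ m *m z).
Proof. by rewrite exprS -mulmxE mulmxA. Qed.

Lemma mxpowSr A m n (z : 'M_(d, n)) : A ^+ m.+1 *m z = A ^+ m *m (A *m z).
Proof. by rewrite exprSr -mulmxE mulmxA. Qed.

Lemma mxpowD A m l n (z : 'M_(d, n)) : A ^+ (m + l) *m z = A ^+ m *m (A ^+ l *m z).
Proof. by rewrite exprD -mulmxE mulmxA. Qed.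

Variables (p : nat) (A D : 'M[k]_d).
Hypothesis pchark : p \in [pchar k].
Hypothesis DA : D *m A = A *m D + 1%:M.

Lemma comm_pow n : D ^+ n.+1 *m A = A *m D ^+ n.+1 + n.+1%:R *: D ^+ n.
Proof.
elim: n => [|n IH]; first by rewrite !expr1 expr0 scale1r.
have S m : D *m D ^+ m = D ^+ m.+1 by rewrite exprS.
rewrite mxpowSl IH mulmxDr mulmxA DA mulmxDl mul1mx -scalemxAr -mulmxA !S.
by rewrite -addrA; congr (_ + _); rewrite [n.+2%:R]mulrS scalerDl scale1r.
Qed.

(** Shows that ker A lies in the image of A^n as long as n! is invertible, that is for n < p. *)
Lemma pow_comm_ker m (z : 'M_(d, m)) n : A *m z = 0 ->
  A ^+ n *m (D ^+ n *m z) = ((-1) ^+ n * n`!%:R) *: z.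
Proof.
move=> Az; elim: n => [|n IH]; first by rewrite !mxpow0 expr0 mul1r scale1r.
have : D ^+ n.+1 *m (A *m z) = 0 by rewrite Az mulmx0.
rewrite mulmxA comm_pow mulmxDl -scalemxAl => /eqP; rewrite addr_eq0 => /eqP H.
rewrite mxpowSr [A *m (_ *m z)]mulmxA H mulmxN -scalemxAr IH scalerA.
by rewrite -scaleNr factS natrM exprS; congr (_ *: _); ring.
Qed.

(** The property of free modules over k[A] / (A^p) used below. If A^(j+1) z = 0, then A^j z lies in
    ker A and hence equals A^(p-1) x; the vector z - A^(p-j-1) x is killed by A^j, which allows
    induction. *)
Lemma ker_pow j m (z : 'M_(d, m)) : (j <= p)%N -> A ^+ j *m z = 0 ->
  exists u, z = A ^+ (p - j) *m u.
Proof.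
have p_gt0 := prime_gt0 (pcharf_prime pchark).
elim: j z => [|j IH] z jp; first by rewrite mxpow0 => ->; exists 0; rewrite mulmx0.
rewrite mxpowSl => /(pow_comm_ker p.-1) H.
have [x Hx] : exists x, A ^+ j *m z = A ^+ p.-1 *m x.
  have c0 : (-1) ^+ p.-1 * p.-1`!%:R != 0 :> k.
    by rewrite mulf_neq0 ?signr_eq0 // (fact_neq0 pchark) // prednK.
  exists (((-1) ^+ p.-1 * p.-1`!%:R)^-1 *: (D ^+ p.-1 *m (A ^+ j *m z))).
  by rewrite -scalemxAr H scalerA mulVf // scale1r.
have e1 : (p.-1 = j + (p - j.+1))%N by lia.
have e2 : (p - j = (p - j.+1) + 1)%N by lia.
have [|u Hu] := IH (z - A ^+ (p - j.+1) *m x) (ltnW jp).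
  by rewrite mulmxBr -mxpowD -e1 Hx subrr.
exists (x + A *m u); rewrite mulmxDr -[A in A *m u]expr1 -mxpowD -e2 -Hu.
by rewrite addrC subrK.
Qed.

End MatrixPowers.

Section Families.
Variables (k : fieldType) (d p : nat).
Implicit Types a b : nat -> 'cV[k]_d.

Definition famx a : 'M[k]_(d, p) := \matrix_(i, j) a j i 0.

Lemma eq_famx a b : (forall j, (j < p)%N -> a j = b j) -> famx a = famx b.
Proof. by move=> ab; apply/matrixP => i j; rewrite !mxE ab. Qed.

Lemma famxE a (c : 'cV_p) : famx a *m c = \sum_(j < p) c j 0 *: a j.
Proof.
apply/matrixP => i j; rewrite (ord1 j) mxE summxE; apply: eq_bigr => l _.
by rewrite !mxE mulrC.
Qed.

(** As a right factor it replaces column j by f j times column g j. If g j >= p, its column j is 0,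
    in accordance with families that vanish from index p on. *)
Definition famc (f : nat -> k) (g : nat -> nat) : 'M[k]_p :=
  \matrix_(i, j) (f j * (i == g j :> nat)%:R).

Lemma famx_famc a f g : (forall i, (p <= i)%N -> a i = 0) ->
  famx a *m famc f g = famx (fun j => f j *: a (g j)).
Proof.
move=> a0; apply/matrixP => i j; rewrite !mxE.
have [gp|gp] := ltnP (g j) p.
  rewrite (bigD1 (Ordinal gp)) //= big1 => [|l lg]; rewrite !mxE /=.
    by rewrite eqxx mulr1 addr0 mulrC.
  rewrite (_ : (_ == _) = false) ?mulr0 //.
  by apply: contraNF lg => /eqP lg; apply/eqP/val_inj.
rewrite a0 // mxE mulr0 big1 // => l _.
by rewrite !mxE (ltn_eqF (leq_trans (ltn_ord l) gp)) !mulr0.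
Qed.

Lemma famxD a b : famx a + famx b = famx (fun j => a j + b j).
Proof. by apply/matrixP => i j; rewrite !mxE. Qed.

End Families.

Lemma mul_famx (k : fieldType) m d p (A : 'M[k]_(m, d)) (a : nat -> 'cV_d) :
  A *m famx p a = famx p (fun j => A *m a j).
Proof.
by apply/matrixP => i j; rewrite !mxE; apply: eq_bigr => l _; rewrite !mxE.
Qed.

Section WeightVectors.
Variables (k : closedFieldType) (p : nat).
Hypothesis pchark : p \in [pchar k].
Variable M : G1Tmod k p.
Local Notation E := (Eop M).
Local Notation F := (Fop M).
Implicit Types (z u : 'cV[k]_(dim M)) (n m : int).

Definition wtvec n z : Prop := wp M n *m z = z.

Lemma wtvec_wp n z : wtvec n (wp M n *m z).
Proof. by rewrite /wtvec mulmxA wpM // eqxx. Qed.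

Lemma wtvec_neq n m z : wtvec n z -> m != n -> wp M m *m z = 0.
Proof. by move=> <- mn; rewrite mulmxA wpM // (negPf mn) mul0mx. Qed.

Lemma wtvecD n z u : wtvec n z -> wtvec n u -> wtvec n (z + u).
Proof. by rewrite /wtvec mulmxDr => -> ->. Qed.

Lemma wtvecZ n c z : wtvec n z -> wtvec n (c *: z).
Proof. by rewrite /wtvec -scalemxAr => ->. Qed.

Lemma wtvecN n z : wtvec n z -> wtvec n (- z).
Proof. by rewrite /wtvec mulmxN => ->. Qed.

Lemma wtvecE n z i : wtvec n z -> wtvec (n + (2 * i)%:Z) (E ^+ i *m z).
Proof.
move=> nz; elim: i => [|i IH]; first by rewrite mxpow0 muln0 addr0.
rewrite mxpowSl /wtvec -[in RHS]IH [RHS]mulmxA E_wp // -[RHS]mulmxA.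
by congr (wp M _ *m _); lia.
Qed.

Lemma wtvecF n z i : wtvec n z -> wtvec (n - (2 * i)%:Z) (F ^+ i *m z).
Proof.
move=> nz; elim: i => [|i IH]; first by rewrite mxpow0 muln0 subr0.
rewrite mxpowSl /wtvec -[in RHS]IH [RHS]mulmxA F_wp // -[RHS]mulmxA.
by congr (wp M _ *m _); lia.
Qed.

Lemma wp_powE n i z : wp M (n + (2 * i)%:Z) *m (E ^+ i *m z) = E ^+ i *m (wp M n *m z).
Proof.
elim: i => [|i IH]; first by rewrite !mxpow0 muln0 addr0.
rewrite !mxpowSl -IH [RHS]mulmxA E_wp // -[RHS]mulmxA.
by congr (wp M _ *m _); lia.
Qed.

Lemma EF_wt n z : wtvec n z -> E *m (F *m z) = F *m (E *m z) + n%:~R *: z.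
Proof.
by move=> nz; rewrite -[z]nz !mulmxA EF_comm // mulmxDl -scalemxAl.
Qed.

Lemma EF_pow n z i : wtvec n z -> E *m (F ^+ i.+1 *m z) =
  F ^+ i.+1 *m (E *m z) + (i.+1%:R * (n%:~R - i%:R)) *: (F ^+ i *m z).
Proof.
move=> nz; elim: i => [|i IH].
  by rewrite !expr1 mxpow0 mul1r subr0 (EF_wt nz).
rewrite mxpowSl (EF_wt (wtvecF i.+1 nz)) IH mulmxDr -mxpowSl -scalemxAr -mxpowSl.
rewrite -addrA -scalerDl; congr (_ + _ *: _).
rewrite intrB -[((2 * i.+1)%:Z)%:~R]/((2 * i.+1)%:R) natrM ![_.+1%:R]mulrS; ring.
Qed.

End WeightVectors.

Section Structure.
Variables (k : closedFieldType) (p : nat).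
Hypothesis pchark : p \in [pchar k].
Let p_gt1 : (1 < p)%N := prime_gt1 (pcharf_prime pchark).

(* T_1(la), where la = r mod p and r <= p - 2, is generated by a vector z as
   in [is_gen]: then v = E^(r+1) z is a highest weight vector, of weight la. As
   E^r F^r v = (r!)^2 v, the scalar [gen_coef] is forced by E^r (E z) = v. *)
Variables (r : nat) (la : int).
Hypotheses (rp : (r.+1 < p)%N) (la_r : la%:~R = r%:R :> k).

Definition gen_weight : int := la - (2 * r.+1)%:Z.
Definition gen_coef : k := (r`!%:R ^- 2).

Section InModule.
Variable M : G1Tmod k p.
Local Notation E := (Eop M).
Local Notation F := (Fop M).

Definition is_gen (z : 'cV[k]_(dim M)) : Prop :=
  [/\ wtvec gen_weight z, E ^+ r.+2 *m z = 0 &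
      E *m z = gen_coef *: (F ^+ r *m (E ^+ r.+1 *m z))].

Section HighestVector.
Variable v : 'cV[k]_(dim M).
Hypotheses (wv : wtvec la v) (Ev : E *m v = 0).

Lemma E_Fv i : E *m (F ^+ i.+1 *m v) = (i.+1%:R * (r%:R - i%:R)) *: (F ^+ i *m v).
Proof. by rewrite (EF_pow pchark i wv) Ev mulmx0 add0r la_r. Qed.

Lemma EiFi i j : E ^+ i *m (F ^+ (i + j) *m v)
  = (\prod_(l < i) ((j + l).+1%:R * (r%:R - (j + l)%:R))) *: (F ^+ j *m v).
Proof.
elim: i j => [|i IH] j; first by rewrite mxpow0 big_ord0 scale1r.
rewrite mxpowSl addSnnS IH -scalemxAr E_Fv scalerA; congr (_ *: _).
rewrite mulrC big_ord_recl addn0; congr (_ * _); apply: eq_bigr => l _.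
by rewrite /= /bump /= add1n addnS.
Qed.

End HighestVector.

Lemma prod_succ m : \prod_(l < m) l.+1%:R = m`!%:R :> k.
Proof.
elim: m => [|m IH]; first by rewrite big_ord0.
by rewrite big_ord_recr IH factS natrM mulrC.
Qed.

(** Freeness gives v = E^(p-1) x, and z0 = E^(p-r-2) x satisfies E^(r+1) z0 = v. The defect w in the
    equation for E z0 is killed by E^r, hence equals E^(p-r) u. Subtracting z1, the weight component
    of E^(p-r-1) u, removes the defect and does not change E^(r+1) z0, as E^(r+1) z1 = E^r w = 0. *)
Lemma gen_exists (D : 'M[k]_(dim M)) v : D *m E = E *m D + 1%:M ->
  wtvec la v -> E *m v = 0 -> exists2 z, is_gen z & E ^+ r.+1 *m z = v.
Proof.
move=> DE wv Ev; have Ev1 : E ^+ 1 *m v = 0 by rewrite expr1.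
have [x0 v_x0] := ker_pow pchark DE (ltnW p_gt1) Ev1.
pose x := wp M (la - (2 * p.-1)%:Z) *m x0.
have v_x : v = E ^+ p.-1 *m x.
  by rewrite -[LHS]wv v_x0 subn1 -wp_powE //; congr (wp M _ *m _); lia.
pose z0 := E ^+ (p - r.+2) *m x.
have Ez0 : E ^+ r.+1 *m z0 = v by rewrite -mxpowD v_x; congr (_ ^+ _ *m _); lia.
have wz0 : wtvec gen_weight z0.
  have := wtvecE pchark (p - r.+2) (wtvec_wp pchark (la - (2 * p.-1)%:Z) x0).
  by congr (wtvec _ _); rewrite /gen_weight; lia.
pose w := E *m z0 - gen_coef *: (F ^+ r *m v).
have Ew : E ^+ r *m w = 0.
  rewrite mulmxBr -mxpowSr Ez0 -scalemxAr -[X in F ^+ X]addn0 EiFi // mxpow0.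
  (* The factors (l + 1) (r - l), for l < r, multiply to (r!)^2: this is what [gen_coef] inverts. *)
  rewrite scalerA (_ : \prod_(l < r) _ = r`!%:R ^+ 2).
    by rewrite /gen_coef mulVf ?expf_neq0 ?(fact_neq0 pchark) ?scale1r ?subrr // ltnW // ltnW.
  under eq_bigr do rewrite add0n.
  rewrite big_split expr2 /=; congr (_ * _); first by rewrite prod_succ.
  rewrite -prod_succ (reindex_inj rev_ord_inj) /=; apply: eq_bigr => l _.
  by rewrite -natrB ?leq_subr // subKn.
have ww : wtvec (gen_weight + 2) w.
  apply: wtvecD; first by have := wtvecE pchark 1 wz0; rewrite expr1.
  apply/wtvecN/wtvecZ; have := wtvecF pchark r wv.
  by congr (wtvec _ _); rewrite /gen_weight; lia.
have [u w_u] := ker_pow pchark DE (ltnW (ltnW rp)) Ew.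
pose z1 := wp M gen_weight *m (E ^+ (p - r.+1) *m u).
have Ez1 : E *m z1 = w.
  rewrite /z1 mulmxA E_wp // -mulmxA -mxpowSl -subSn ?(ltnW rp) // subSS -w_u.
  exact: ww.
have Erz1 : E ^+ r.+1 *m z1 = 0 by rewrite mxpowSr Ez1 Ew.
exists (z0 - z1); [split|].
- exact: wtvecD wz0 (wtvecN (wtvec_wp _ _ _)).
- by rewrite mxpowSl mulmxBr Ez0 Erz1 subr0 Ev.
- rewrite [X in _ = _ *: (_ *m X)]mulmxBr Ez0 Erz1 subr0 mulmxBr Ez1 /w.
  by rewrite opprB addrC subrK.
by rewrite mulmxBr Ez0 Erz1 subr0.
Qed.

End InModule.
End Structure.

Section Structure.
Variables (k : closedFieldType) (p : nat).
Hypothesis pchark : p \in [pchar k].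
Variables (r : nat) (la : int).
Hypotheses (rp : (r.+1 < p)%N) (la_r : la%:~R = r%:R :> k).

Local Notation mu := (gen_weight r la).
Local Notation gc := (gen_coef k r).
Local Notation gen := (is_gen (p := p) r la).

Definition upper_vec (M : G1Tmod k p) (z : 'cV[k]_(dim M)) i :=
  Fop M ^+ i *m (Eop M ^+ r.+1 *m z).
Definition lower_vec (M : G1Tmod k p) (z : 'cV[k]_(dim M)) i := Fop M ^+ i *m z.

Definition gen_basis (M : G1Tmod k p) (z : 'cV[k]_(dim M)) : 'M_(dim M, p + p) :=
  row_mx (famx p (upper_vec z)) (famx p (lower_vec z)).

(** The matrix of E in the vectors F^j v and F^j z. For j = 0 the coefficients of the two diagonal
    blocks are 0, so the value 0 of the predecessor of 0 does no harm. *)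
Definition mat_E : 'M[k]_(p + p) :=
  block_mx (famc p (fun j => j%:R * (r%:R - j.-1%:R)) predn)
           (famc p (fun j => gc) (addn r))
           0 (famc p (fun j => - (j%:R * (j + r.+1)%:R)) predn).
Definition mat_F : 'M[k]_(p + p) :=
  block_mx (famc p (fun=> 1) succn) 0 0 (famc p (fun=> 1) succn).
Definition mat_wp n : 'M[k]_(p + p) :=
  block_mx (famc p (fun j => (n == la - (2 * j)%:Z)%:R) id) 0
         0 (famc p (fun j => (n == mu - (2 * j)%:Z)%:R) id).

Section InModule.
Variable M : G1Tmod k p.
Local Notation E := (Eop M).
Local Notation F := (Fop M).
Variable z : 'cV[k]_(dim M).
Hypothesis gz : gen z.

Lemma wt_z : wtvec mu z. Proof. by case: gz. Qed.

Lemma wt_v : wtvec la (E ^+ r.+1 *m z).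
Proof.
have := wtvecE pchark r.+1 wt_z; congr (wtvec _ _); rewrite /gen_weight; lia.
Qed.

Lemma E_v : E *m (E ^+ r.+1 *m z) = 0.
Proof. by case: gz => _ <- _; rewrite [RHS]mxpowSl. Qed.

Lemma wt_fa i : wtvec (la - (2 * i)%:Z) (upper_vec z i).
Proof. exact: wtvecF wt_v. Qed.

Lemma wt_fb i : wtvec (mu - (2 * i)%:Z) (lower_vec z i).
Proof. exact: wtvecF wt_z. Qed.

Lemma fa_big i : (p <= i)%N -> upper_vec z i = 0.
Proof. by move=> pi; rewrite /upper_vec (expr_nilp (Fop_nilp pchark M)) // mul0mx. Qed.

Lemma fb_big i : (p <= i)%N -> lower_vec z i = 0.
Proof. by move=> pi; rewrite /lower_vec (expr_nilp (Fop_nilp pchark M)) // mul0mx. Qed.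

Lemma E_fa0 : E *m upper_vec z 0 = 0.
Proof. by rewrite /upper_vec mxpow0 E_v. Qed.

Lemma E_faS i : E *m upper_vec z i.+1 = (i.+1%:R * (r%:R - i%:R)) *: upper_vec z i.
Proof. exact: (E_Fv pchark la_r wt_v E_v). Qed.

Lemma E_fb0 : E *m lower_vec z 0 = gc *: upper_vec z r.
Proof. by rewrite /lower_vec mxpow0; case: gz. Qed.

Lemma E_fbS i : E *m lower_vec z i.+1
  = gc *: upper_vec z (i.+1 + r) - (i.+1%:R * (i + r.+2)%:R) *: lower_vec z i.
Proof.
rewrite /lower_vec (EF_pow pchark i wt_z); case: gz => _ _ ->.
rewrite -scalemxAr /upper_vec mxpowD; congr (_ + _); rewrite -scaleNr; congr (_ *: _).
have -> : mu%:~R - i%:R = - (i + r.+2)%:R :> k.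
  rewrite /gen_weight intrB la_r -[((2 * r.+1)%:Z)%:~R]/((2 * r.+1)%:R).
  by rewrite -[r.+2]addn2 -[r.+1]addn1 natrM !natrD; ring.
by rewrite mulrN.
Qed.

Lemma famx_basisE : E *m gen_basis z = gen_basis z *m mat_E.
Proof.
rewrite /mat_E mul_row_block mul_mx_row mulmx0 addr0 !mul_famx.
rewrite !(famx_famc _ _ fa_big) !(famx_famc _ _ fb_big).
congr row_mx; rewrite ?famxD; apply: eq_famx => -[|j] jp /=.
- by rewrite E_fa0 mul0r scale0r.
- exact: E_faS.
- by rewrite E_fb0 mul0r oppr0 scale0r addr0 addn0.
by rewrite E_fbS scaleNr [(j.+1 + r.+1)%N]addSnnS [(r + _)%N]addnC.
Qed.

Lemma famx_basisF : F *m gen_basis z = gen_basis z *m mat_F.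
Proof.
rewrite /mat_F mul_row_block mul_mx_row !mulmx0 addr0 add0r !mul_famx.
rewrite !(famx_famc _ _ fa_big) !(famx_famc _ _ fb_big).
by congr row_mx; apply: eq_famx => j jp /=; rewrite scale1r /upper_vec /lower_vec -mxpowSl.
Qed.

Lemma famx_basisW n : wp M n *m gen_basis z = gen_basis z *m mat_wp n.
Proof.
rewrite /mat_wp mul_row_block mul_mx_row !mulmx0 addr0 add0r !mul_famx.
rewrite !(famx_famc _ _ fa_big) !(famx_famc _ _ fb_big).
congr row_mx; apply: eq_famx => j jp /=.
  have wj := wt_fa j; case: eqP => [->|/eqP nj]; first by rewrite scale1r wj.
  by rewrite scale0r (wtvec_neq pchark wj).
have wj := wt_fb j; case: eqP => [->|/eqP nj]; first by rewrite scale1r wj.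
by rewrite scale0r (wtvec_neq pchark wj).
Qed.

End InModule.

Lemma natr_neq0 n : (0 < n < p)%N -> n%:R != 0 :> k.
Proof. by case/andP=> n0 np; rewrite -(dvdn_pcharf pchark) gtnNdvd. Qed.

Lemma tau_powF (M : G1Tmod k p) i (u x : 'cV[k]_(dim M)) :
  (Fop (tau M) ^+ i *m u)^T *m x = u^T *m (Eop M ^+ i *m x).
Proof. by rewrite trmx_mul F_tau -trmxX trmxK mulmxA. Qed.

Lemma tau_powE (M : G1Tmod k p) i (u x : 'cV[k]_(dim M)) :
  (Eop (tau M) ^+ i *m u)^T *m x = u^T *m (Fop M ^+ i *m x).
Proof. by rewrite trmx_mul E_tau -trmxX trmxK mulmxA. Qed.

Lemma wt_orth (M : G1Tmod k p) n m (u x : 'cV[k]_(dim M)) :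
  wtvec (M := tau M) n u -> wtvec m x -> n != m -> u^T *m x = 0.
Proof.
move=> <- xm nm; rewrite wp_tau // trmx_mul trmxK -mulmxA.
by rewrite (wtvec_neq pchark xm) // mulmx0.
Qed.

Section Gram.
Variables (M : G1Tmod k p) (z : 'cV[k]_(dim M)) (y : 'cV[k]_(dim (tau M))).
Hypotheses (gz : gen z) (gy : gen (M := tau M) y).
Local Notation E := (Eop M).
Local Notation F := (Fop M).
Local Notation ka := (y^T *m upper_vec z r.+1 : 'M[k]_1).
Local Notation a := (upper_vec z).
Local Notation b := (lower_vec z).
Local Notation a' := (upper_vec (M := tau M) y).
Local Notation b' := (lower_vec (M := tau M) y).

(** Moving all operators to M leaves y^T F^(r+1) E^i F^i v. Here E^i F^i acts on v by the product of
    the (l + 1) (r - l) with l < i, which is nonzero up to i = r and contains the factor 0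
    afterwards. *)
Lemma aa_lt i : (i <= r)%N -> exists2 c : k, c != 0 & (a' i)^T *m a i = c *: ka.
Proof.
move=> ir; have -> : a i = F ^+ (i + 0) *m (E ^+ r.+1 *m z) by rewrite addn0.
rewrite tau_powF tau_powE.
rewrite (EiFi pchark la_r (wt_v gz) (E_v gz)) -scalemxAr -scalemxAr.
rewrite mxpow0; eexists; last by [].
apply/prodf_neq0 => l _; rewrite add0n; have li := ltn_ord l.
apply: mulf_neq0; first by apply: natr_neq0; lia.
by rewrite -natrB; [apply: natr_neq0; lia | lia].
Qed.

Lemma aa_ge i : (r < i)%N -> (a' i)^T *m a i = 0.
Proof.
move=> ri; have -> : a i = F ^+ (i + 0) *m (E ^+ r.+1 *m z) by rewrite addn0.
rewrite tau_powF tau_powE.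
rewrite (EiFi pchark la_r (wt_v gz) (E_v gz)) (bigD1 (Ordinal ri)) //=.
by rewrite add0n subrr mulr0 mul0r scale0r !mulmx0.
Qed.

(** E^(m+r+1) F^m z is a nonzero multiple of E^(r+1) z. In the induction step the extra term is a
    multiple of E^(m+r+1) F^(m+r+1) v, which vanishes through its factor r - r. *)
Lemma ab_lt m : (m + r.+1 < p)%N ->
  exists2 c : k, c != 0 & (a' (m + r.+1))^T *m b m = c *: ka.
Proof.
move=> mp; have [c c0 H] : exists2 c : k, c != 0 &
    E ^+ (m + r.+1) *m b m = c *: (E ^+ r.+1 *m z).
  elim: m mp => [|m IH] mp.
    by exists 1; rewrite ?oner_neq0 // add0n /lower_vec mxpow0 scale1r.
  have [|c c0 H] := IH; first by lia.
  exists (- (m.+1%:R * (m + r.+2)%:R) * c).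
    apply: mulf_neq0 => //; rewrite oppr_eq0.
    by apply: mulf_neq0; apply: natr_neq0; lia.
  rewrite addSn mxpowSr (E_fbS gz) mulmxBr -scalemxAr -scalemxAr H.
  have -> : (m.+1 + r = m + r.+1 + 0)%N by lia.
  rewrite [upper_vec z _]/upper_vec (EiFi pchark la_r (wt_v gz) (E_v gz)).
  have rl : (r < m + r.+1)%N by lia.
  rewrite (bigD1 (Ordinal rl)) //= add0n subrr mulr0 mul0r scale0r scaler0 sub0r.
  by rewrite scalerA mulNr scaleNr.
by exists c => //; rewrite tau_powF tau_powE H -!scalemxAr.
Qed.

Lemma ba_lt i : (i + r.+1 < p)%N ->
  exists2 c : k, c != 0 & (b' i)^T *m a (i + r.+1) = c *: ka.
Proof.
move=> ip; have -> : a (i + r.+1) = F ^+ (i + r.+1) *m (E ^+ r.+1 *m z) by [].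
rewrite tau_powF.
rewrite (EiFi pchark la_r (wt_v gz) (E_v gz)) -scalemxAr.
eexists; last by [].
apply/prodf_neq0 => l _.
have -> : r%:R - (r.+1 + l)%:R = - l.+1%:R :> k.
  by rewrite addSnnS natrD opprD addrA subrr sub0r.
have li := ltn_ord l.
by apply: mulf_neq0; rewrite ?oppr_eq0; apply: natr_neq0; lia.
Qed.

(** With s = p - r - 2, powers of E lower F^i z to a multiple of F^(s+1) z, the terms in F^j v
    having j >= p. One more E leads to F^(s+r+1) v, since the coefficient of F^s z contains s + r +
    2 = p = 0. The pairing is then that of [ba_lt] for s. *)
Lemma bb_ge i : (p <= i + r.+1)%N -> (i < p)%N ->
  exists2 c : k, c != 0 & (b' i)^T *m b i = c *: ka.
Proof.
move=> pi ip; pose s := (p - r.+2)%N.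
have sE : (s + r.+2 = p)%N by rewrite /s; lia.
have [m iE] : exists m, i = (s.+1 + m)%N by exists (i - s.+1)%N; lia.
have [c c0 H] : exists2 c : k, c != 0 & E ^+ m *m b i = c *: b s.+1.
  move: ip; rewrite {}iE; elim: m => [|m IH] ip.
    by exists 1; rewrite ?oner_neq0 // mxpow0 scale1r addn0.
  have [|c c0 H] := IH; first by lia.
  exists (- ((s.+1 + m).+1%:R * m.+1%:R) * c).
    apply: mulf_neq0 => //; rewrite oppr_eq0.
    by apply: mulf_neq0; apply: natr_neq0; lia.
  rewrite addnS mxpowSr (E_fbS gz) fa_big ?scaler0 ?sub0r; last by lia.
  have -> : (s.+1 + m + r.+2 = p + m.+1)%N by lia.
  by rewrite natrD (pcharf0 pchark) add0r mulmxN -scalemxAr H scalerA mulNr scaleNr.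
have H1 : E *m b s.+1 = gc *: a (s + r.+1).
  rewrite (E_fbS gz) sE (pcharf0 pchark) mulr0 scale0r subr0.
  by rewrite addSnnS.
have gc0 : gc != 0.
  by rewrite invr_eq0 expf_neq0 // (fact_neq0 pchark) // ltnW // ltnW.
have [|d d0 H2] := @ba_lt s; first by lia.
exists (c * gc * d); first by rewrite !mulf_neq0.
have -> : (b' i)^T = (Fop (tau M) ^+ (s + m.+1) *m y)^T by rewrite /lower_vec iE addSnnS.
rewrite tau_powF mxpowD mxpowSl H -scalemxAr H1 -!scalemxAr.
move: H2; rewrite tau_powF => ->.
by rewrite !scalerA.
Qed.

Definition gram : 'M[k]_(p + p) :=
  (gen_basis (M := tau M) y)^T *m gen_basis z.

Lemma famx_tr_eq0 d (f : nat -> 'cV[k]_d) (s : 'cV_d) i : (i < p)%N ->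
  (famx p f)^T *m s = 0 -> (f i)^T *m s = 0.
Proof.
move=> ip /matrixP/(_ (Ordinal ip) 0) H; apply/matrixP => x x'.
rewrite !ord1 [RHS]mxE; move: H; rewrite [RHS]mxE => <-.
by rewrite !mxE; apply: eq_bigr => l _; rewrite !mxE.
Qed.

(** Orthogonality of distinct weights splits the matrix into blocks. The vector F^i v is alone in
    its weight for i <= r, and so is F^i z for i + r + 1 >= p. The other weights contain F^(i+r+1) v
    and F^i z: there the first vectors pair to 0 and the mixed pairings are nonzero, so the 2 x 2
    block is antitriangular. *)
Lemma gram_unit : ka != 0 -> gram \in unitmx.
Proof.
move=> ka0; rewrite -unitmx_tr -row_free_unit; apply: inj_row_free => v.
move/(congr1 trmx); rewrite trmx_mul trmxK trmx0 -mulmxA.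
rewrite -[v^T]vsubmxK; set al := usubmx _; set be := dsubmx _.
rewrite mul_row_col !famxE => H.
set s := _ + _ in H.
have Ha i : (i < p)%N -> (a' i)^T *m s = 0.
  move=> ip; apply: famx_tr_eq0 ip _.
  by move/eqP: H; rewrite /gen_basis tr_row_mx mul_col_mx col_mx_eq0 => /andP[/eqP].
have Hb i : (i < p)%N -> (b' i)^T *m s = 0.
  move=> ip; apply: famx_tr_eq0 ip _.
  by move/eqP: H; rewrite /gen_basis tr_row_mx mul_col_mx col_mx_eq0 => /andP[_ /eqP].
have sE (f : 'cV_(dim M)) : f^T *m s = \sum_(j < p) al j 0 *: (f^T *m a j)
    + \sum_(j < p) be j 0 *: (f^T *m b j).
  rewrite /s mulmxDr !mulmx_sumr.
  by congr (_ + _); apply: eq_bigr => j _; rewrite -scalemxAr.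
have wa' i := wt_fa gy i; have wb' i := wt_fb gy i.
have wa i := wt_fa gz i; have wb i := wt_fb gz i.
have one (c : 'cV[k]_p) (g : nat -> 'M[k]_1) (i : 'I_p) :
  (forall j : nat, (j != i)%N -> g j = 0) ->
    \sum_(j < p) c j 0 *: g j = c i 0 *: g i.
  move=> g0; rewrite (bigD1 i) //= big1 ?addr0 // => j ji.
  by rewrite g0 ?scaler0.
have none (c : 'cV[k]_p) (g : nat -> 'M[k]_1) :
  (forall j, (j < p)%N -> g j = 0) -> \sum_(j < p) c j 0 *: g j = 0.
  by move=> g0; rewrite big1 // => j _; rewrite g0 // scaler0.
have aa i j : j != i -> (a' i)^T *m a j = 0.
  move=> ji; apply: wt_orth (wa' i) (wa j) _.
  by apply: contra ji => /eqP H'; apply/eqP; lia.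
have ab i j : (j + r.+1 != i)%N -> (a' i)^T *m b j = 0.
  move=> ji; apply: wt_orth (wa' i) (wb j) _.
  by apply: contra ji => /eqP H'; apply/eqP; rewrite /gen_weight in H'; lia.
have ba i j : (i + r.+1 != j)%N -> (b' i)^T *m a j = 0.
  move=> ji; apply: wt_orth (wb' i) (wa j) _.
  by apply: contra ji => /eqP H'; apply/eqP; rewrite /gen_weight in H'; lia.
have bb i j : (j != i)%N -> (b' i)^T *m b j = 0.
  move=> ji; apply: wt_orth (wb' i) (wb j) _.
  by apply: contra ji => /eqP H'; apply/eqP; lia.
have sc0 (x : k) (g : 'M[k]_1) (c : k) : c != 0 -> g = c *: ka -> x *: g = 0 -> x = 0.
  move=> c0 ->; rewrite scalerA => /eqP.
  by rewrite scaler_eq0 (negPf ka0) orbF mulf_eq0 (negPf c0) orbF => /eqP.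
have al1 (i : 'I_p) : (i <= r)%N -> al i 0 = 0.
  move=> ir; have [c c0 cE] := aa_lt ir.
  apply: sc0 c0 cE _; have := Ha i (ltn_ord i); rewrite sE.
  rewrite (one _ (fun j => (a' i)^T *m a j) i (aa i)).
  rewrite (none _ (fun j => (a' i)^T *m b j)) ?addr0 // => j jp.
  by apply: ab; apply/eqP; lia.
have be1 (i : 'I_p) : (i + r.+1 < p)%N -> be i 0 = 0.
  move=> ir; have [c c0 cE] := ab_lt ir.
  apply: sc0 c0 cE _; have := Ha (i + r.+1)%N ir; rewrite sE.
  rewrite (none _ (fun j => (a' (i + r.+1))^T *m a j)) => [|j jp].
    rewrite add0r (one _ (fun j => (a' (i + r.+1))^T *m b j) i) // => j ji.
    by apply: ab; rewrite eqn_add2r.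
  by have [->|/aa//] := eqVneq j (i + r.+1)%N; apply: aa_ge; lia.
have al2 (i : 'I_p) : (r < i)%N -> al i 0 = 0.
  move=> ri; have ip : (i - r.+1 + r.+1 < p)%N by rewrite subnK.
  have [c c0 cE] := ba_lt ip; rewrite subnK // in cE.
  apply: sc0 c0 cE _; have := Hb (i - r.+1)%N (leq_ltn_trans (leq_subr _ _) (ltn_ord i)).
  rewrite sE (one _ (fun j => (b' (i - r.+1))^T *m a j) i) => [|j ji]; last first.
    by apply: ba; rewrite subnK // eq_sym.
  (* The pairing of F^j z with its counterpart is the uncontrolled entry of the 2 x 2 block; its
     coefficient is already 0 by [be1]. *)
  rewrite big1 ?addr0 // => j _; have [jE|/bb->] := eqVneq (j : nat) (i - r.+1)%N.
    by rewrite be1 ?scale0r // jE.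
  by rewrite scaler0.
have al0 : al = 0.
  apply/matrixP => i j; rewrite (ord1 j) [RHS]mxE.
  by have [/al1|/al2] := leqP i r.
have be0 : be = 0.
  apply/matrixP => i j; rewrite (ord1 j) [RHS]mxE.
  have [ir|ir] := ltnP (i + r.+1) p; first exact: be1.
  have [c c0 cE] := bb_ge ir (ltn_ord i).
  apply: sc0 c0 cE _; have := Hb i (ltn_ord i); rewrite sE.
  rewrite (one _ (fun j => (b' i)^T *m b j) i (bb i)).
  by rewrite big1 ?add0r // => l _; rewrite al0 mxE scale0r.
apply: trmx_inj; rewrite trmx0 -[v^T]vsubmxK -/al -/be al0 be0.
by rewrite -[RHS]vsubmxK !linear0.
Qed.

End Gram.
End Structure.

(** * Direct sums and summands *)

Section HomAlgebra.
Variables (k : closedFieldType) (p : nat).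
Implicit Types M N L : G1Tmod k p.

Lemma is_hom0 M N : is_hom (0 : lin M N).
Proof. by move=> R g _; rewrite map_mx0 mul0mx mulmx0. Qed.

Lemma is_hom1 M : is_hom (1%:M : lin M M).
Proof. by move=> R g _; rewrite map_mx1 mul1mx mulmx1. Qed.

Lemma is_homD M N (f h : lin M N) : is_hom f -> is_hom h -> is_hom (f + h : lin M N).
Proof. by move=> hf hh R g gG; rewrite map_mxD mulmxDl mulmxDr hf ?hh. Qed.

Lemma is_homZ M N c (f : lin M N) : is_hom f -> is_hom (c *: f : lin M N).
Proof. by move=> hf R g gG; rewrite alg_mxZ -scalemxAl -scalemxAr hf. Qed.

Lemma is_homM M N L (f : lin M N) (h : lin N L) :
  is_hom f -> is_hom h -> is_hom (h *m f : lin M L).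
Proof.
by move=> hf hh R g gG; rewrite map_mxM -mulmxA hf // mulmxA hh // mulmxA.
Qed.

Lemma is_hom_sum M N I (s : seq I) (P : pred I) (f : I -> lin M N) :
  (forall i, P i -> is_hom (f i)) -> is_hom (\sum_(i <- s | P i) f i : lin M N).
Proof.
move=> hf; elim/big_rec: _ => [|i x Pi hx]; first exact: is_hom0.
by apply: is_homD => //; exact: hf.
Qed.

Lemma is_hom_inv M N (f : lin M N) (h : lin N M) :
  is_hom f -> h *m f = 1%:M -> f *m h = 1%:M -> is_hom h.
Proof.
move=> hf hfK fhK R g gG; rewrite -[LHS]mulmx1 -[1%:M](map_mx1 (in_alg R)).
rewrite -fhK map_mxM mulmxA -(mulmxA h^R) -hf // mulmxA -alg_mxM hfK map_mx1.
by rewrite mul1mx.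
Qed.

Lemma iso_trans M N L : isomorphic M N -> isomorphic N L -> isomorphic M L.
Proof.
move=> [f [h [hf hh hfK fhK]]] [f' [h' [hf' hh' hfK' fhK']]].
exists (f' *m f), (h *m h'); split; try exact: is_homM.
  by rewrite mulmxA -(mulmxA h) hfK' mulmx1.
by rewrite mulmxA -(mulmxA f') fhK mulmx1.
Qed.

End HomAlgebra.

Section DirectSums.
Variables (k : closedFieldType) (p r : nat) (N : 'I_r -> G1Tmod k p).

Lemma act_dsum (R : comAlgType k) (g : 'M[R]_2) :
  act_at (dsum N) g = \mxdiag_i act_at (N i) g.
Proof. by rewrite -map_dsum_act. Qed.

Lemma mxcol_hom M (f : forall i, lin M (N i)) :
  (forall i, is_hom (f i)) -> is_hom (\mxcol_i f i : lin M (dsum N)).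
Proof.
move=> hf R g gG; rewrite act_dsum.
have -> : (\mxcol_i f i)^R = \mxcol_i (f i)^R :> 'M[R]_(_, _).
  by apply/matrixP => x y; rewrite !mxE.
by rewrite mul_mxdiag_mxcol mxcol_mul; apply: eq_mxcol => i; exact: hf.
Qed.

Lemma mxrow_hom M (f : forall i, lin (N i) M) :
  (forall i, is_hom (f i)) -> is_hom (\mxrow_i f i : lin (dsum N) M).
Proof.
move=> hf R g gG; rewrite act_dsum.
have -> : (\mxrow_i f i)^R = \mxrow_i (f i)^R :> 'M[R]_(_, _).
  by apply/matrixP => x y; rewrite !mxE.
by rewrite mul_mxrow_mxdiag mul_mxrow; apply: eq_mxrow => i; exact: hf.
Qed.

Definition dinc i : lin (N i) (dsum N) := submxrow (1%:M : 'M[k]_(dim (dsum N))) i.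
Definition dpr i : lin (dsum N) (N i) := submxcol (1%:M : 'M[k]_(dim (dsum N))) i.

Lemma mxrow_dinc : \mxrow_i dinc i = 1%:M. Proof. exact: submxrowK. Qed.
Lemma mxcol_dpr : \mxcol_i dpr i = 1%:M. Proof. exact: submxcolK. Qed.

Lemma dinc_dpr : \sum_i dinc i *m dpr i = 1%:M.
Proof. by rewrite -mul_mxrow_mxcol mxrow_dinc mxcol_dpr mulmx1. Qed.

Lemma mx1_block : 1%:M = \mxblock_(i, j)
  (if i == j then conform_mx 0 (1%:M : 'M[k]_(dim (N i)))
   else (0 : 'M[k]_(dim (N i), dim (N j)))).
Proof. by rewrite -mxdiagZ. Qed.

Lemma dinc_hom i : is_hom (dinc i).
Proof.
move=> R g gG; rewrite act_dsum.
have -> : (dinc i)^R = \mxcol_j (if j == i then conform_mx 0 (1%:M : 'M[R]_(dim (N j)))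
    else (0 : 'M[R]_(dim (N j), dim (N i)))).
  rewrite -(submxrow_matrix (fun j l => if j == l then
    conform_mx 0 (1%:M : 'M[R]_(dim (N j))) else (0 : 'M[R]_(dim (N j), dim (N l))))).
  by rewrite -/(\mxdiag_j _) mxdiagZ -(map_mx1 (in_alg R)) /submxrow -map_mxsub.
rewrite mul_mxdiag_mxcol mxcol_mul; apply: eq_mxcol => j.
have [->|_] := eqVneq j i; last by rewrite mul0mx mulmx0.
by rewrite conform_mx_id mul1mx mulmx1.
Qed.

Lemma dpr_hom i : is_hom (dpr i).
Proof.
move=> R g gG; rewrite act_dsum.
have -> : (dpr i)^R = \mxrow_j (if i == j then conform_mx 0 (1%:M : 'M[R]_(dim (N i)))
    else (0 : 'M[R]_(dim (N i), dim (N j)))).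
  rewrite -(submxcol_matrix (fun j l => if j == l then
    conform_mx 0 (1%:M : 'M[R]_(dim (N j))) else (0 : 'M[R]_(dim (N j), dim (N l))))).
  by rewrite -/(\mxdiag_j _) mxdiagZ -(map_mx1 (in_alg R)) /submxcol -map_mxsub.
rewrite mul_mxrow_mxdiag mul_mxrow; apply: eq_mxrow => j.
have [->|_] := eqVneq i j; last by rewrite mul0mx mulmx0.
by rewrite conform_mx_id mul1mx mulmx1.
Qed.

Lemma dpr_dinc i j : dpr i *m dinc j =
  if i == j then conform_mx 0 (1%:M : 'M[k]_(dim (N i)))
  else (0 : 'M[k]_(dim (N i), dim (N j))).
Proof.
have := mul_mxcol_mxrow dpr dinc; rewrite mxrow_dinc mxcol_dpr mulmx1 mx1_block.
by move/eq_mxblockP/(_ i j).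
Qed.

Lemma dprK i : dpr i *m dinc i = 1%:M.
Proof. by rewrite dpr_dinc eqxx conform_mx_id. Qed.

Lemma dpr_dinc0 i j : i != j -> dpr i *m dinc j = 0.
Proof. by rewrite dpr_dinc => /negPf->. Qed.

Lemma dsum_iso M (inc : forall i, lin (N i) M) (pr : forall i, lin M (N i)) :
  (forall i, is_hom (inc i)) -> (forall i, is_hom (pr i)) ->
  (forall i, pr i *m inc i = 1%:M) -> (forall i j, i != j -> pr i *m inc j = 0) ->
  \sum_i inc i *m pr i = 1%:M -> isomorphic M (dsum N).
Proof.
move=> hinc hpr prK pr0 sum1; exists (\mxcol_i pr i), (\mxrow_i inc i); split.
- exact: mxcol_hom.
- exact: mxrow_hom.
- by rewrite mul_mxrow_mxcol.
rewrite mul_mxcol_mxrow mx1_block; apply: eq_mxblock => i j.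
have [->|ij] := eqVneq i j; last exact: pr0.
by rewrite prK conform_mx_id.
Qed.

End DirectSums.

Lemma dsum_iso_congr (k : closedFieldType) p r (N N' : 'I_r -> G1Tmod k p) :
  (forall i, isomorphic (N i) (N' i)) -> isomorphic (dsum N) (dsum N').
Proof.
move=> H; have [f /fin_all_exists[h Hh]] := fin_all_exists H.
apply: (@dsum_iso _ _ _ N' (dsum N) (fun i => dinc N i *m h i)
  (fun i => f i *m dpr N i)) => [i|i|i|i j ij|].
- by have [_ hh _ _] := Hh i; apply: is_homM hh (dinc_hom _ _).
- by have [hf _ _ _] := Hh i; apply: is_homM (dpr_hom _ _) hf.
- have [_ _ _ fhK] := Hh i.
  by rewrite mulmxA -(mulmxA (f i)) dprK mulmx1.
- by rewrite mulmxA -(mulmxA (f i)) dpr_dinc0 // mulmx0 mul0mx.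
rewrite -[RHS](dinc_dpr N); apply: eq_bigr => i _; have [_ _ hfK _] := Hh i.
by rewrite mulmxA -(mulmxA (dinc N i)) hfK mulmx1.
Qed.

Lemma idem_factor (F : fieldType) d n (e : 'M[F]_d) (C : 'M_(d, n)) (R : 'M_(n, d))
    (A : 'M_(n, d)) (B : 'M_(d, n)) :
  C *m R = e -> e *m e = e -> A *m C = 1%:M -> R *m B = 1%:M -> R *m C = 1%:M.
Proof.
move=> CR ee AC RB; transitivity (A *m (C *m R *m (C *m R)) *m B).
  by rewrite !mulmxA AC mul1mx -!mulmxA RB mulmx1.
by rewrite CR ee -CR !mulmxA AC mul1mx RB.
Qed.

(** * Splitting of idempotent endomorphisms *)

Section Summand.
Variables (k : closedFieldType) (p : nat) (M : G1Tmod k p) (e : lin M M).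
Variables (n : nat) (smd_inc : 'M[k]_(dim M, n)) (smd_pr : 'M[k]_(n, dim M)).
Hypotheses (e_hom : is_hom e) (smd_incK : smd_inc *m smd_pr = e).
Hypothesis smd_prK : smd_pr *m smd_inc = 1%:M.

Lemma smd_pr_e : smd_pr *m e = smd_pr.
Proof. by rewrite -[X in _ *m X]smd_incK mulmxA smd_prK mul1mx. Qed.

Lemma smd_e_inc : e *m smd_inc = smd_inc.
Proof. by rewrite -[X in X *m _]smd_incK -mulmxA smd_prK mulmx1. Qed.

Definition smd_act : 'M[{mpoly k[4]}]_n :=
  map_mx (mpolyC 4 (R := k)) smd_pr *m act M *m map_mx (mpolyC 4 (R := k)) smd_inc.

Lemma map_smd_act (R : comAlgType k) (g : 'M[R]_2) :
  map_mx (eval_at g) smd_act = smd_pr^R *m act_at M g *m smd_inc^R.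
Proof.
have C m l (A : 'M[k]_(m, l)) :
    map_mx (eval_at g) (map_mx (mpolyC 4 (R := k)) A) = A^R.
  by apply/matrixP => i j; rewrite !mxE eval_atC.
by rewrite !map_mxM !C.
Qed.

Lemma smd_act1 (R : comAlgType k) :
  map_mx (eval_at (1%:M : 'M[R]_2)) smd_act = 1%:M.
Proof. by rewrite map_smd_act act_at1 mulmx1 -alg_mxM smd_prK map_mx1. Qed.

Lemma smd_inc_act (R : comAlgType k) (g : 'M[R]_2) : in_G1T p g ->
  smd_inc^R *m (smd_pr^R *m act_at M g *m smd_inc^R) = act_at M g *m smd_inc^R.
Proof.
move=> gG; rewrite !mulmxA -alg_mxM smd_incK e_hom // -mulmxA -alg_mxM.
by rewrite smd_e_inc.
Qed.

Lemma smd_actM (R : comAlgType k) (g h : 'M[R]_2) : in_G1T p g -> in_G1T p h ->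
  map_mx (eval_at (g *m h)) smd_act
    = map_mx (eval_at g) smd_act *m map_mx (eval_at h) smd_act.
Proof.
move=> gG hG; rewrite !map_smd_act act_atM // -[RHS]mulmxA smd_inc_act //.
by rewrite !mulmxA.
Qed.

Definition summand : G1Tmod k p := MkG1Tmod smd_act1 smd_actM.

Lemma smd_pr_hom : is_hom (smd_pr : lin M summand).
Proof.
move=> R g gG; rewrite {2}/act_at map_smd_act -[RHS]mulmxA -alg_mxM smd_incK.
rewrite -[RHS]mulmxA -e_hom // mulmxA -alg_mxM.
by rewrite smd_pr_e.
Qed.

Lemma smd_inc_hom : is_hom (smd_inc : lin summand M).
Proof. by move=> R g gG; rewrite {1}/act_at map_smd_act smd_inc_act. Qed.

End Summand.

(** Rank factorizations of e and 1 - e make their images into modules, of which M is the direct sum;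
    one of the two has dimension 0. *)
Lemma indecomposable_idem (k : closedFieldType) p (M : G1Tmod k p) (e : lin M M) :
  indecomposable M -> is_hom e -> e *m e = e -> e = 0 \/ e = 1%:M.
Proof.
move=> [_ indM] he ee; pose e_ (i : 'I_2) : lin M M := if i == 0 then e else 1%:M - e.
have he_ i : is_hom (e_ i).
  rewrite /e_; case: eqP => // _; rewrite -scaleN1r.
  by apply: is_homD; [exact: is_hom1 | exact: is_homZ].
have ee_ i : e_ i *m e_ i = e_ i.
  rewrite /e_; case: eqP => // _.
  by rewrite mulmxBl mul1mx mulmxBr mulmx1 ee subrr subr0.
have ee0 i j : i != j -> e_ i *m e_ j = 0.
  move=> ij; rewrite /e_; have [i0|i0] := eqVneq i 0; have [j0|j0] := eqVneq j 0.
  - by rewrite i0 j0 eqxx in ij.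
  - by rewrite mulmxBr mulmx1 ee subrr.
  - by rewrite mulmxBl mul1mx ee subrr.
  move: ij i0 j0; case: i => -[|[|//]] ?; case: j => -[|[|//]] ? //.
have incK i : col_base (e_ i) *m row_base (e_ i) = e_ i by exact: mulmx_base.
have prK i : row_base (e_ i) *m col_base (e_ i) = 1%:M.
  have /row_freeP[B RB] : row_free (row_base (e_ i)) by exact: row_base_free.
  have /row_fullP[A AC] : row_full (col_base (e_ i)) by exact: col_base_full.
  exact: idem_factor (incK i) (ee_ i) AC RB.
pose N i := summand (he_ i) (incK i) (prK i).
have [] : exists i, dim (N i) = 0%N.
  apply: indM; apply: (@dsum_iso _ _ _ N M (fun i => col_base (e_ i))
      (fun i => row_base (e_ i))) => [i|i|i|i j ij|].
  - exact: smd_inc_hom.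
  - exact: smd_pr_hom.
  - exact: prK.
  - rewrite -(smd_pr_e (incK i) (prK i)) -(smd_e_inc (incK j) (prK j)) -mulmxA.
    by rewrite [e_ i *m _]mulmxA ee0 // mul0mx mulmx0.
  rewrite !big_ord_recl big_ord0 !incK /e_ /= addr0.
  by rewrite addrC subrK.
move=> i /eqP; rewrite /= mxrank_eq0 /e_; case: (i == 0) => /eqP; first by left.
by move/eqP; rewrite subr_eq0 => /eqP <-; right.
Qed.

(** * Uniqueness of T_1 *)

Definition isw (la n : int) (j : nat) : bool := n == la - (2 * j)%:Z.

Section HasWeight.
Variables (k : closedFieldType) (p : nat).
Hypothesis pchark : p \in [pchar k].
Variable M : G1Tmod k p.

Lemma wtvec_has_weight n (v : 'cV[k]_(dim M)) : v != 0 -> wtvec n v -> has_weight M n.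
Proof.
move=> v0 wv; exists v => // R t /in_T_mk2E [tE ad].
by rewrite -wv alg_mxM mulmxA tE act_diag_wp // -scalemxAl.
Qed.

Lemma has_weight_wtvec n : has_weight M n -> exists2 v : 'cV[k]_(dim M), v != 0 & wtvec n v.
Proof.
case=> v v0 H; exists v => //.
have Hv t : t != 0 -> tor M t *m v = t ^ n *: v.
  move=> t0; have := H (k^o : comAlgType k) (mk2 (t : k^o) 0 0 t^-1).
  rewrite alg_mx_id chi_expz; apply; apply: in_T_mk2; exact: mulfV.
by rewrite /wtvec (wp_eigen pchark Hv) eqxx.
Qed.

Lemma highest_wp la m : highest_weight M la ->
  (forall n : nat, la != m + (2 * n)%:Z) -> wp M m = 0.
Proof.
move=> [_ H] mn; apply/eqP; apply: contraT => W0.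
have [j Wj] : exists j, col j (wp M m) != 0.
  apply/existsP; apply: contraNT W0 => /existsPn H'; apply/eqP/matrixP => i j.
  have := H' j; rewrite negbK => /eqP/colP/(_ i); by rewrite !mxE.
have wj : wtvec m (col j (wp M m)).
  by rewrite /wtvec colE mulmxA wpM // eqxx.
have [n nE] := H _ (wtvec_has_weight Wj wj).
by have := mn n; rewrite nE eqxx.
Qed.

End HasWeight.

Section Structure.
Variables (k : closedFieldType) (p : nat).
Hypothesis pchark : p \in [pchar k].
Let p_gt1 : (1 < p)%N := prime_gt1 (pcharf_prime pchark).
Variables (r : nat) (la : int).
Hypotheses (rp : (r.+1 < p)%N) (la_r : la%:~R = r%:R :> k).

Local Notation mu := (gen_weight r la).
Local Notation gen := (is_gen (p := p) r la).
Local Notation fa := (upper_vec (p := p) r).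
Local Notation fb := (lower_vec (p := p)).
Local Notation basis := (gen_basis r).
Local Notation modE := (mat_E k p r).
Local Notation modF := (mat_F k p).
Local Notation modW := (mat_wp k p r la).

Definition is_basis (M : G1Tmod k p) (z : 'cV[k]_(dim M)) (L : 'M[k]_(p + p, dim M)) : Prop :=
  [/\ gen (M := M) z, basis (M := M) z *m L = 1%:M & L *m basis (M := M) z = 1%:M].

Section Tau.
Variables (M : G1Tmod k p) (y : 'cV[k]_(dim (tau M))).
Hypothesis gy : gen (M := tau M) y.
Local Notation Y := ((basis (M := tau M) y)^T : 'M[k]_(p + p, dim M)).

Lemma tau_basisE : Y *m Eop M = modF^T *m Y.
Proof.
have := famx_basisF pchark r y; rewrite F_tau => /(congr1 trmx).
by rewrite !trmx_mul trmxK.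
Qed.

Lemma tau_basisF : Y *m Fop M = modE^T *m Y.
Proof.
have := famx_basisE pchark rp la_r gy; rewrite E_tau => /(congr1 trmx).
by rewrite !trmx_mul trmxK.
Qed.

Lemma tau_basisW n : Y *m wp M n = (modW n)^T *m Y.
Proof.
have := famx_basisW pchark rp gy n; rewrite wp_tau // => /(congr1 trmx).
by rewrite !trmx_mul trmxK.
Qed.

End Tau.

(* The vectors F^i v, F^i z and their analogues in tau M are dual to each other
   up to the matrix G, so that X G^-1 Y is an idempotent endomorphism of M. *)
Lemma T1_basis (M : G1Tmod k p) : is_T1 la M -> exists (z : 'cV[k]_(dim M)) L,
  is_basis z L /\ exists2 y : 'cV[k]_(dim (tau M)), gen y & y^T *m fa z r.+1 != 0.
Proof.
move=> [projM indM [hwM hwmax]].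
have wla2 : wp M (la + 2) = 0.
  by apply: (@highest_wp _ _ pchark M la) => // n; apply/eqP; lia.
have [v v0 wv] := has_weight_wtvec pchark hwM.
have Ev : Eop M *m v = 0.
  have := wtvecE pchark 1 wv; rewrite expr1 => H.
  by rewrite -H wla2 mul0mx.
have [D DE] := projective_Efree pchark projM.
have [z gz zv] := gen_exists pchark rp la_r DE wv Ev.
have [i vi] : exists i, v i 0 != 0.
  apply/existsP; apply: contraNT v0 => /existsPn H'; apply/eqP/colP => i.
  by have := H' i; rewrite negbK mxE => /eqP.
(* A weight vector of the dual with w^T v = v_i, which is not 0. *)
pose w : 'cV[k]_(dim (tau M)) := wp (tau M) la *m delta_mx i 0.
have ww : wtvec la w by exact: wtvec_wp.
have Ew : Eop (tau M) *m w = 0.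
  have := wtvecE pchark 1 ww; rewrite expr1 => H.
  by rewrite -H wp_tau // wla2 trmx0 mul0mx.
have [D' DF] := projective_Ffree pchark projM.
(* Transposing reverses the products, hence the sign. *)
have DE' : - D'^T *m Eop (tau M) = Eop (tau M) *m - D'^T + 1%:M.
  rewrite E_tau mulmxN mulNmx -!trmx_mul DF linearD /= trmx1.
  by rewrite opprD subrK.
have [y gy yw] := gen_exists (M := tau M) pchark rp la_r DE' ww Ew.
have ka0 : y^T *m fa z r.+1 != 0 :> 'M[k]_1.
  have -> : y^T *m fa z r.+1 = w^T *m v.
    by rewrite /upper_vec zv -yw; exact: esym (@tau_powE k p M r.+1 y v).
  have -> : w^T *m v = (delta_mx i 0)^T *m v.
    by rewrite /w wp_tau // trmx_mul trmxK -mulmxA wv.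
  apply: contraNneq vi => /matrixP/(_ 0 0).
  by rewrite trmx_delta -rowE !mxE => ->.
exists z; pose X := basis z; pose Y : 'M_(p + p, dim M) := (basis (M := tau M) y)^T.
pose G := Y *m X; have GU : G \in unitmx by exact: (gram_unit pchark rp la_r gz gy ka0).
have GE : G = Y *m X by [].
clearbody G; pose e : lin M M := X *m invmx G *m Y.
have ee : e *m e = e.
  rewrite /e -!mulmxA; congr (_ *m _); rewrite !mulmxA -(mulmxA _ Y) -GE.
  by rewrite mulVmx // mul1mx.
have comm (A : 'M[k]_(dim M)) (B C : 'M[k]_(p + p)) :
    A *m X = X *m B -> Y *m A = C *m Y -> e *m A = A *m e.
  move=> AX YA.
  have -> : e *m A = X *m invmx G *m (Y *m A) by rewrite /e -[LHS]mulmxA.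
  have -> : A *m e = X *m B *m invmx G *m Y by rewrite /e !mulmxA AX.
  have GB : G *m B = C *m G by rewrite GE -mulmxA -AX !mulmxA YA.
  have GC : invmx G *m C = B *m invmx G.
    by rewrite -[LHS]mulmx1 -(mulmxV GU) !mulmxA -(mulmxA _ C) -GB mulmxA mulVmx // mul1mx.
  by rewrite YA mulmxA -(mulmxA X) GC mulmxA.
have ehom : is_hom e.
  apply: (intertwines_hom pchark); split=> [||n].
  - apply: comm (famx_basisE pchark rp la_r gz) (tau_basisE _).
  - apply: comm (famx_basisF pchark r z) (tau_basisF gy).
  - apply: comm (famx_basisW pchark rp gz n) (tau_basisW gy n).
exists (invmx G *m Y); split; last by exists y.
split=> //; last by rewrite -mulmxA -GE mulVmx.
(* The case e = 0 gives G = Y e X = 0, which is impossible for an invertible matrix of positive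
   size. *)
have [e0|e1] := indecomposable_idem indM ehom ee; last by rewrite mulmxA.
have G0 : G = 0.
  transitivity (Y *m e *m X); last by rewrite e0 mulmx0 mul0mx.
  by rewrite /e !mulmxA -GE mulmxV // mul1mx -GE.
have := mulVmx GU; rewrite G0 mulmx0 => /matrixP.
move/(_ (lshift p (Ordinal (ltnW p_gt1))) (lshift p (Ordinal (ltnW p_gt1))))/eqP.
by rewrite !mxE eqxx eq_sym oner_eq0.
Qed.

Section Basis.
Variables (M : G1Tmod k p) (z : 'cV[k]_(dim M)) (L : 'M[k]_(p + p, dim M)).
Hypothesis zL : is_basis z L.

Lemma hom_powE (N : G1Tmod k p) (f : lin M N) n (x : 'cV[k]_(dim M)) :
  is_hom f -> Eop N ^+ n *m (f *m x) = f *m (Eop M ^+ n *m x).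
Proof.
move=> /(is_hom_intertwines pchark) [fE _ _].
elim: n => [|n IH]; first by rewrite !mxpow0.
by rewrite !mxpowSl IH !mulmxA fE.
Qed.

Lemma hom_powF (N : G1Tmod k p) (f : lin M N) n (x : 'cV[k]_(dim M)) :
  is_hom f -> Fop N ^+ n *m (f *m x) = f *m (Fop M ^+ n *m x).
Proof.
move=> /(is_hom_intertwines pchark) [_ fF _].
elim: n => [|n IH]; first by rewrite !mxpow0.
by rewrite !mxpowSl IH !mulmxA fF.
Qed.

Lemma gen_image (N : G1Tmod k p) (f : lin M N) : is_hom f ->
  gen (M := N) (f *m z).
Proof.
move=> hf; have [fE fF fw] := is_hom_intertwines pchark hf.
have [[wz Erz Ez] _ _] := zL; split.
- by rewrite /wtvec mulmxA -fw -mulmxA wz.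
- by rewrite hom_powE // Erz mulmx0.
by rewrite hom_powE // hom_powF // scalemxAr -Ez !mulmxA fE.
Qed.

Lemma hom_fa (N : G1Tmod k p) (f : lin M N) i : is_hom f ->
  fa (M := N) (f *m z) i = f *m fa z i.
Proof. by move=> hf; rewrite /upper_vec hom_powE // hom_powF. Qed.

Lemma hom_fb (N : G1Tmod k p) (f : lin M N) i : is_hom f ->
  fb (M := N) (f *m z) i = f *m fb z i.
Proof. by move=> hf; rewrite /lower_vec hom_powF. Qed.

Lemma hom_basis (N : G1Tmod k p) (f : lin M N) : is_hom f ->
  basis (M := N) (f *m z) = f *m basis z.
Proof.
move=> hf; rewrite mul_mx_row !mul_famx.
by congr row_mx; apply: eq_famx => j _; rewrite ?hom_fa ?hom_fb.
Qed.

Lemma hom_det (N : G1Tmod k p) (f h : lin M N) : is_hom f -> is_hom h ->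
  f *m z = h *m z -> f = h.
Proof.
have [_ XL _] := zL => hf hh fh.
by rewrite -[LHS]mulmx1 -[RHS]mulmx1 -XL !mulmxA -!hom_basis // fh.
Qed.

(** The map takes the basis built from z to the vectors built from y. On both families E, F and the
    weight projections have the same matrices, so T_1(la) is universal for vectors satisfying
    [is_gen]. *)
Lemma gen_hom (N : G1Tmod k p) (y : 'cV[k]_(dim N)) : gen y ->
  is_hom (basis y *m L : lin M N).
Proof.
have [gz XL LX] := zL => gy.
have comm (A : 'M[k]_(dim M)) A' B : A *m basis z = basis z *m B ->
    A' *m basis y = basis y *m B -> basis y *m L *m A = A' *m (basis y *m L).
  move=> AX AY; rewrite -[A]mulmx1 -XL -mulmxA.
  rewrite [A *m _]mulmxA AX -[basis z *m B *m L]mulmxA [L *m _]mulmxA LX mul1mx.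
  by rewrite !mulmxA AY.
apply: (intertwines_hom pchark); split=> [||n].
- exact: comm (famx_basisE pchark rp la_r gz) (famx_basisE pchark rp la_r gy).
- exact: comm (famx_basisF pchark r z) (famx_basisF pchark r y).
have Wz := famx_basisW pchark rp gz n; have Wy := famx_basisW pchark rp gy n.
exact: (comm _ _ _ Wz Wy).
Qed.

Lemma gen_hom_z (N : G1Tmod k p) (y : 'cV[k]_(dim N)) : gen y ->
  basis y *m L *m z = y.
Proof.
move=> gy; have [gz XL LX] := zL.
have : basis y *m L *m basis z = basis y by rewrite -mulmxA LX mulmx1.
rewrite {2 3}/gen_basis mul_mx_row => /eq_row_mx[_].
rewrite mul_famx => /matrixP H.
apply/colP => i; have := H i (Ordinal (ltnW p_gt1)).
by rewrite [LHS]mxE [RHS]mxE /= /lower_vec !mxpow0.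
Qed.

Lemma wt_span n (x : 'cV[k]_(dim M)) : wtvec n x -> exists al be : nat -> k,
  x = \sum_(j < p) ((isw la n j)%:R * al j) *: fa z j
      + \sum_(j < p) ((isw mu n j)%:R * be j) *: fb z j.
Proof.
have [gz XL LX] := zL => wx; pose c := L *m x.
have xc : x = basis z *m c by rewrite mulmxA XL mul1mx.
have cE (u : 'cV[k]_p) (i : 'I_p) : (fun i => if insub i is Some j then u j 0 else 0) i = u i 0.
  by rewrite valK.
(* The coordinates are extended by 0 to functions on natural numbers, so that single indices can be
   selected later. *)
exists (fun i => if insub i is Some j then usubmx c j 0 else 0).
exists (fun i => if insub i is Some j then dsubmx c j 0 else 0).
rewrite -wx {1}xc mulmxA (famx_basisW pchark rp gz n) -mulmxA.
rewrite -[c]vsubmxK /mat_wp mul_block_col !mul0mx addr0 add0r.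
rewrite mul_row_col !famxE vsubmxK.
have dg (f : nat -> k) (u : 'cV[k]_p) (i : 'I_p) :
    (famc p f id *m u) i 0 = f i * u i 0.
  rewrite mxE (bigD1 i) //= big1 => [|j ji]; rewrite [famc _ _ _ _ _]mxE /=.
    by rewrite eqxx mulr1 addr0.
  rewrite (_ : (i == j :> nat) = false) ?mulr0 ?mul0r //.
  by apply: contraNF ji => /eqP ij; apply/eqP/val_inj.
by congr (_ + _); apply: eq_bigr => i _; rewrite dg valK.
Qed.

End Basis.

Lemma T1_unique (M N : G1Tmod k p) : is_T1 la M -> is_T1 la N -> isomorphic M N.
Proof.
move=> /T1_basis[z [L [zL _]]] /T1_basis[y [L' [yL' _]]].
have [gz XL LX] := zL; have [gy YL LY] := yL'.
exists (basis y *m L), (basis z *m L'); split.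
- exact: (gen_hom zL gy).
- exact: (gen_hom yL' gz).
- by rewrite mulmxA -(mulmxA _ L') LY mulmx1.
by rewrite mulmxA -(mulmxA _ L) LX mulmx1.
Qed.

End Structure.

(** * Twists and symmetric forms *)

Section Twists.
Variables (k : closedFieldType) (p : nat).
Hypothesis pchark : p \in [pchar k].
Implicit Types M N : G1Tmod k p.

Lemma act_twist (R : comAlgType k) l M (g : 'M[R]_2) :
  act_at (twist pchark l M) g = chi (p%:Z * l) g *: act_at M g.
Proof. by rewrite -map_twist_act. Qed.

Lemma chi_frobK (R : comAlgType k) l (g : 'M[R]_2) : in_G1T p g ->
  chi (p%:Z * l) g * chi (p%:Z * - l) g = 1.
Proof.
case=> _ /in_T_mk2E[gE ad]; rewrite !(chi_frob pchark) -/(Frob p g).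
have adX n : Frob p g 0 0 ^+ n * Frob p g 1 1 ^+ n = 1.
  by rewrite -exprMn ad expr1n.
case: l => [[|n]|n] /=; first by rewrite mulr1.
  exact: adX.
by rewrite mulrC; exact: adX.
Qed.

(** Moves the twist to the target, so that the universal property of an untwisted source applies. *)
Lemma hom_twistl l M N (f : 'M[k]_(dim N, dim M)) :
  is_hom (f : lin (twist pchark l M) N) <-> is_hom (f : lin M (twist pchark (- l) N)).
Proof.
split=> hf R g gG; have := hf R g gG; rewrite !act_twist.
  rewrite -scalemxAr -scalemxAl => <-.
  by rewrite scalerA mulrC chi_frobK // scale1r.
rewrite -scalemxAr => ->; rewrite -scalemxAl scalerA chi_frobK //.
by rewrite scale1r.
Qed.

Lemma hom_twist l M N (f : 'M[k]_(dim N, dim M)) :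
  is_hom (f : lin M N) <->
  is_hom (f : lin (twist pchark l M) (twist pchark l N)).
Proof.
split=> hf R g gG.
  by rewrite !act_twist -scalemxAr -scalemxAl; congr (_ *: _); exact: hf.
have := hf R g gG; rewrite !act_twist -scalemxAr -scalemxAl.
move/(congr1 (fun X => chi (p%:Z * - l) g *: X)).
by rewrite !scalerA mulrC chi_frobK // !scale1r.
Qed.

Lemma hom_twistr l M N (f : 'M[k]_(dim N, dim M)) :
  is_hom (f : lin M (twist pchark l N)) <-> is_hom (f : lin (twist pchark (- l) M) N).
Proof. by rewrite hom_twistl opprK. Qed.

Lemma chi_up (R : comAlgType k) n (s : R) : chi n (up s) = 1.
Proof. by case: n => n /=; rewrite mxE /= expr1n. Qed.

Lemma chi_lo (R : comAlgType k) n (s : R) : chi n (lo s) = 1.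
Proof. by case: n => n /=; rewrite mxE /= expr1n. Qed.

Lemma E_twist l M : Eop (twist pchark l M) = Eop M.
Proof.
apply: (Eop_unique pchark (M := twist pchark l M)) => R s ss.
by rewrite act_twist chi_up scale1r (act_up_square0 pchark).
Qed.

Lemma F_twist l M : Fop (twist pchark l M) = Fop M.
Proof.
apply: (Fop_unique pchark (M := twist pchark l M)) => R s ss.
by rewrite act_twist chi_lo scale1r (act_lo_square0 pchark).
Qed.

Lemma wp_twist l M n : wp (twist pchark l M) n = wp M (n - p%:Z * l).
Proof.
pose B n : 'M_(dim M) := wp M (n - p%:Z * l).
apply: (@wp_uniq k p pchark (twist pchark l M) [seq m + p%:Z * l | m <- wts M] B).
- by rewrite map_inj_uniq ?wts_uniq //; exact: addIr.
- by rewrite big_map -(wp_sum M); apply: eq_bigr => m _; rewrite /B addrK.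
- move=> m mw; rewrite /B wp_notin //; apply: contra mw => mw.
  by apply/mapP; exists (m - p%:Z * l); rewrite ?subrK.
move=> m t t0; have -> : tor (twist pchark l M) t = t ^ (p%:Z * l) *: tor M t.
  by rewrite /tor act_twist chi_expz.
have tB : tor M t *m B m = t ^ (m - p%:Z * l) *: B m by exact: tor_wp.
apply: etrans (esym (scalemxAl _ _ _)) _; rewrite tB scalerA -expfzDr //.
by rewrite [_ + (m - _)]addrC subrK.
Qed.

(** A sum of twists and the twist of a sum are different records over the same vector space; being a
    homomorphism depends only on the action at points. *)
Lemma dsum_twist_act l r (N : 'I_r -> G1Tmod k p) (R : comAlgType k) (g : 'M[R]_2) :
  act_at (dsum (fun i => twist pchark l (N i))) g
    = chi (p%:Z * l) g *: act_at (dsum N) g.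
Proof.
rewrite !act_dsum; apply/mxblockP => i j; rewrite mxblockK.
have -> (c : R) (A : 'M[R]_(\sum_i dim (N i))) :
    submxblock (c *: A) i j = c *: submxblock A i j.
  by apply/matrixP => x y; rewrite !mxE.
rewrite mxblockK; have [<-|_] := eqVneq i j; last by rewrite scaler0.
by rewrite !conform_mx_id act_twist.
Qed.

Lemma twist_dsum_hom l r M (N : 'I_r -> G1Tmod k p) (f : 'M[k]_(dim (dsum N), dim M)) :
  is_hom (f : lin (twist pchark l M) (dsum N)) ->
  is_hom (f : lin M (dsum (fun i => twist pchark (- l) (N i)))).
Proof.
move/hom_twistl => hf R g gG; have := hf R g gG.
by rewrite act_twist dsum_twist_act.
Qed.

Lemma dsum_twist_hom l r M (N : 'I_r -> G1Tmod k p) (f : 'M[k]_(dim M, dim (dsum N))) :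
  is_hom (f : lin (dsum N) (twist pchark l M)) ->
  is_hom (f : lin (dsum (fun i => twist pchark (- l) (N i))) M).
Proof.
move/hom_twistr => hf R g gG; have := hf R g gG.
by rewrite act_twist dsum_twist_act.
Qed.

Lemma T1_twist l m M : is_T1 m M -> is_T1 (m + p%:Z * l) (twist pchark l M).
Proof.
move=> [projM [dM indM] [hw hmax]]; split.
- move=> A B f h hf rf /hom_twistl hh.
  have hf' : is_hom (f : lin (twist pchark (- l) A) (twist pchark (- l) B)).
    exact: (@hom_twist (- l) A B f).1 hf.
  have [x hx fx] := projM _ _ _ _ hf' rf hh.
  by exists x => //; apply/hom_twistl.
- split=> // N [f [h [hf hh hfK fhK]]].
  have [] := indM (fun i => twist pchark (- l) (N i)); last by move=> i di; exists i.
  by exists f, h; split=> //; [exact: twist_dsum_hom | exact: dsum_twist_hom].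
split.
  have [v v0 wv] := has_weight_wtvec pchark hw.
  apply: (wtvec_has_weight pchark (M := twist pchark l M) v0).
  by rewrite /wtvec wp_twist addrK.
move=> n /(has_weight_wtvec pchark)[v v0].
rewrite /wtvec wp_twist => wv.
have [j jE] := hmax _ (@wtvec_has_weight k p pchark M _ v v0 wv).
by exists j; rewrite jE; lia.
Qed.

End Twists.

Section SymmetricForm.
Variables (k : closedFieldType) (p : nat).
Hypotheses (pchark : p \in [pchar k]) (p_gt2 : (2 < p)%N).
Variables (r : nat) (la : int).
Hypotheses (rp : (r.+1 < p)%N) (la_r : la%:~R = r%:R :> k).

(** Let psi be the homomorphism to the dual with psi z = y. Its transpose is again a homomorphism,
    and both images of z have the same pairing with F^(r+1) E^(r+1) z. For S = psi + psi^T this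
    pairing is doubled, hence nonzero as p > 2, and the Gram matrix criterion makes S invertible. *)
Lemma T1_form (M : G1Tmod k p) : is_T1 la M -> exists S : 'M[k]_(dim M),
  [/\ is_hom (S : lin M (tau M)), S \in unitmx & S^T = S].
Proof.
move=> /(T1_basis pchark rp la_r)[z [L [zL [y gy ka0]]]].
have [gz XL LX] := zL.
have form_unit (w : 'cV[k]_(dim (tau M))) : is_gen r la w ->
    w^T *m upper_vec r z r.+1 != 0 -> (gen_basis r w *m L : 'M[k]_(dim M)) \in unitmx.
  move=> gw w0; have GU := gram_unit pchark rp la_r gz gw w0.
  set psi : 'M_(dim M) := _ *m L.
  have : psi^T *m (gen_basis r z *m invmx (gram r z w) *m (gen_basis r z)^T) = 1%:M.
    have -> : psi^T = L^T *m (gen_basis (M := tau M) r w)^T by rewrite trmx_mul.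
    rewrite !mulmxA -(mulmxA L^T) -/(gram r z w) -(mulmxA L^T) mulmxV //.
    by rewrite mulmx1 -trmx_mul XL trmx1.
  by case/mulmx1_unit; rewrite unitmx_tr.
pose psi : 'M[k]_(dim M) := gen_basis (M := tau M) r y *m L.
have psi_hom : is_hom (psi : lin M (tau M)) by exact: (gen_hom pchark rp la_r zL gy).
have psi_z : psi *m z = y by exact: (gen_hom_z pchark zL gy).
clearbody psi.
have psiT_hom : is_hom (psi^T : lin M (tau M)).
  apply/(is_homP pchark); have [pE pF pw] := is_hom_intertwines pchark psi_hom.
  rewrite F_tau in pF; rewrite E_tau in pE.
  split=> [||n].
  - rewrite E_tau -[Eop M]trmxK.
    apply: (etrans (esym (trmx_mul (Eop M)^T psi))).
    by apply: (etrans (congr1 trmx (esym pF))); exact: trmx_mul.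
  - rewrite F_tau -[Fop M]trmxK.
    apply: (etrans (esym (trmx_mul (Fop M)^T psi))).
    by apply: (etrans (congr1 trmx (esym pE))); exact: trmx_mul.
  have pwn := pw n; rewrite wp_tau // in pwn.
  rewrite wp_tau // -[wp M n in LHS]trmxK.
  apply: (etrans (esym (trmx_mul (wp M n)^T psi))).
  by apply: (etrans (congr1 trmx (esym pwn))); exact: trmx_mul.
pose S : 'M[k]_(dim M) := psi + psi^T.
have S_hom : is_hom (S : lin M (tau M)) by exact: is_homD.
exists S; split=> //; last by rewrite linearD /= trmxK addrC.
pose a := upper_vec r z r.+1.
(* The operator F^(r+1) E^(r+1) is self-adjoint, since duality exchanges E and F and reverses
   products. *)
have zpsia : (psi^T *m z)^T *m a = (y^T *m a)^T.
  rewrite trmx_mul trmxK -mulmxA.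
  have -> : psi *m a = upper_vec (M := tau M) r y r.+1.
    by rewrite -psi_z; exact: esym (hom_fa pchark r z r.+1 psi_hom).
  rewrite -[LHS]trmxK trmx_mul trmxK; congr (_^T).
  by rewrite /upper_vec tau_powF tau_powE.
have Sz_gen : is_gen (p := p) (M := tau M) r la (S *m z) by exact: (gen_image pchark zL S_hom).
have -> : S = gen_basis (M := tau M) r (S *m z) *m L.
  by rewrite (hom_basis pchark r z S_hom) -mulmxA XL mulmx1.
apply: form_unit => //.
have -> : (S *m z)^T *m a = y^T *m a + (y^T *m a)^T.
  by rewrite mulmxDl linearD /= mulmxDl psi_z zpsia.
have -> : (y^T *m a)^T = y^T *m a by apply/matrixP => i j; rewrite !ord1 mxE.
rewrite -mulr2n -scaler_nat scaler_eq0 negb_or ka0 andbT.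
by apply: (natr_neq0 pchark); rewrite p_gt2.
Qed.

End SymmetricForm.

(** * Homomorphisms between the P_m and Q_m *)

Section TwistedHoms.
Variables (k : closedFieldType) (p : nat).
Hypothesis pchark : p \in [pchar k].
Variables (r : nat) (la : int).
Hypotheses (rp : (r.+1 < p)%N) (la_r : la%:~R = r%:R :> k).
Variables (A B : G1Tmod k p) (z : 'cV[k]_(dim A)) (L : 'M[k]_(p + p, dim A)).
Hypothesis zL : is_basis r la z L.
Local Notation tw := (twist pchark).
Implicit Types (l : int) (f h : 'M[k]_(dim B, dim A)).

Lemma twhom_wt l l' f : is_hom (f : lin (tw l A) (tw l' B)) ->
  wtvec (gen_weight r la + p%:Z * (l - l')) (f *m z).
Proof.
move/hom_twistl => hf; have [wz _ _] := gen_image pchark zL hf.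
move: wz; rewrite /wtvec !wp_twist; congr (wp B _ *m _ = _); lia.
Qed.

Lemma twhom_det l l' f h : is_hom (f : lin (tw l A) (tw l' B)) ->
  is_hom (h : lin (tw l A) (tw l' B)) -> f *m z = h *m z -> f = h.
Proof. by move=> /hom_twistl hf /hom_twistl hh; exact: (hom_det pchark zL hf hh). Qed.

Lemma twhom0 l l' f : is_hom (f : lin (tw l A) (tw l' B)) -> f *m z = 0 -> f = 0.
Proof.
move=> hf fz; apply: (twhom_det hf (is_hom0 (tw l A) (tw l' B))).
by rewrite fz; exact: esym (mul0mx _ _).
Qed.

Lemma twhom_E l l' f n (x : 'cV[k]_(dim A)) : is_hom (f : lin (tw l A) (tw l' B)) ->
  f *m (Eop A ^+ n *m x) = Eop B ^+ n *m (f *m x).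
Proof.
move/hom_twistl => hf; have := hom_powE pchark n x hf.
by rewrite !E_twist => H; exact: esym H.
Qed.

Lemma twhom_F l l' f n (x : 'cV[k]_(dim A)) : is_hom (f : lin (tw l A) (tw l' B)) ->
  f *m (Fop A ^+ n *m x) = Fop B ^+ n *m (f *m x).
Proof.
move/hom_twistl => hf; have := hom_powF pchark n x hf.
by rewrite !F_twist => H; exact: esym H.
Qed.

End TwistedHoms.

Section SumPick.
Variables (k : fieldType) (V : lmodType k) (p : nat).

Lemma sum_pick (P : nat -> bool) (a : nat -> k) (G : nat -> V) j0 :
  (j0 < p)%N -> (forall j, (j < p)%N -> P j = (j == j0)) ->
  \sum_(j < p) ((P j)%:R * a j) *: G j = a j0 *: G j0.
Proof.
move=> jp HP; rewrite (bigD1 (Ordinal jp)) //= big1 => [|j jj].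
  by rewrite HP // eqxx mul1r addr0.
rewrite HP // (_ : (_ == _) = false) ?mul0r ?scale0r //.
by apply: contraNF jj => /eqP jj; apply/eqP/val_inj.
Qed.

Lemma sum_none (P : nat -> bool) (a : nat -> k) (G : nat -> V) :
  (forall j, (j < p)%N -> P j = false) ->
  \sum_(j < p) ((P j)%:R * a j) *: G j = 0.
Proof. by move=> HP; rewrite big1 // => j _; rewrite HP // mul0r scale0r. Qed.

End SumPick.

Section Block.
Variables (k : closedFieldType) (p : nat).
Hypotheses (pchark : p \in [pchar k]) (p_gt2 : (2 < p)%N).
Variables (P0 Q0 : G1Tmod k p).
Local Notation tw := (twist pchark).
Local Notation rQ := (p - 2)%N.
Local Notation laQ := ((2 * p)%:Z - 2).
Variables (zP : 'cV[k]_(dim P0)) (LP : 'M[k]_(p + p, dim P0)).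
Variables (zQ : 'cV[k]_(dim Q0)) (LQ : 'M[k]_(p + p, dim Q0)).
Hypotheses (bP : is_basis 0 0 zP LP) (bQ : is_basis rQ laQ zQ LQ).

Lemma rP_lt : (1 < p)%N. Proof. exact: ltnW. Qed.
Lemma rQ_lt : (rQ.+1 < p)%N. Proof. by lia. Qed.
Lemma laP_r : 0%:~R = 0%:R :> k. Proof. by []. Qed.
Lemma laQ_r : laQ%:~R = rQ%:R :> k.
Proof.
rewrite intrB -[((2 * p)%:Z)%:~R]/((2 * p)%:R) natrM (pcharf0 pchark) mulr0.
by rewrite natrB ?(pcharf0 pchark) // ltnW.
Qed.

Local Notation aP := (upper_vec 0 zP).
Local Notation bP_ := (lower_vec zP).
Local Notation aQ := (upper_vec rQ zQ).
Local Notation bQ_ := (lower_vec zQ).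

Lemma muP : gen_weight 0 0 = -2. Proof. by []. Qed.
Lemma muQ : gen_weight rQ laQ = 0. Proof. by rewrite /gen_weight; lia. Qed.

(** The image of z has weight -2 + 2p (m - m'), while the weights of [P0] lie between -2p and 0.
    Only m = m' remains, and the weight -2 occurs in the basis as F v and as z. *)
Lemma hom_PP m m' (f : 'M[k]_(dim P0, dim P0)) :
  is_hom (f : lin (tw (2 * m) P0) (tw (2 * m') P0)) ->
  if m == m' then exists al be : k, f *m zP = al *: zP + be *: aP 1 else f = 0.
Proof.
move=> hf; have := twhom_wt rP_lt bP hf.
have -> : gen_weight 0 0 + p%:Z * (2 * m - 2 * m') = -2 + 2 * (p%:Z * (m - m')).
  by rewrite muP; lia.
case: eqVneq => [->|mm'].
  rewrite subrr mulr0 mulr0 addr0 => w.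
  have [al [be ->]] := wt_span pchark rP_lt bP w.
  exists (be 0%N), (al 1%N); rewrite addrC; congr (_ + _).
    rewrite (sum_pick (j0 := 0) _ _ (ltnW rP_lt)) ?/lower_vec ?mxpow0 //.
    by move=> j jp; rewrite /isw muP; lia.
  by rewrite (sum_pick (j0 := 1) _ _ rP_lt) // => j jp; rewrite /isw; lia.
move=> w; apply: (twhom0 bP hf).
have [al [be ->]] := wt_span pchark rP_lt bP w.
have [X0|X0] : (p%:Z * (m - m') >= p%:Z) \/ (p%:Z * (m - m') <= - p%:Z).
- by nia.
- by rewrite !sum_none ?addr0 // => j jp; rewrite /isw ?muP; lia.
by rewrite !sum_none ?addr0 // => j jp; rewrite /isw ?muP; lia.
Qed.

(** The weights of [Q0] lie between -(2p - 2) and 2p - 2. Among the candidates -2 + 2p (m - m') this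
    leaves -2 and 2p - 2, each of multiplicity one. *)
Lemma hom_PQ m m' (f : 'M[k]_(dim Q0, dim P0)) :
  is_hom (f : lin (tw (2 * m) P0) (tw (2 * m') Q0)) ->
  if m == m' then exists be : k, f *m zP = be *: bQ_ 1
  else if m == m' + 1 then exists al : k, f *m zP = al *: aQ 0 else f = 0.
Proof.
move=> hf; have := twhom_wt rP_lt bP hf.
have -> : gen_weight 0 0 + p%:Z * (2 * m - 2 * m') = -2 + 2 * (p%:Z * (m - m')).
  by rewrite muP; lia.
move=> w; have [al [be fE]] := wt_span pchark rQ_lt bQ w.
case: eqVneq => [mm'|mm'].
  exists (be 1%N); rewrite fE mm' subrr mulr0 mulr0 addr0 sum_none ?add0r.
    by rewrite (sum_pick (j0 := 1) _ _ rP_lt) // => j jp; rewrite /isw muQ; lia.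
  by move=> j jp; rewrite /isw; lia.
case: eqVneq => [mm1|mm1].
  exists (al 0%N); rewrite fE mm1 [m' + 1]addrC addrK mulr1 [X in _ + X]sum_none ?addr0.
    by rewrite (sum_pick (j0 := 0) _ _ (ltnW rP_lt)) // => j jp; rewrite /isw; lia.
  by move=> j jp; rewrite /isw muQ; lia.
apply: (twhom0 bP hf); rewrite fE.
have [X0|X0] : (p%:Z * (m - m') >= 2 * p%:Z) \/ (p%:Z * (m - m') <= - p%:Z).
- by nia.
- by rewrite !sum_none ?addr0 // => j jp; rewrite /isw ?muQ; lia.
by rewrite !sum_none ?addr0 // => j jp; rewrite /isw ?muQ; lia.
Qed.

Lemma hom_QQ m m' (f : 'M[k]_(dim Q0, dim Q0)) :
  is_hom (f : lin (tw (2 * m) Q0) (tw (2 * m') Q0)) ->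
  if m == m' then exists al be : k, f *m zQ = al *: zQ + be *: aQ p.-1 else f = 0.
Proof.
move=> hf; have := twhom_wt rQ_lt bQ hf.
have -> : gen_weight rQ laQ + p%:Z * (2 * m - 2 * m') = 2 * (p%:Z * (m - m')).
  by rewrite muQ; lia.
move=> w; have [al [be fE]] := wt_span pchark rQ_lt bQ w.
case: eqVneq => [mm'|mm'].
  exists (be 0%N), (al p.-1); rewrite fE mm' subrr mulr0 mulr0 addrC; congr (_ + _).
    rewrite (sum_pick (j0 := 0) _ _ (ltnW rP_lt)) ?/lower_vec ?mxpow0 //.
    by move=> j jp; rewrite /isw muQ; lia.
  have p1 : (p.-1 < p)%N by lia.
  by rewrite (sum_pick (j0 := p.-1) _ _ p1) // => j jp; rewrite /isw; lia.
apply: (twhom0 bQ hf); rewrite fE.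
have [X0|X0] : (p%:Z * (m - m') >= p%:Z) \/ (p%:Z * (m - m') <= - p%:Z).
- by nia.
- by rewrite !sum_none ?addr0 // => j jp; rewrite /isw ?muQ; lia.
by rewrite !sum_none ?addr0 // => j jp; rewrite /isw ?muQ; lia.
Qed.

Lemma hom_QP m m' (f : 'M[k]_(dim P0, dim Q0)) :
  is_hom (f : lin (tw (2 * m) Q0) (tw (2 * m') P0)) ->
  if m == m' then exists al : k, f *m zQ = al *: aP 0
  else if m' == m + 1 then exists be : k, f *m zQ = be *: bP_ p.-1 else f = 0.
Proof.
move=> hf; have := twhom_wt rQ_lt bQ hf.
have -> : gen_weight rQ laQ + p%:Z * (2 * m - 2 * m') = 2 * (p%:Z * (m - m')).
  by rewrite muQ; lia.
move=> w; have [al [be fE]] := wt_span pchark rP_lt bP w.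
case: eqVneq => [mm'|mm'].
  exists (al 0%N); rewrite fE mm' subrr mulr0 mulr0 [X in _ + X]sum_none ?addr0.
    by rewrite (sum_pick (j0 := 0) _ _ (ltnW rP_lt)) // => j jp; rewrite /isw; lia.
  by move=> j jp; rewrite /isw muP; lia.
case: eqVneq => [mm1|mm1].
  have p1 : (p.-1 < p)%N by lia.
  exists (be p.-1); rewrite fE mm1 opprD addrA subrr sub0r mulrN1 sum_none ?add0r.
    by rewrite (sum_pick (j0 := p.-1) _ _ p1) // => j jp; rewrite /isw muP; lia.
  by move=> j jp; rewrite /isw; lia.
apply: (twhom0 bQ hf); rewrite fE.
have [X0|X0] : (p%:Z * (m - m') >= p%:Z) \/ (p%:Z * (m - m') <= - (2 * p%:Z)).
- by nia.
- by rewrite !sum_none ?addr0 // => j jp; rewrite /isw ?muP; lia.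
by rewrite !sum_none ?addr0 // => j jp; rewrite /isw ?muP; lia.
Qed.

End Block.

Section Twists.
Variables (k : closedFieldType) (p : nat).
Hypothesis pchark : p \in [pchar k].
Local Notation tw := (twist pchark).
Variables (A B : G1Tmod k p).

Lemma twhomP l l' (f : 'M[k]_(dim B, dim A)) :
  is_hom (f : lin (tw l A) (tw l' B)) <->
  [/\ f *m Eop A = Eop B *m f, f *m Fop A = Fop B *m f &
      forall n, f *m wp A n = wp B (n + p%:Z * (l - l')) *m f].
Proof.
split=> [/(is_hom_intertwines pchark)|] [fE fF fw].
  rewrite !E_twist !F_twist in fE fF; split=> // n.
  have := fw (n + p%:Z * l); rewrite !wp_twist addrK => ->.
  by congr (wp B _ *m _); lia.
apply: (intertwines_hom pchark); split=> [||n]; rewrite ?E_twist ?F_twist //.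
by rewrite !wp_twist; apply: etrans (fw _) _; congr (wp B _ *m _); lia.
Qed.

Lemma tw_shift l l' m m' (f : 'M[k]_(dim B, dim A)) : l - l' = m - m' ->
  is_hom (f : lin (tw l A) (tw l' B)) -> is_hom (f : lin (tw m A) (tw m' B)).
Proof. by move=> E /twhomP H; apply/twhomP; rewrite -E. Qed.

Lemma tw0l l (f : 'M[k]_(dim B, dim A)) :
  is_hom (f : lin A (tw l B)) -> is_hom (f : lin (tw 0 A) (tw l B)).
Proof.
move=> /(is_hom_intertwines pchark)[fE fF fw]; apply/twhomP.
rewrite E_twist F_twist in fE fF; split=> // n; rewrite fw wp_twist.
by congr (wp B _ *m _); lia.
Qed.

End Twists.

(** * Composites of neighbouring arrows *)

Section Arrows.
Variables (k : closedFieldType) (p : nat).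
Hypotheses (pchark : p \in [pchar k]) (p_gt2 : (2 < p)%N).
Variables (P0 Q0 : G1Tmod k p).
Local Notation tw := (twist pchark).
Local Notation rQ := (p - 2)%N.
Local Notation laQ := ((2 * p)%:Z - 2).
Variables (zP : 'cV[k]_(dim P0)) (LP : 'M[k]_(p + p, dim P0)).
Variables (zQ : 'cV[k]_(dim Q0)) (LQ : 'M[k]_(p + p, dim Q0)).
Hypotheses (bP : is_basis 0 0 zP LP) (bQ : is_basis rQ laQ zQ LQ).
Local Notation aP := (upper_vec 0 zP).
Local Notation bP_ := (lower_vec zP).
Local Notation aQ := (upper_vec rQ zQ).
Local Notation bQ_ := (lower_vec zQ).
Local Notation gcQ := (gen_coef k rQ).

Lemma even_PP m m' (u : 'M[k]_(dim Q0, dim P0)) (d : 'M[k]_(dim P0, dim Q0)) al be :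
  is_hom (u : lin (tw m P0) (tw m' Q0)) -> is_hom (d : lin (tw m' Q0) (tw m P0)) ->
  u *m zP = al *: bQ_ 1 -> d *m zQ = be *: aP 0 ->
  d *m u *m zP = (al * be) *: aP 1.
Proof.
move=> hu hd uz dz; rewrite -mulmxA uz -scalemxAr (twhom_F 1 _ hd) dz -scalemxAr scalerA.
by rewrite /upper_vec mxpow0 .
Qed.

(** On z of weight 0 the operators E and F commute, so E F z = F (E z), and the value of E z
    prescribed by [is_gen] brings in [gcQ]. *)
Lemma even_QQ m m' (u : 'M[k]_(dim Q0, dim P0)) (d : 'M[k]_(dim P0, dim Q0)) al be :
  is_hom (u : lin (tw m P0) (tw m' Q0)) -> is_hom (d : lin (tw m' Q0) (tw m P0)) ->
  u *m zP = al *: bQ_ 1 -> d *m zQ = be *: aP 0 ->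
  u *m d *m zQ = (al * be * gcQ) *: aQ p.-1.
Proof.
move=> hu hd uz dz; have [gz _ _] := bQ; have [wz _ Ez] := gz.
rewrite -mulmxA dz -scalemxAr /upper_vec mxpow0 (twhom_E 1 _ hu) uz -scalemxAr scalerA.
rewrite [be * al]mulrC -scalerA; congr (_ *: _).
have := EF_wt pchark wz; rewrite (muQ pchark p_gt2) scale0r addr0 => EF.
rewrite expr1 /lower_vec expr1 EF Ez -scalemxAr -mxpowSl.
by have -> : (rQ.+1 = p.-1)%N by lia.
Qed.

Lemma odd_QQ m m' (u : 'M[k]_(dim P0, dim Q0)) (d : 'M[k]_(dim Q0, dim P0)) ga de :
  is_hom (u : lin (tw m Q0) (tw m' P0)) -> is_hom (d : lin (tw m' P0) (tw m Q0)) ->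
  u *m zQ = ga *: bP_ p.-1 -> d *m zP = de *: aQ 0 ->
  d *m u *m zQ = (ga * de) *: aQ p.-1.
Proof.
move=> hu hd uz dz; rewrite -mulmxA uz -scalemxAr (twhom_F p.-1 _ hd) dz.
by rewrite -scalemxAr scalerA /upper_vec mxpow0.
Qed.

Lemma gcQ_neq0 : gcQ != 0.
Proof. by rewrite invr_eq0 expf_neq0 // (fact_neq0 pchark) //; lia. Qed.

(** The composite sends z to a multiple of E^(p-1) F^(p-1) z. As p = 0, the first E takes F^(p-1) z
    to F^(p-1) E z, and the remaining E^(p-2) contributes ((p-2)!)^2, the inverse of [gcQ]. Hence
    both nontrivial relations compare the same scalars. *)
Lemma odd_PP m m' (u : 'M[k]_(dim P0, dim Q0)) (d : 'M[k]_(dim Q0, dim P0)) ga de :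
  is_hom (u : lin (tw m Q0) (tw m' P0)) -> is_hom (d : lin (tw m' P0) (tw m Q0)) ->
  u *m zQ = ga *: bP_ p.-1 -> d *m zP = de *: aQ 0 ->
  u *m d *m zP = (ga * de / gcQ) *: aP 1.
Proof.
move=> hu hd uz dz; have [gz _ _] := bP.
have rP := ltnW p_gt2.
rewrite -mulmxA dz -scalemxAr {1}/upper_vec mxpow0 (twhom_E _ _ hu) uz -scalemxAr scalerA.
rewrite [de * ga]mulrC -scalerA; congr (_ *: _).
have E1 : Eop P0 *m bP_ p.-1 = aP p.-1.
  have -> : p.-1 = (p - 2).+1 by lia.
  rewrite (E_fbS pchark (laP_r k) gz) addn0.
  have -> : ((p - 2) + 2 = p)%N by lia.
  by rewrite (pcharf0 pchark) mulr0 scale0r subr0 /gen_coef fact0 expr1n invr1 scale1r.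
rewrite mxpowSr E1.
have -> : aP p.-1 = Fop P0 ^+ (rQ + 1) *m (Eop P0 ^+ 1 *m zP).
  by rewrite /upper_vec; congr (_ ^+ _ *m _); lia.
rewrite (EiFi pchark (laP_r k) (wt_v pchark (rP_lt p_gt2) gz) (E_v gz)); congr (_ *: _).
rewrite /gen_coef invrK big_split /=.
(* Reversing the order of the factors replaces l by p - l modulo p, which turns one factorial into
   the other up to signs. *)
have rev : \prod_(l < rQ) (1 + l).+1%:R = \prod_(l < rQ) (0%:R - (1 + l)%:R) :> k.
  rewrite [LHS](reindex_inj rev_ord_inj) /=; apply: eq_bigr => l _.
  have -> : ((1 + (rQ - l.+1)).+1 = p - (1 + l))%N by have := ltn_ord l; lia.
  by rewrite natrB ?(pcharf0 pchark) //; have := ltn_ord l; lia.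
rewrite rev -big_split -(prod_succ k) expr2 -big_split; apply: eq_bigr => l _ /=.
by rewrite sub0r mulrNN add1n.
Qed.

End Arrows.

Lemma fa_neq0 (k : closedFieldType) (p r : nat) (la : int) (M : G1Tmod k p)
    (z : 'cV[k]_(dim M)) (L : 'M[k]_(p + p, dim M)) j :
  is_basis r la z L -> (j < p)%N -> upper_vec r z j != 0.
Proof.
move=> [_ _ XL] jp; apply: contra_neq (oner_neq0 k) => aj0.
have := congr1 (fun A : 'M_(p + p) => A (lshift p (Ordinal jp)) (lshift p (Ordinal jp))) XL.
rewrite [RHS]mxE eqxx mulr1n => <-; rewrite mxE; apply: big1 => i _.
by rewrite row_mxEl mxE /= aj0 mxE mulr0.
Qed.

(** The character involves only diagonal entries and is therefore unchanged by transposition. *)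
Lemma form_twist (k : closedFieldType) (p : nat) (pchark : p \in [pchar k]) l
    (M : G1Tmod k p) (S : 'M[k]_(dim M)) :
  is_hom (S : lin M (tau M)) ->
  is_hom (S : lin (twist pchark l M) (tau (twist pchark l M))).
Proof.
move=> hS R g gG; rewrite act_tau !act_twist [X in _ = X *m _]linearZ /=.
have -> : chi (p%:Z * l) g^T = chi (p%:Z * l) g :> R.
  by case: (p%:Z * l) => n; rewrite /= mxE.
by rewrite -scalemxAr -scalemxAl; congr (_ *: _); rewrite hS // act_tau.
Qed.

Section Quiver.
Variables (k : closedFieldType) (p : nat).
Hypotheses (pchark : p \in [pchar k]) (p_gt2 : (2 < p)%N).
Variables (P0 Q0 : G1Tmod k p).
Local Notation tw := (twist pchark).
Local Notation rQ := (p - 2)%N.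
Local Notation laQ := ((2 * p)%:Z - 2).
Variables (zP : 'cV[k]_(dim P0)) (LP : 'M[k]_(p + p, dim P0)).
Variables (zQ : 'cV[k]_(dim Q0)) (LQ : 'M[k]_(p + p, dim Q0)).
Hypotheses (bP : is_basis 0 0 zP LP) (bQ : is_basis rQ laQ zQ LQ).
Local Notation aP := (upper_vec 0 zP).
Local Notation bP_ := (lower_vec zP).
Local Notation aQ := (upper_vec rQ zQ).
Local Notation bQ_ := (lower_vec zQ).
Local Notation gcQ := (gen_coef k rQ).
Local Notation vmod := (vmod pchark P0 Q0).
Variables (u0 : lin P0 Q0) (u1 : lin Q0 (tw 2 P0)).
Hypotheses (u0_hom : is_hom u0) (u0_neq0 : u0 != 0).
Hypotheses (u1_hom : is_hom u1) (u1_neq0 : u1 != 0).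

Lemma aP1_neq0 : aP 1 != 0. Proof. by apply: fa_neq0 bP _; clear -p_gt2; lia. Qed.
Lemma aQp_neq0 : aQ p.-1 != 0. Proof. by apply: fa_neq0 bQ _; clear -p_gt2; lia. Qed.

Lemma u_even_hom m : is_hom (u_even pchark u0 m).
Proof.
apply: (@tw_shift _ _ pchark P0 Q0 0 0) => //; first by rewrite !subrr.
exact: (proj1 (@hom_twist _ _ pchark 0 _ _ u0) u0_hom).
Qed.

Lemma u_odd_hom m : is_hom (u_odd u1 m).
Proof.
by apply: (@tw_shift _ _ pchark Q0 P0 0 2 _ _ _ _ (tw0l u1_hom)); rewrite /=; clear; lia.
Qed.

Lemma u0_coef : exists2 al, al != 0 & u0 *m zP = al *: bQ_ 1.
Proof.
have := hom_PQ (m := 0) (m' := 0) p_gt2 bP bQ (u_even_hom 0) => -[al E].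
exists al => //; apply: contraNneq u0_neq0 => al0.
by apply/eqP; apply: (twhom0 bP (u_even_hom 0)); rewrite E al0 scale0r.
Qed.

Lemma u1_coef : exists2 ga, ga != 0 & u1 *m zQ = ga *: bP_ p.-1.
Proof.
have := hom_QP (m := 0) (m' := 1) p_gt2 bP bQ (u_odd_hom 0) => -[ga E].
exists ga => //; apply: contraNneq u1_neq0 => ga0.
by apply/eqP; apply: (twhom0 bQ (u_odd_hom 0)); rewrite E ga0 scale0r.
Qed.

Lemma hom_P0Q0 (f : lin P0 Q0) : is_hom f -> exists a : k, f = a *: u0.
Proof.
move=> hf; have hf0 : is_hom (f : lin (tw (2 * 0) P0) (tw (2 * 0) Q0)).
  exact: (proj1 (@hom_twist _ _ pchark _ _ _ f) hf).
have := hom_PQ (m := 0) (m' := 0) p_gt2 bP bQ hf0 => -[be E].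
have [al al0 uE] := u0_coef; exists (be / al).
apply: (twhom_det bP hf0); first exact: is_homZ (u_even_hom 0).
by rewrite E; apply/esym/(etrans (esym (scalemxAl _ _ _))); rewrite uE scalerA divfK.
Qed.

Lemma hom_Q0P1 (f : lin Q0 (tw 2 P0)) : is_hom f -> exists a : k, f = a *: u1.
Proof.
move=> hf; have hf0 : is_hom (f : lin (tw (2 * 0) Q0) (tw (2 * 1) P0)) by exact: tw0l.
have := hom_QP (m := 0) (m' := 1) p_gt2 bP bQ hf0 => -[be E].
have [al al0 uE] := u1_coef; exists (be / al).
apply: (twhom_det bQ hf0); first exact: is_homZ (u_odd_hom 0).
by rewrite E; apply/esym/(etrans (esym (scalemxAl _ _ _))); rewrite uE scalerA divfK.
Qed.

Section Dagger.
Variable phi : iso_family pchark P0 Q0.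
Hypothesis phi_sym : symmetric_isos phi.

Lemma phi_inv_hom v : is_hom (invmx (phi v) : lin (tau (vmod v)) (vmod v)).
Proof.
have [hS uS _] := phi_sym v.
exact: (is_hom_inv hS (mulVmx uS) (mulmxV uS)).
Qed.

Lemma dagger_hom v w (f : lin (vmod v) (vmod w)) : is_hom f -> is_hom (dagger phi f).
Proof.
move=> hf; have [hS _ _] := phi_sym w.
have h1 := is_homM hS (is_hom_tr hf).
have h2 := is_homM h1 (phi_inv_hom v).
by move: h2; rewrite /dagger mulmxA.
Qed.

Lemma dagger_neq0 v w (f : lin (vmod v) (vmod w)) : f != 0 -> dagger phi f != 0.
Proof.
apply: contra_neq => df0; have [_ uv _] := phi_sym v; have [_ uw _] := phi_sym w.
apply: trmx_inj; rewrite trmx0.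
have := congr1 (fun A => phi v *m A *m invmx (phi w)) df0.
by rewrite mulmx0 mul0mx /dagger !mulmxA mulmxV // mul1mx mulmxK.
Qed.

Lemma d_even_hom m : is_hom (d_even phi u0 m).
Proof. exact: dagger_hom (u_even_hom m). Qed.

Lemma d_odd_hom m : is_hom (d_odd phi u1 m).
Proof. exact: (dagger_hom (u_odd_hom m)). Qed.

Lemma d_even_coef m : exists2 be, be != 0 & d_even phi u0 m *m zQ = be *: aP 0.
Proof.
have := hom_QP (m := m) (m' := m) p_gt2 bP bQ (d_even_hom m); rewrite eqxx => -[al E].
exists al => //.
have : d_even phi u0 m != 0 by apply: dagger_neq0.
apply: contraNneq => al0; apply/eqP.
by apply: (twhom0 bQ (d_even_hom m)); rewrite E al0 scale0r.
Qed.

Lemma d_odd_coef m : exists2 de, de != 0 & d_odd phi u1 m *m zP = de *: aQ 0.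
Proof.
have := hom_PQ (m := m + 1) (m' := m) p_gt2 bP bQ (d_odd_hom m).
rewrite (_ : (m + 1 == m) = false); last by clear; lia.
rewrite eqxx => -[al E]; exists al => //.
have : d_odd phi u1 m != 0 by apply: (@dagger_neq0 (vQ m) (vP (m + 1))).
apply: contraNneq => al0; apply/eqP.
by apply: (twhom0 bP (d_odd_hom m)); rewrite E al0 scale0r.
Qed.

Lemma loop_P m :
  exists2 c, c != 0 & d_even phi u0 m *m u_even pchark u0 m *m zP = c *: aP 1.
Proof.
have [al al0 uE] := u0_coef; have [be be0 dE] := d_even_coef m.
exists (al * be); first exact: mulf_neq0.
exact: (even_PP (u_even_hom m) (d_even_hom m) uE dE).
Qed.

Lemma loop_Q m :
  exists2 c, c != 0 & u_even pchark u0 m *m d_even phi u0 m *m zQ = c *: aQ p.-1.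
Proof.
have [al al0 uE] := u0_coef; have [be be0 dE] := d_even_coef m.
exists (al * be * gcQ); first by rewrite !mulf_neq0 ?(gcQ_neq0 pchark).
exact: (even_QQ p_gt2 bQ (u_even_hom m) (d_even_hom m) uE dE).
Qed.

(** The weight computation bounds the possible images of z, and the arrows and loops attain them
    with nonzero coefficients; division by these coefficients gives the expression. *)
Lemma hom_span v w (f : lin (vmod v) (vmod w)) : is_hom f ->
  exists e : expr k v w, eval_expr phi u0 u1 e = f.
Proof.
case: v f => -[] m; case: w => -[] m' f hf.
- have := hom_PP (m := m) (m' := m') p_gt2 bP hf.
  case: eqP hf => [mm'|_ _ ->]; last by exists (Ezero _ _ _).
  case: m' / mm' f => f hf [al [be fE]].
  have [c c0 lE] := loop_P m.
  exists (Eadd (Escale al (Eid _ (vP m)))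
    (Escale (be / c) (Ecomp (Egen k (D_even m)) (Egen k (U_even m))))) => /=.
  apply/esym/(twhom_det bP hf).
    apply: is_homD; apply: is_homZ; first exact: is_hom1.
    exact: is_homM (u_even_hom m) (d_even_hom m).
  by rewrite fE mulmxDl -!scalemxAl mul1mx lE scalerA divfK.
- have := hom_PQ (m := m) (m' := m') p_gt2 bP bQ hf.
  case: eqP hf => [mm'|_].
    case: m' / mm' f => f hf [be fE]; have [al al0 uE] := u0_coef.
    exists (Escale (be / al) (Egen k (U_even m))) => /=.
    apply/esym/(twhom_det bP hf); first exact: is_homZ (u_even_hom m).
    by rewrite fE -scalemxAl uE scalerA divfK.
  case: eqP => [mm'|_ _ ->]; last by exists (Ezero _ _ _).
  move: f; rewrite mm' => f hf [be fE]; have [de de0 dE] := d_odd_coef m'.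
  exists (Escale (be / de) (Egen k (D_odd m'))) => /=.
  apply/esym/(twhom_det bP hf); first exact: is_homZ (d_odd_hom m').
  by rewrite fE -scalemxAl dE scalerA divfK.
- have := hom_QP (m := m) (m' := m') p_gt2 bP bQ hf.
  case: eqP hf => [mm'|_].
    case: m' / mm' f => f hf [be fE]; have [de de0 dE] := d_even_coef m.
    exists (Escale (be / de) (Egen k (D_even m))) => /=.
    apply/esym/(twhom_det bQ hf); first exact: is_homZ (d_even_hom m).
    by rewrite fE -scalemxAl dE scalerA divfK.
  case: eqP => [mm'|_ _ ->]; last by exists (Ezero _ _ _).
  move: f; rewrite mm' => f hf [be fE]; have [ga ga0 uE] := u1_coef.
  exists (Escale (be / ga) (Egen k (U_odd m))) => /=.
  apply/esym/(twhom_det bQ hf); first exact: is_homZ (u_odd_hom m).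
  by rewrite fE -scalemxAl uE scalerA divfK.
have := hom_QQ (m := m) (m' := m') p_gt2 bQ hf.
case: eqP hf => [mm'|_ _ ->]; last by exists (Ezero _ _ _).
case: m' / mm' f => f hf [al [be fE]].
have [c c0 lE] := loop_Q m.
exists (Eadd (Escale al (Eid _ (vQ m)))
  (Escale (be / c) (Ecomp (Egen k (U_even m)) (Egen k (D_even m))))) => /=.
apply/esym/(twhom_det bQ hf).
  apply: is_homD; apply: is_homZ; first exact: is_hom1.
  exact: is_homM (d_even_hom m) (u_even_hom m).
by rewrite fE mulmxDl -!scalemxAl mul1mx lE scalerA divfK.
Qed.

(** The composite lies in a zero space: there are no nonzero homomorphisms between P_m and P_n, or
    between Q_m and Q_n, for m != n. The three companions hold for the same reason. *)
Lemma uu_even m : u_odd u1 m *m u_even pchark u0 m = 0.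
Proof.
have := hom_PP (m := m) (m' := m + 1) p_gt2 bP
  (is_homM (u_even_hom m) (u_odd_hom m)).
by case: eqP => // E; clear -E; lia.
Qed.

Lemma uu_odd m : u_even pchark u0 (m + 1) *m u_odd u1 m = 0.
Proof.
have := hom_QQ (m := m) (m' := m + 1) p_gt2 bQ
  (is_homM (u_odd_hom m) (u_even_hom (m + 1))).
by case: eqP => // E; clear -E; lia.
Qed.

Lemma dd_even m : d_even phi u0 m *m d_odd phi u1 m = 0.
Proof.
have := hom_PP (m := m + 1) (m' := m) p_gt2 bP
  (is_homM (d_odd_hom m) (d_even_hom m)).
by case: eqP => // E; clear -E; lia.
Qed.

Lemma dd_odd m : d_odd phi u1 m *m d_even phi u0 (m + 1) = 0.
Proof.
have := hom_QQ (m := m + 1) (m' := m) p_gt2 bQ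
  (is_homM (d_even_hom (m + 1)) (d_odd_hom m)).
by case: eqP => // E; clear -E; lia.
Qed.

(** The last two relations are tested on z_Q and z_P, where both reduce to the same equation of
    scalars. The equality of [d_even] at 1 and 0 is what makes the matrix of d_0 u_0 a homomorphism
    on P_1. *)
Lemma relations_coef al be ga de :
  u0 *m zP = al *: bQ_ 1 -> d_even phi u0 0 *m zQ = be *: aP 0 ->
  u1 *m zQ = ga *: bP_ p.-1 -> d_odd phi u1 0 *m zP = de *: aQ 0 ->
  d_even phi u0 1 = d_even phi u0 0 ->
  al * be * gcQ = ga * de -> relations phi u0 u1.
Proof.
move=> u0E d0E u1E d1E d01 abgd; split; first exact: (uu_even 0).
- exact: (uu_odd 0).
- have := is_homM (d_even_hom 0) (u_even_hom 0).
  move=> h; apply: (twhom_det bQ h); first exact: is_homM (u_odd_hom 0) (d_odd_hom 0).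
  have E1 := even_QQ p_gt2 bQ (u_even_hom 0) (d_even_hom 0) u0E d0E.
  have E2 := odd_QQ (u_odd_hom 0) (d_odd_hom 0) u1E d1E.
  by apply: etrans E1 _; rewrite abgd; exact: esym E2.
have := is_homM (d_odd_hom 0) (u_odd_hom 0).
move=> h; apply: (twhom_det bP h).
  have := is_homM (u_even_hom 1) (d_even_hom 1); rewrite d01; exact.
have E1 := odd_PP p_gt2 bP (u_odd_hom 0) (d_odd_hom 0) u1E d1E.
have E2 := even_PP (u_even_hom 0) (d_even_hom 0) u0E d0E.
apply: etrans E1 _; rewrite -abgd mulfK ?(gcQ_neq0 pchark) //; exact: esym E2.
Qed.

End Dagger.
End Quiver.

(** * The relations *)

Lemma sqrt_closed (k : closedFieldType) (c : k) : exists x, x ^+ 2 = c.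
Proof.
have [x xE] := @solve_monicpoly k 2 (fun i => if i == 0%N then c else 0) isT.
by exists x; rewrite xE !big_ord_recl big_ord0 /= mulr1 mul0r !addr0.
Qed.

Lemma scale_ratio (k : closedFieldType) (x y : k) : x != 0 -> y != 0 ->
  exists2 c, c != 0 & c ^+ 2 * x = y.
Proof.
move=> x0 y0; have [c cE] := sqrt_closed (y / x).
exists c; last by rewrite cE divfK.
apply: contraNneq y0 => c0; move: cE; rewrite c0 expr0n /= => /esym/eqP.
by rewrite mulf_eq0 invr_eq0 (negPf x0) orbF.
Qed.

Section Forms.
Variables (k : closedFieldType) (p : nat).
Hypotheses (pchark : p \in [pchar k]) (p_gt2 : (2 < p)%N).
Variables (P0 Q0 : G1Tmod k p).
Hypotheses (P0_T1 : is_T1 0 P0) (Q0_T1 : is_T1 ((2 * p)%:Z - 2) Q0).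
Local Notation tw := (twist pchark).
Local Notation vmod := (vmod pchark P0 Q0).
Variables (u0 : lin P0 Q0) (u1 : lin Q0 (tw 2 P0)).
Hypotheses (u0_hom : is_hom u0) (u0_neq0 : u0 != 0).
Hypotheses (u1_hom : is_hom u1) (u1_neq0 : u1 != 0).

Section Compatible.
Variable phi : iso_family pchark P0 Q0.
Hypothesis phi_tens : tens_compatible phi.

(** Shifting the vertex 0 by m gives the index 0 + m, which is not convertible to m; hence the
    detour through an equation for the index. *)
Lemma phi_vP m : phi (vP m) = phi (vP 0) :> 'M_(dim P0).
Proof.
have H m' : m' = 0 + m -> phi (vP m') = phi (vP 0) :> 'M_(dim P0).
  by move=> ->; exact: (phi_tens m (vP 0)).
by apply: H; rewrite add0r.
Qed.

Lemma phi_vQ m : phi (vQ m) = phi (vQ 0) :> 'M_(dim Q0).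
Proof.
have H m' : m' = 0 + m -> phi (vQ m') = phi (vQ 0) :> 'M_(dim Q0).
  by move=> ->; exact: (phi_tens m (vQ 0)).
by apply: H; rewrite add0r.
Qed.

Lemma d_evenE m : d_even phi u0 m = d_even phi u0 0.
Proof.
have H (S S' : 'M_(dim P0)) (T T' : 'M_(dim Q0)) : S = S' -> T = T' ->
    invmx S *m u0^T *m T = invmx S' *m u0^T *m T' by move=> -> ->.
exact: H (phi_vP m) (phi_vQ m).
Qed.

Lemma d_oddE m : d_odd phi u1 m = d_odd phi u1 0.
Proof.
have H (S S' : 'M_(dim P0)) (T T' : 'M_(dim Q0)) : S = S' -> T = T' ->
    invmx T *m u1^T *m S = invmx T' *m u1^T *m S' by move=> -> ->.
exact: H (etrans (phi_vP (m + 1)) (esym (phi_vP (0 + 1)))) (phi_vQ m).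
Qed.

End Compatible.

Definition form_family (SP : 'M[k]_(dim P0)) (SQ : 'M[k]_(dim Q0)) :
  iso_family pchark P0 Q0 := fun v =>
  match v as v0 return 'M[k]_(dim (vmod v0)) with
  | (true, _) => SP
  | (false, _) => SQ
  end.

Lemma form_family_sym SP SQ : is_hom (SP : lin P0 (tau P0)) -> SP \in unitmx ->
  SP^T = SP -> is_hom (SQ : lin Q0 (tau Q0)) -> SQ \in unitmx -> SQ^T = SQ ->
  symmetric_isos (form_family SP SQ).
Proof.
by move=> hP uP sP hQ uQ sQ [[] m]; split=> //; exact: form_twist.
Qed.

Lemma form_family_tens SP SQ : tens_compatible (form_family SP SQ).
Proof. by move=> n [[] m]. Qed.

Lemma relations_exist : exists phi : iso_family pchark P0 Q0,
  [/\ symmetric_isos phi, tens_compatible phi & relations phi u0 u1].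
Proof.
have [zP [LP [bP _]]] := T1_basis pchark (rP_lt p_gt2) (laP_r k) P0_T1.
have [zQ [LQ [bQ _]]] := T1_basis pchark (rQ_lt pchark p_gt2) (laQ_r pchark p_gt2) Q0_T1.
have [SP [hP uP sP]] := T1_form pchark p_gt2 (rP_lt p_gt2) (laP_r k) P0_T1.
have [SQ [hQ uQ sQ]] :=
  T1_form pchark p_gt2 (rQ_lt pchark p_gt2) (laQ_r pchark p_gt2) Q0_T1.
have s1 := form_family_sym hP uP sP hQ uQ sQ.
have [al al0 u0E] := u0_coef pchark p_gt2 bP bQ u0_hom u0_neq0.
have [ga ga0 u1E] := u1_coef p_gt2 bP bQ u1_hom u1_neq0.
have [be be0 d0E] := d_even_coef p_gt2 bP bQ u0_hom u0_neq0 s1 0.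
have [de de0 d1E] := d_odd_coef p_gt2 bP bQ u1_hom u1_neq0 s1 0.
(* With the form on [Q0] scaled by c, the pair (be, de) becomes (c be, c^-1 de), and the equation to
   solve is c^2 al be [gen_coef] = ga de. *)
have [||c c0 cE] := @scale_ratio k (al * be * gen_coef k (p - 2)) (ga * de).
- by rewrite !mulf_neq0 ?(gcQ_neq0 pchark).
- exact: mulf_neq0.
have sc : symmetric_isos (form_family SP (c *: SQ)).
  apply: form_family_sym => //; first exact: is_homZ hQ.
    by rewrite unitmxZ ?unitfE.
  by rewrite linearZ /= sQ.
exists (form_family SP (c *: SQ)); split=> //; first exact: form_family_tens.
apply: (relations_coef p_gt2 bP bQ u0_hom u1_hom sc (be := c * be) (de := c^-1 * de)
  u0E _ u1E).
- apply: etrans (_ : c *: (d_even (form_family SP SQ) u0 0 *m zQ) = _).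
    by rewrite scalemxAl; congr (_ *m _); exact: esym (scalemxAr _ _ _).
  by rewrite d0E scalerA.
- apply: etrans (_ : c^-1 *: (d_odd (form_family SP SQ) u1 0 *m zP) = _).
    rewrite scalemxAl; congr (_ *m _).
    rewrite /d_odd /dagger /= invmxZ // ?unitmxZ ?unitfE //.
    by rewrite !scalemxAl.
  by rewrite d1E scalerA.
- exact: (d_evenE (form_family_tens _ _) 1).
apply: (mulfI c0); rewrite mulrCA [c * (ga * _)]mulrCA.
rewrite mulVKf // -cE; ring.
Qed.

Lemma d_evenZ (phi : iso_family pchark P0 Q0) a m : d_even phi (a *: u0) m = a *: d_even phi u0 m.
Proof.
rewrite /d_even /dagger.
have -> : (u_even pchark (a *: u0) m)^T = a *: (u_even pchark u0 m)^T.
  by apply/matrixP => i j; rewrite !mxE.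
by rewrite -scalemxAr -scalemxAl.
Qed.

Lemma relations_rescale (phi : iso_family pchark P0 Q0) :
  symmetric_isos phi -> tens_compatible phi ->
  exists2 a : k, a != 0 & relations phi (a *: u0) u1.
Proof.
move=> s1 t1.
have [zP [LP [bP _]]] := T1_basis pchark (rP_lt p_gt2) (laP_r k) P0_T1.
have [zQ [LQ [bQ _]]] := T1_basis pchark (rQ_lt pchark p_gt2) (laQ_r pchark p_gt2) Q0_T1.
have [al al0 u0E] := u0_coef pchark p_gt2 bP bQ u0_hom u0_neq0.
have [ga ga0 u1E] := u1_coef p_gt2 bP bQ u1_hom u1_neq0.
have [be be0 d0E] := d_even_coef p_gt2 bP bQ u0_hom u0_neq0 s1 0.
have [de de0 d1E] := d_odd_coef p_gt2 bP bQ u1_hom u1_neq0 s1 0.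
(* Now al and be both acquire the factor c, which leads to the same quadratic equation. *)
have [||c c0 cE] := @scale_ratio k (al * be * gen_coef k (p - 2)) (ga * de).
- by rewrite !mulf_neq0 ?(gcQ_neq0 pchark).
- exact: mulf_neq0.
exists c => //.
apply: (relations_coef p_gt2 bP bQ _ u1_hom s1 (al := c * al) (be := c * be)
  _ _ u1E d1E).
- exact: is_homZ.
- by rewrite -scalemxAl u0E scalerA.
- by rewrite d_evenZ -scalemxAl d0E scalerA.
- by rewrite !d_evenZ (d_evenE t1 1).
by rewrite -cE; ring.
Qed.

Lemma u2_d2 (phi : iso_family pchark P0 Q0) : symmetric_isos phi -> tens_compatible phi ->
  let u_ := u_even pchark u0 in
  let d_ := d_even phi u0 in
  [/\ tens 1 (u_ 0) = u_ 1, tens 1 (d_ 0) = d_ 1 &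
      tens 1 (v := vP 0) (w := vP 0) (d_ 0 *m u_ 0) = d_ 1 *m u_ 1].
Proof.
move=> s1 t1; split=> //; first exact: esym (d_evenE t1 1).
by rewrite (d_evenE t1 1).
Qed.

End Forms.

(** * Formal expressions *)

Section Arrows.

Lemma arrow_flip v w (a : arrow v w) : v.1 = ~~ w.1. Proof. by case: a. Qed.

(** Indices such as m + 1 obstruct a direct case analysis on two arrows with common endpoints. The
    endpoints are therefore separated and compared through casts, which disappear because equality
    of vertices is decidable. *)
Lemma arrow_uniq v w (a b : arrow v w) : a = b.
Proof.
suff H v1 w1 (a1 : arrow v1 w1) v2 w2 (c : arrow v2 w2) :
    forall (E : v2 = v1) (F : w2 = w1),
    a1 = ecast w0 (arrow v1 w0) F (ecast v0 (arrow v0 w2) E c).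
  exact: (H v w a v w b erefl erefl).
case: v1 w1 / a1 => m; case: v2 w2 / c => m' E F //.
- case: (E) => mm; subst m'.
  by rewrite (eq_irrelevance E erefl) (eq_irrelevance F erefl).
- by exfalso; case: (E) => mm; case: (F); clear -mm; lia.
- case: (E) => mm; subst m'.
  by rewrite (eq_irrelevance E erefl) (eq_irrelevance F erefl).
- by exfalso; case: (E) => mm; case: (F); clear -mm; lia.
- by exfalso; case: (E) => mm; case: (F); clear -mm; lia.
- case: (E) => mm; subst m'.
  by rewrite (eq_irrelevance E erefl) (eq_irrelevance F erefl).
- by exfalso; case: (F) => mm; case: (E); clear -mm; lia.
case: (F) => mm; subst m'.
by rewrite (eq_irrelevance E erefl) (eq_irrelevance F erefl).
Qed.

(** Based at P_(m+1) rather than P_m, so that [D_odd m] starts there without a cast; [vertexP]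
    reduces every vertex to this form. *)
Lemma arrow_outP m z (a : arrow (vP (m + 1)) z) (X : forall z, arrow (vP (m + 1)) z -> Prop) :
  X _ (U_even (m + 1)) -> X _ (D_odd m) -> X z a.
Proof.
case: z a => -[] n a X1 X2; first by have := arrow_flip a.
have [E|E] : n = m + 1 \/ n = m.
  suff H v w (b : arrow v w) : v = vP (m + 1) -> w = vQ n -> n = m + 1 \/ n = m by exact: H a _ _.
  by case: b => // m' [e1] [e2]; [left | right]; clear -e1 e2; lia.
  by subst n; rewrite (arrow_uniq a (U_even (m + 1))).
by subst n; rewrite (arrow_uniq a (D_odd m)).
Qed.

Lemma arrow_outQ m z (a : arrow (vQ m) z) (X : forall z, arrow (vQ m) z -> Prop) :
  X _ (U_odd m) -> X _ (D_even m) -> X z a.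
Proof.
case: z a => -[] n a X1 X2; last by have := arrow_flip a.
have [E|E] : n = m + 1 \/ n = m.
  suff H v w (b : arrow v w) : v = vQ m -> w = vP n -> n = m + 1 \/ n = m by exact: H a _ _.
  by case: b => // m' [e1] [e2]; [left | right]; clear -e1 e2; lia.
  by subst n; rewrite (arrow_uniq a (U_odd m)).
by subst n; rewrite (arrow_uniq a (D_even m)).
Qed.

Lemma arrow_inP m z (a : arrow z (vP (m + 1))) (X : forall z, arrow z (vP (m + 1)) -> Prop) :
  X _ (U_odd m) -> X _ (D_even (m + 1)) -> X z a.
Proof.
case: z a => -[] n a X1 X2; first by have := arrow_flip a.
have [E|E] : n = m + 1 \/ n = m.
  suff H v w (b : arrow v w) : w = vP (m + 1) -> v = vQ n -> n = m + 1 \/ n = m by exact: H a _ _.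
  by case: b => // m' [e1] [e2]; [right | left]; clear -e1 e2; lia.
  by subst n; rewrite (arrow_uniq a (D_even (m + 1))).
by subst n; rewrite (arrow_uniq a (U_odd m)).
Qed.

Lemma arrow_inQ m z (a : arrow z (vQ m)) (X : forall z, arrow z (vQ m) -> Prop) :
  X _ (U_even m) -> X _ (D_odd m) -> X z a.
Proof.
case: z a => -[] n a X1 X2; last by have := arrow_flip a.
have [E|E] : n = m + 1 \/ n = m.
  suff H v w (b : arrow v w) : w = vQ m -> v = vP n -> n = m + 1 \/ n = m by exact: H a _ _.
  by case: b => // m' [e1] [e2]; [right | left]; clear -e1 e2; lia.
  by subst n; rewrite (arrow_uniq a (D_odd m)).
by subst n; rewrite (arrow_uniq a (U_even m)).
Qed.

Lemma vertexP (X : vertex -> Prop) :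
  (forall m, X (vP (m + 1))) -> (forall m, X (vQ m)) -> forall v, X v.
Proof.
by move=> XP XQ [[] m]; [have := XP (m - 1); rewrite subrK | exact: XQ].
Qed.

End Arrows.

(** * Normal forms of expressions *)

Section Words.
Variable k : closedFieldType.
Notation "a ~ b" := (expr_equiv (k := k) a b) (at level 70).
Notation "a '∘' b" := (Ecomp (k := k) a b) (at level 40, left associativity).
Notation "a '⊕' b" := (Eadd (k := k) a b) (at level 50, left associativity).
Notation "c '⋅' a" := (Escale (k := k) c a) (at level 35).
Notation UE m := (Egen k (U_even m)).
Notation UO m := (Egen k (U_odd m)).
Notation DE m := (Egen k (D_even m)).
Notation DO m := (Egen k (D_odd m)).

#[local] Instance equiv_equivalence v w : Equivalence (@expr_equiv k v w).
Proof.
split=> [a|a b|a b c].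
- exact: Q_refl.
- exact: (@Q_sym k v w a b).
- exact: (@Q_trans k v w a b c).
Qed.

#[local] Instance comp_proper v w z :
  Proper (@expr_equiv k w z ==> @expr_equiv k v w ==> @expr_equiv k v z)
    (@Ecomp k v w z).
Proof. by move=> a a' aa b b' bb; exact: Q_comp. Qed.

#[local] Instance add_proper v w :
  Proper (@expr_equiv k v w ==> @expr_equiv k v w ==> @expr_equiv k v w)
    (@Eadd k v w).
Proof. by move=> a a' aa b b' bb; exact: Q_add. Qed.

#[local] Instance scale_proper v w c :
  Proper (@expr_equiv k v w ==> @expr_equiv k v w) (@Escale k v w c).
Proof. by move=> a a' aa; exact: Q_scale. Qed.

#[local] Hint Resolve Q_refl : core.

Lemma scale_zero v w c : c ⋅ Ezero k v w ~ Ezero k v w.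
Proof. by rewrite -{1}(Q_scale0 (Ezero k v w)) Q_scaleA mulr0 Q_scale0. Qed.

Lemma comp0l v w z (a : expr k v w) : Ezero k w z ∘ a ~ Ezero k v z.
Proof. by rewrite -(Q_scale0 (Ezero k w z)) Q_compZl Q_scale0. Qed.

Lemma comp0r v w z (a : expr k w z) : a ∘ Ezero k v w ~ Ezero k v z.
Proof. by rewrite -(Q_scale0 (Ezero k v w)) Q_compZr Q_scale0. Qed.

Lemma add_zero v w (a : expr k v w) : a ⊕ Ezero k v w ~ a.
Proof. by rewrite Q_addC Q_add0. Qed.

Definition loop (v : vertex) : expr k v v :=
  match v with
  | (true, m) => Ecomp (v := vP m) (z := vP m) (DE m) (UE m)
  | (false, m) => Ecomp (v := vQ m) (z := vQ m) (UE m) (DE m)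
  end.

Lemma UDU m : UE m ∘ (DE m ∘ UE m) ~ Ezero k _ _.
Proof. by rewrite Q_compA Q_ud_even -Q_compA Q_uu_even comp0r. Qed.

Lemma DUD m : DE m ∘ (UE m ∘ DE m) ~ Ezero k _ _.
Proof. by rewrite Q_ud_even Q_compA Q_dd_even comp0l. Qed.

(** After at most one exchange of the two forms of the loop, two consecutive arrows point in the
    same direction, and such a composite is zero. *)
Lemma gen_loop v w (a : arrow v w) : Egen k a ∘ loop v ~ Ezero k v w.
Proof.
elim/vertexP: v a => m a.
  elim/arrow_outP: a; first exact: UDU.
  by rewrite /loop /= Q_compA Q_dd_odd comp0l.
elim/arrow_outQ: a; last exact: DUD.
by rewrite /loop /= Q_compA Q_uu_even comp0l.
Qed.

Lemma loop_gen v w (a : arrow v w) : loop w ∘ Egen k a ~ Ezero k v w.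
Proof.
elim/vertexP: w a => m a.
  elim/arrow_inP: a; last by rewrite -Q_compA; exact: DUD.
  by rewrite -Q_compA Q_uu_odd comp0r.
elim/arrow_inQ: a; first by rewrite -Q_compA; exact: UDU.
by rewrite -Q_compA Q_dd_even comp0r.
Qed.

Lemma loop_loop v : loop v ∘ loop v ~ Ezero k v v.
Proof.
by case: v => -[] m; rewrite {1}/loop -Q_compA gen_loop comp0r.
Qed.

(** The cases reflect the shape of the spaces of homomorphisms. An arrow changes the type of the
    vertex, so the last two cases never share endpoints and normal forms can be added. *)
Definition nf v w (e : expr k v w) : Prop :=
  [\/ e ~ Ezero k v w, exists a : arrow v w, exists c, e ~ c ⋅ Egen k a |
   exists E : v = w, exists a b,
     e ~ ecast w0 (expr k v w0) E (a ⋅ Eid k v ⊕ b ⋅ loop v)].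

Lemma nf_equiv v w (a b : expr k v w) : a ~ b -> nf b -> nf a.
Proof.
move=> ab [b0|[x [c bE]]|[E [x [c bE]]]].
- by constructor 1; rewrite ab.
- by constructor 2; exists x, c; rewrite ab.
by constructor 3; exists E, x, c; rewrite ab.
Qed.

Lemma nf_loop v : nf (loop v).
Proof.
by constructor 3; exists erefl, 0, 1 => /=; rewrite Q_scale0 Q_add0 Q_scale1.
Qed.

Lemma nf_gen v w (a : arrow v w) : nf (Egen k a).
Proof. by constructor 2; exists a, 1; rewrite Q_scale1. Qed.

Lemma nf_scale v w c (a : expr k v w) : nf a -> nf (c ⋅ a).
Proof.
move=> [a0|[x [d aE]]|[E [x [d aE]]]].
- by constructor 1; rewrite a0 scale_zero.
- by constructor 2; exists x, (c * d); rewrite aE Q_scaleA.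
constructor 3; exists E, (c * x), (c * d); rewrite aE.
by case: w / E {a aE} => /=; rewrite Q_scaleDr !Q_scaleA.
Qed.

Lemma nf_add v w (a b : expr k v w) : nf a -> nf b -> nf (a ⊕ b).
Proof.
move=> [a0|[x [c aE]]|[E [x [c aE]]]] nb.
- by apply: nf_equiv nb; rewrite a0 Q_add0.
- case: nb => [b0|[y [d bE]]|[E _]].
  + by constructor 2; exists x, c; rewrite b0 aE add_zero.
  + by constructor 2; exists x, (c + d); rewrite aE bE Q_scaleDl (arrow_uniq y x).
  by exfalso; have := arrow_flip x; rewrite -E; case: (v.1).
case: w / E a b aE nb => a b aE [b0|[y _]|[E [y [d bE]]]].
- by constructor 3; exists erefl, x, c; rewrite b0 aE /= add_zero.
- by have := arrow_flip y; case: (v.1).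
rewrite (eq_irrelevance E erefl) /= in bE.
constructor 3; exists erefl, (x + y), (c + d); rewrite aE bE /= !Q_scaleDl !Q_addA.
apply: Q_add => //; rewrite -!Q_addA; apply: Q_add => //; exact: Q_addC.
Qed.

Lemma nf_zero v w : nf (Ezero k v w). Proof. by constructor 1. Qed.

Lemma nf_gen_gen v w z (a : arrow w z) (b : arrow v w) : nf (Egen k a ∘ Egen k b).
Proof.
elim/vertexP: w a b => m a b.
  elim/arrow_outP: a; elim/arrow_inP: b.
  - by apply: nf_equiv (nf_zero _ _); rewrite Q_uu_odd.
  - exact: (nf_loop (vQ (m + 1))).
  - by apply: nf_equiv (nf_loop (vQ m)); rewrite -Q_ud_even.
  by apply: nf_equiv (nf_zero _ _); rewrite Q_dd_odd.
elim/arrow_outQ: a; elim/arrow_inQ: b.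
- by apply: nf_equiv (nf_zero _ _); rewrite Q_uu_even.
- by apply: nf_equiv (nf_loop (vP (m + 1))); rewrite Q_ud_odd.
- exact: (nf_loop (vP m)).
by apply: nf_equiv (nf_zero _ _); rewrite Q_dd_even.
Qed.

Lemma nf_comp v w z (a : expr k w z) (b : expr k v w) : nf a -> nf b -> nf (a ∘ b).
Proof.
move=> [a0|[x [c aE]]|[E [x [c aE]]]] nb.
- by apply: nf_equiv (nf_zero _ _); rewrite a0 comp0l.
- case: nb => [b0|[y [d bE]]|[E [y [d bE]]]].
  + by apply: nf_equiv (nf_zero _ _); rewrite b0 comp0r.
  + apply: nf_equiv (nf_scale c (nf_scale d (nf_gen_gen x y))).
    by rewrite aE bE Q_compZl Q_compZr.
  case: w / E x a aE b bE => x a aE b bE.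
  apply: nf_equiv (nf_scale c (nf_scale y (nf_gen x))); rewrite aE bE /=.
  by rewrite Q_compZl Q_compDr !Q_compZr gen_loop scale_zero add_zero Q_idr.
case: z / E a aE => a aE; case: nb => [b0|[y [d bE]]|[E [y [d bE]]]].
- by apply: nf_equiv (nf_zero _ _); rewrite b0 comp0r.
- apply: nf_equiv (nf_scale x (nf_scale d (nf_gen y))); rewrite aE bE /=.
  by rewrite Q_compDl !Q_compZl !Q_compZr Q_idl loop_gen !scale_zero add_zero.
case: w / E a aE b bE => a aE b bE /=.
have nid : nf (Eid k v).
  by constructor 3; exists erefl, 1, 0 => /=; rewrite Q_scale1 Q_scale0 add_zero.
have n1 := nf_scale x (nf_add (nf_scale y nid) (nf_scale d (nf_loop v))).
have n2 := nf_scale c (nf_scale y (nf_loop v)).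
apply: nf_equiv (nf_add n1 n2); rewrite aE bE /=.
rewrite Q_compDl !Q_compZl Q_idl Q_compDr !Q_compZr Q_idr loop_loop scale_zero.
by rewrite add_zero.
Qed.

Lemma nf_all v w (e : expr k v w) : nf e.
Proof.
elim: e => {v w} [v|v w a|v w z a IHa b IHb|v w|v w a IHa b IHb|v w c a IHa].
- by constructor 3; exists erefl, 1, 0 => /=; rewrite Q_scale1 Q_scale0 add_zero.
- exact: nf_gen.
- exact: nf_comp.
- exact: nf_zero.
- exact: nf_add.
exact: nf_scale.
Qed.

End Words.

(** * Completeness of the relations *)

Section Presentation.
Variables (k : closedFieldType) (p : nat).
Hypotheses (pchark : p \in [pchar k]) (p_gt2 : (2 < p)%N).
Variables (P0 Q0 : G1Tmod k p).
Hypotheses (P0_T1 : is_T1 0 P0) (Q0_T1 : is_T1 ((2 * p)%:Z - 2) Q0).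
Local Notation tw := (twist pchark).
Local Notation vmod := (vmod pchark P0 Q0).
Variables (u0 : lin P0 Q0) (u1 : lin Q0 (tw 2 P0)).
Hypotheses (u0_hom : is_hom u0) (u0_neq0 : u0 != 0).
Hypotheses (u1_hom : is_hom u1) (u1_neq0 : u1 != 0).
Variable phi : iso_family pchark P0 Q0.
Hypothesis phi_sym : symmetric_isos phi.

Lemma eval_arrow_neq0 v w (a : arrow v w) : eval_arrow phi u0 u1 a != 0.
Proof.
case: a => m.
- exact: u0_neq0.
- exact: u1_neq0.
- exact: (@dagger_neq0 _ _ _ _ _ _ phi_sym (vP m) (vQ m) u0 u0_neq0).
exact: (@dagger_neq0 _ _ _ _ _ _ phi_sym (vQ m) (vP (m + 1)) u1 u1_neq0).
Qed.

Lemma eval_loop_neq0 v : eval_expr phi u0 u1 (loop k v) != 0.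
Proof.
have [zP [LP [bP _]]] := T1_basis pchark (rP_lt p_gt2) (laP_r k) P0_T1.
have [zQ [LQ [bQ _]]] := T1_basis pchark (rQ_lt pchark p_gt2) (laQ_r pchark p_gt2) Q0_T1.
case: v => -[] m.
  have [c c0 E] := loop_P p_gt2 bP bQ u0_hom u0_neq0 phi_sym m.
  apply: contraNneq c0 => l0; move: E; rewrite /= in l0; rewrite l0.
  rewrite (mul0mx _ zP) => /esym/eqP.
  by rewrite scaler_eq0 (negPf (aP1_neq0 p_gt2 bP)) orbF.
have [c c0 E] := loop_Q p_gt2 bP bQ u0_hom u0_neq0 phi_sym m.
apply: contraNneq c0 => l0; move: E; rewrite /= in l0; rewrite l0.
rewrite (mul0mx _ zQ) => /esym/eqP.
by rewrite scaler_eq0 (negPf (aQp_neq0 p_gt2 bQ)) orbF.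
Qed.

Hypotheses (phi_tens : tens_compatible phi) (rels : relations phi u0 u1).

Lemma ud_even m :
  u_even pchark u0 m *m d_even phi u0 m = d_odd phi u1 m *m u_odd u1 m.
Proof.
rewrite (d_evenE u0 phi_tens) (d_oddE u1 phi_tens).
by have [_ _ R _] := rels; exact: R.
Qed.

Lemma ud_odd m : u_odd u1 m *m d_odd phi u1 m =
  d_even phi u0 (m + 1) *m u_even pchark u0 (m + 1).
Proof.
rewrite (d_evenE u0 phi_tens) (d_oddE u1 phi_tens).
by have [_ _ _ R] := rels; exact: R.
Qed.

Lemma eval_sound v w (e1 e2 : expr k v w) : expr_equiv e1 e2 ->
  eval_expr phi u0 u1 e1 = eval_expr phi u0 u1 e2.
Proof.
have [zP [LP [bP _]]] := T1_basis pchark (rP_lt p_gt2) (laP_r k) P0_T1.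
have [zQ [LQ [bQ _]]] := T1_basis pchark (rQ_lt pchark p_gt2) (laQ_r pchark p_gt2) Q0_T1.
elim => //=.
- by move=> ? ? ? ? ? _ -> _ ->.
- by move=> ? ? ? ? ? ? ? _ -> _ ->.
- by move=> ? ? ? ? ? ? _ -> _ ->.
- by move=> ? ? ? ? ? _ ->.
- by move=> *; rewrite mul1mx.
- by move=> *; rewrite mulmx1.
- by move=> *; rewrite mulmxA.
- by move=> *; rewrite addrA.
- by move=> *; rewrite addrC.
- by move=> *; rewrite add0r.
- by move=> *; rewrite scale0r.
- by move=> *; rewrite scale1r.
- by move=> *; rewrite scalerA.
- by move=> *; rewrite scalerDl.
- by move=> *; rewrite scalerDr.
- by move=> *; rewrite mulmxDl.
- by move=> *; rewrite mulmxDr.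
- by move=> *; rewrite scalemxAl.
- by move=> *; rewrite scalemxAr.
- by move=> m; exact: (uu_even p_gt2 bP u0_hom u1_hom m).
- by move=> m; exact: (uu_odd p_gt2 bQ u0_hom u1_hom m).
- by move=> m; exact: (dd_even p_gt2 bP u0_hom u1_hom phi_sym m).
- by move=> m; exact: (dd_odd p_gt2 bQ u0_hom u1_hom phi_sym m).
- exact: ud_even.
exact: ud_odd.
Qed.

(** In the normal form a id + b loop, multiplication by the loop, whose square is 0, isolates a;
    then b is read off, as the loop evaluates to a nonzero map. *)
Lemma eval_eq0 v w (e : expr k v w) : eval_expr phi u0 u1 e = 0 ->
  expr_equiv e (Ezero k v w).
Proof.
move=> e0; case: (nf_all e) => [//|[a [c ea]]|[E [a [b ea]]]].
  move: (e0); rewrite (eval_sound ea) /= => /eqP.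
  rewrite scaler_eq0 (negPf (eval_arrow_neq0 a)) orbF => /eqP c0.
  by apply: Q_trans ea _; rewrite c0; exact: Q_scale0.
case: w / E e e0 ea => e e0 /= ea.
move: (e0); rewrite (eval_sound ea) /= => ab0.
have /eqP := congr1 (mulmx (eval_expr phi u0 u1 (loop k v))) ab0.
rewrite mulmx0 mulmxDr -!scalemxAr mulmx1.
have /= -> := eval_sound (loop_loop k v).
rewrite scaler0 addr0 scaler_eq0 (negPf (eval_loop_neq0 v)) orbF => /eqP a0.
move: ab0; rewrite a0 scale0r add0r => /eqP.
rewrite scaler_eq0 (negPf (eval_loop_neq0 v)) orbF => /eqP b0.
apply: Q_trans ea _; rewrite a0 b0; apply: Q_trans (Q_add _ _) (Q_add0 _).
  exact: Q_scale0.
exact: Q_scale0.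
Qed.

Lemma eval_expr_eq v w (e1 e2 : expr k v w) :
  eval_expr phi u0 u1 e1 = eval_expr phi u0 u1 e2 <-> expr_equiv e1 e2.
Proof.
split=> [e12|]; last exact: eval_sound.
have := @eval_eq0 v w (Eadd e1 (Escale (-1) e2)).
rewrite /= e12 scaleN1r subrr => /(_ erefl) d0.
have c0 : expr_equiv (Eadd (Escale (-1) e2) e2) (Ezero k v w).
  apply: Q_trans (Q_add (Q_refl _) (Q_sym (Q_scale1 e2))) _.
  apply: Q_trans (Q_sym (Q_scaleDl _ _ _)) _.
  by rewrite addNr; exact: Q_scale0.
have H : expr_equiv (Eadd e1 (Eadd (Escale (-1) e2) e2)) e1.
  apply: Q_trans (Q_add (Q_refl _) c0) _.
  exact: Q_trans (Q_addC _ _) (Q_add0 _).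
apply: Q_trans (Q_sym H) _; apply: Q_trans (Q_addA _ _ _) _.
exact: Q_trans (Q_add d0 (Q_refl _)) (Q_add0 _).
Qed.

End Presentation.

(** * Generation *)

Section OneBlock.
Variable k : fieldType.

(** A direct sum with one term has as dimension a sum over one index, which is not convertible to
    the dimension of the term; maps between single vertices are transported through these one-block
    matrices. *)
Definition blk m n (A : 'M[k]_(m, n)) : 'M_(\sum_(_ < 1) m, \sum_(_ < 1) n) :=
  \mxblock_(_ < 1, _ < 1) A.

Lemma blkM m n q (A : 'M[k]_(m, n)) (B : 'M_(n, q)) : blk A *m blk B = blk (A *m B).
Proof.
by rewrite /blk mul_mxblock; apply: eq_mxblock => i j; rewrite big_ord1.
Qed.

Lemma blk1 m : blk (1%:M : 'M[k]_m) = 1%:M.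
Proof.
rewrite -mxdiagZ; apply: eq_mxblock => i j.
by rewrite !ord1 eqxx conform_mx_id.
Qed.

Lemma blk_tr m n (A : 'M[k]_(m, n)) : (blk A)^T = blk A^T.
Proof. exact: tr_mxblock. Qed.

Lemma blk_inv m (A : 'M[k]_m) : A \in unitmx -> invmx (blk A) = blk (invmx A).
Proof.
move=> uA; have E : blk A *m blk (invmx A) = 1%:M by rewrite blkM mulmxV // blk1.
have [uB _] := mulmx1_unit E.
by rewrite -[LHS]mulmx1 -E mulKmx.
Qed.

Lemma blk0 m n : blk (0 : 'M[k]_(m, n)) = 0.
Proof. exact: mxblock0. Qed.

Lemma blk_lin m n c (A B : 'M[k]_(m, n)) : blk (c *: A + B) = c *: blk A + blk B.
Proof. by apply/matrixP => i j; rewrite !mxE. Qed.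

Lemma row_blk_col a b m n (X : 'M[k]_(a, m)) (A : 'M[k]_(m, n)) (Y : 'M[k]_(n, b)) :
  (\mxrow_(_ < 1) X) *m blk A *m (\mxcol_(_ < 1) Y) = X *m A *m Y.
Proof.
rewrite /blk mul_mxrow_mxblock mul_mxrow_mxcol big_ord1.
by rewrite big_ord1.
Qed.

End OneBlock.

Section Sums.
Variables (k : closedFieldType) (p : nat) (pchark : p \in [pchar k]).
Variables P0 Q0 : G1Tmod k p.
Local Notation vmod := (vmod pchark P0 Q0).
Local Notation vertex_sum := (vertex_sum pchark P0 Q0).

Lemma single_hom v w (f : lin (vmod v) (vmod w)) : is_hom f -> is_hom (single f).
Proof.
move=> hf; rewrite /single mxblockEh.
apply: (@mxrow_hom _ _ _ (fun i => vmod (one v i))) => j.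
exact: (@mxcol_hom _ _ _ (fun i => vmod (one w i))).
Qed.

Lemma incl_hom r (x : 'I_r -> vertex) i : is_hom (incl pchark P0 Q0 x i).
Proof.
apply: (@mxrow_hom _ _ _ (fun j => vmod (one (x i) j))) => j.
exact: (dinc_hom (fun i => vmod (x i))).
Qed.

Lemma proj_hom r (x : 'I_r -> vertex) i : is_hom (proj pchark P0 Q0 x i).
Proof.
apply: (@mxcol_hom _ _ _ (fun j => vmod (one (x i) j))) => j.
exact: (dpr_hom (fun i => vmod (x i))).
Qed.

Section Entries.
Variables (r s : nat) (x : 'I_r -> vertex) (y : 'I_s -> vertex).
Variable f : lin (vertex_sum x) (vertex_sum y).

Definition entry j i : lin (vmod (x i)) (vmod (y j)) :=
  dpr (fun j => vmod (y j)) j *m f *m dinc (fun i => vmod (x i)) i.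

Lemma entry_hom j i : is_hom f -> is_hom (entry j i).
Proof.
move=> hf; apply: is_homM; first exact: dinc_hom.
by apply: is_homM hf _; exact: dpr_hom.
Qed.

Lemma sum_entries : f = \sum_j \sum_i
  dinc (fun j => vmod (y j)) j *m entry j i *m dpr (fun i => vmod (x i)) i.
Proof.
rewrite -[LHS]mul1mx -[LHS]mulmx1 -(dinc_dpr (fun j => vmod (y j))).
rewrite -(dinc_dpr (fun i => vmod (x i))) !mulmx_suml; apply: eq_bigr => j _.
by rewrite mulmx_sumr; apply: eq_bigr => i _; rewrite /entry !mulmxA.
Qed.

Lemma sum_entries_single : f = \sum_j \sum_i
  incl pchark P0 Q0 y j *m single (entry j i) *m proj pchark P0 Q0 x i.
Proof.
rewrite [LHS]sum_entries; apply: eq_bigr => j _; apply: eq_bigr => i _.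
by apply/esym; exact: row_blk_col.
Qed.

End Entries.

(** Done entry by entry: for a map between two twists only the difference of the twists matters, and
    the shift preserves it. *)
Lemma tens_sum_hom n r s (x : 'I_r -> vertex) (y : 'I_s -> vertex)
    (f : lin (vertex_sum x) (vertex_sum y)) : is_hom f -> is_hom (tens_sum n f).
Proof.
move=> hf; rewrite /tens_sum [f]sum_entries.
apply: is_hom_sum => j _; apply: is_hom_sum => i _.
apply: (@is_homM _ _ _ (vmod (shift n (x i)))).
  exact: (dpr_hom (fun i => vmod (shift n (x i)))).
apply: (@is_homM _ _ _ (vmod (shift n (y j)))); last first.
  exact: (dinc_hom (fun j => vmod (shift n (y j)))).
apply: tw_shift (entry_hom j i hf) => /=; clear; lia.
Qed.

Variable phi : iso_family pchark P0 Q0.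
Hypothesis phi_sym : symmetric_isos phi.

Lemma iso_sum_inv r (x : 'I_r -> vertex) :
  iso_sum phi x *m (\mxdiag_i invmx (phi (x i))) = 1%:M.
Proof.
rewrite /iso_sum {2}/mxdiag mul_mxdiag_mxblock -mxdiagZ.
apply: eq_mxblock => i j; have [<-|_] := eqVneq i j; last by rewrite mulmx0.
by rewrite !conform_mx_id; have [_ ? _] := phi_sym (x i); rewrite mulmxV.
Qed.

Lemma iso_sum_hom r (x : 'I_r -> vertex) :
  is_hom (iso_sum phi x : lin (vertex_sum x) (tau (vertex_sum x))).
Proof.
move=> R g gG; rewrite act_tau !act_dsum.
have -> : map_mx (in_alg R) (iso_sum phi x) = \mxdiag_i (map_mx (in_alg R) (phi (x i))).
  apply/mxblockP => i j; rewrite mxblockK.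
  rewrite /submxblock -map_mxsub -/(submxblock _ i j) mxblockK.
  have [<-|_] := eqVneq i j; first by rewrite !conform_mx_id.
  by apply/matrixP => a b; rewrite !mxE rmorph0.
rewrite tr_mxdiag {2 4}/mxdiag !mul_mxdiag_mxblock; apply: eq_mxblock => i j.
have [<-|_] := eqVneq i j; last by rewrite !mulmx0.
rewrite !conform_mx_id; have [H _ _] := phi_sym (x i).
by have := H R g gG; rewrite act_tau.
Qed.

Lemma dagger_sum_hom r s (x : 'I_r -> vertex) (y : 'I_s -> vertex)
    (f : lin (vertex_sum x) (vertex_sum y)) : is_hom f -> is_hom (dagger_sum phi f).
Proof.
move=> hf; have [ux _] := mulmx1_unit (iso_sum_inv x).
have h1 := is_homM (iso_sum_hom y) (is_hom_tr hf).
have h2 := is_homM h1 (is_hom_inv (iso_sum_hom x) (mulVmx ux) (mulmxV ux)).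
by move: h2; rewrite /dagger_sum mulmxA.
Qed.

Lemma dagger_single v w (f : lin (vmod v) (vmod w)) :
  dagger_sum phi (single f) = single (dagger phi f).
Proof.
have E v' : iso_sum phi (one v') = blk (phi v').
  by apply: eq_mxblock => i j; rewrite !ord1 eqxx conform_mx_id.
have [_ uv _] := phi_sym v.
rewrite /dagger_sum !E blk_inv // -[single f]/(blk f) blk_tr.
by rewrite [X in X *m _]blkM blkM.
Qed.

End Sums.

Section Generation.
Variables (k : closedFieldType) (p : nat).
Hypotheses (pchark : p \in [pchar k]) (p_gt2 : (2 < p)%N).
Variables (P0 Q0 : G1Tmod k p).
Hypotheses (P0_T1 : is_T1 0 P0) (Q0_T1 : is_T1 ((2 * p)%:Z - 2) Q0).
Local Notation tw := (twist pchark).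
Local Notation vmod := (vmod pchark P0 Q0).
Local Notation vertex_sum := (vertex_sum pchark P0 Q0).
Variables (u0 : lin P0 Q0) (u1 : lin Q0 (tw 2 P0)).
Hypotheses (u0_hom : is_hom u0) (u0_neq0 : u0 != 0).
Hypotheses (u1_hom : is_hom u1) (u1_neq0 : u1 != 0).
Variable phi : iso_family pchark P0 Q0.
Hypothesis phi_sym : symmetric_isos phi.

Lemma generated_hom r s (x : 'I_r -> vertex) (y : 'I_s -> vertex)
    (f : lin (vertex_sum x) (vertex_sum y)) : generated phi u0 u1 f -> is_hom f.
Proof.
elim=> {r s x y f}.
- exact: (single_hom (u_even_hom pchark u0_hom 0)).
- exact: (single_hom (u_odd_hom u1_hom 0)).
- by move=> r x; exact: is_hom1.
- by move=> r s t x y z f g _ hf _ hg; exact: is_homM hf hg.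
- by move=> *; exact: is_hom0.
- by move=> r s x y a f g _ hf _ hg; apply: is_homD hg; exact: is_homZ.
- by move=> *; exact: incl_hom.
- by move=> *; exact: proj_hom.
- by move=> r s x y f _ hf; exact: dagger_sum_hom.
by move=> r s x y n f _ hf; exact: tens_sum_hom.
Qed.

(** [Gen_tens] produces the index 0 + m; the equation as hypothesis allows it to be rewritten before
    the types are fixed. *)
Lemma generated_even m m' : m' = 0 + m ->
  generated phi u0 u1 (x := one (vP m')) (y := one (vQ m'))
    (single (u_even pchark u0 m')).
Proof. by move->; exact: (Gen_tens m (Gen_u0 phi u0 u1)). Qed.

Lemma generated_odd m a b : a = 0 + m -> b = 1 + m ->
  generated phi u0 u1 (x := one (vQ a)) (y := one (vP b))
    (single (v := vQ a) (w := vP b) (u1 : 'M[k]_(dim P0, dim Q0))).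
Proof. by move=> -> ->; exact: (Gen_tens m (Gen_u1 phi u0 u1)). Qed.

Lemma generated_arrow v w (a : arrow v w) :
  generated phi u0 u1 (x := one v) (y := one w) (single (eval_arrow phi u0 u1 a)).
Proof.
have GE m : generated phi u0 u1 (x := one (vP m)) (y := one (vQ m))
    (single (u_even pchark u0 m)) by apply: (@generated_even m); rewrite add0r.
have GO m : generated phi u0 u1 (x := one (vQ m)) (y := one (vP (m + 1)))
    (single (u_odd u1 m)) by apply: (@generated_odd m); rewrite ?add0r // addrC.
case: a => m; [exact: GE | exact: GO | |].
  have := Gen_dual (GE m); rewrite dagger_single //; exact.
have := Gen_dual (GO m); rewrite (@dagger_single _ _ _ _ _ _ phi_sym (vQ m) (vP (m + 1))).
exact.
Qed.

Lemma generated_expr v w (e : expr k v w) :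
  generated phi u0 u1 (x := one v) (y := one w) (single (eval_expr phi u0 u1 e)).
Proof.
elim: e => {v w} [v|v w a|v w z a IHa b IHb|v w|v w a IHa b IHb|v w c a IHa] /=.
- have -> : single (1%:M : lin (vmod v) (vmod v)) = 1%:M by exact: blk1.
  exact: Gen_id.
- exact: generated_arrow.
- have := Gen_comp IHb IHa; congr generated; exact: blkM.
- have -> : single (0 : lin (vmod v) (vmod w)) = 0 by exact: blk0.
  exact: Gen_zero.
- have := Gen_lin 1 IHa IHb; congr generated.
  by apply: etrans (esym (blk_lin _ _ _)) _; rewrite scale1r.
have := Gen_lin c IHa (Gen_zero _ _ _ _ _); congr generated.
rewrite addr0; apply/esym; apply: etrans (_ : blk (c *: eval_expr phi u0 u1 a + 0) = _).
  by rewrite addr0.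
by rewrite blk_lin blk0 addr0.
Qed.

Lemma generated_sum r s (x : 'I_r -> vertex) (y : 'I_s -> vertex) I (t : seq I)
    (F : I -> lin (vertex_sum x) (vertex_sum y)) :
  (forall i, generated phi u0 u1 (F i)) -> generated phi u0 u1 (\sum_(i <- t) F i).
Proof.
move=> H; elim/big_rec: _ => [|i f _ gf]; first exact: Gen_zero.
by rewrite -[F i]scale1r; exact: Gen_lin.
Qed.

Lemma hom_generated r s (x : 'I_r -> vertex) (y : 'I_s -> vertex)
    (f : lin (vertex_sum x) (vertex_sum y)) : is_hom f -> generated phi u0 u1 f.
Proof.
have [zP [LP [bP _]]] := T1_basis pchark (rP_lt p_gt2) (laP_r k) P0_T1.
have [zQ [LQ [bQ _]]] := T1_basis pchark (rQ_lt pchark p_gt2) (laQ_r pchark p_gt2) Q0_T1.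
move=> hf; rewrite [f]sum_entries_single; apply: generated_sum => j.
apply: generated_sum => i; apply: Gen_comp; first exact: Gen_proj.
apply: Gen_comp; last exact: Gen_incl.
have [e <-] := hom_span p_gt2 bP bQ u0_hom u0_neq0 u1_hom u1_neq0 phi_sym
  (entry_hom j i hf).
exact: generated_expr.
Qed.

End Generation.

(** * Objects of the block *)

Section Objects.
Variables (k : closedFieldType) (p : nat).
Hypotheses (pchark : p \in [pchar k]) (p_gt2 : (2 < p)%N).
Variables (P0 Q0 : G1Tmod k p).
Hypotheses (P0_T1 : is_T1 0 P0) (Q0_T1 : is_T1 ((2 * p)%:Z - 2) Q0).
Local Notation vmod := (vmod pchark P0 Q0).

Definition vweight (v : vertex) : int :=
  (if v.1 then 0 else (2 * p)%:Z - 2) + p%:Z * (2 * v.2).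

Lemma vmod_T1 v : is_T1 (vweight v) (vmod v).
Proof. by case: v => -[] m; exact: T1_twist. Qed.

(** The two reflections compose to translations by 2p in both directions, which yields 2pZ from 0.
    The highest weight of Q_m is the reflection in -1 of 2p (-m - 1). *)
Lemma Wp_vweight v : Wp_dot_0 p (vweight v).
Proof.
have up m : Wp_dot_0 p m -> Wp_dot_0 p (m + p%:Z * 2).
  move=> /Wp_refl0/(@Wp_reflp p).
  by have -> : (2 * p)%:Z - 2 - (-2 - m) = m + p%:Z * 2 by clear; lia.
have down m : Wp_dot_0 p m -> Wp_dot_0 p (m - p%:Z * 2).
  move=> /Wp_reflp/(@Wp_refl0 p).
  by have -> : -2 - ((2 * p)%:Z - 2 - m) = m - p%:Z * 2 by clear; lia.
have WP m : Wp_dot_0 p (p%:Z * (2 * m)).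
  elim: m => [|n|n]; first by rewrite !mulr0; exact: Wp_0.
    by move/up; congr Wp_dot_0; rewrite intS; ring.
  by move/down; congr Wp_dot_0; rewrite intS; ring.
case: v => -[] m; rewrite /vweight /=; first by rewrite add0r.
have := Wp_refl0 (WP (- m - 1)); congr Wp_dot_0.
by rewrite PoszM; ring.
Qed.

Lemma Wp_vertex m : Wp_dot_0 p m -> exists v, m = vweight v.
Proof.
elim=> {m} [|_ _ [[[] n] ->]|_ _ [[[] n] ->]]; rewrite /vweight /=.
- by exists (vP 0); rewrite /= !mulr0.
- by exists (vQ (- n - 1)); rewrite /= PoszM; ring.
- by exists (vP (- n - 1)); rewrite /= PoszM; ring.
- by exists (vQ (- n)); rewrite /= PoszM; ring.
by exists (vP (- n)); rewrite /= PoszM; ring.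
Qed.

Lemma T1_vmod m N : Wp_dot_0 p m -> is_T1 m N -> exists v, isomorphic N (vmod v).
Proof.
move=> /Wp_vertex[v ->] hN; exists v; have hv := vmod_T1 v.
have p0 (n : int) : (p%:Z * n)%:~R = 0 :> k.
  by rewrite intrM -[(p%:Z)%:~R]/(p%:R) (pcharf0 pchark) mul0r.
case: v hN hv => -[] n hN hv.
  apply: (T1_unique pchark (rP_lt p_gt2) _ hN hv).
  by rewrite /vweight /= add0r p0.
apply: (T1_unique pchark (rQ_lt pchark p_gt2) _ hN hv).
by rewrite /vweight /= intrD p0 addr0 (laQ_r pchark p_gt2).
Qed.

Lemma P10_vertex_sum M : in_P10 M <->
  exists r : nat, exists x : 'I_r -> vertex, isomorphic M (vertex_sum pchark P0 Q0 x).
Proof.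
split=> [[r [N [MN HN]]]|[r [x Mx]]].
  have H i : exists v, isomorphic (N i) (vmod v).
    by have [m Wm Nm] := HN i; exact: T1_vmod Wm Nm.
  have [x Hx] := fin_all_exists H.
  by exists r, x; apply: iso_trans MN _; exact: dsum_iso_congr.
exists r, (fun i => vmod (x i)); split=> // i.
by exists (vweight (x i)); [exact: Wp_vweight | exact: vmod_T1].
Qed.

End Objects.

Theorem proposition6p1 (k : closedFieldType) (p : nat)
    (pchark : p \in [pchar k]) (p_gt2 : (2 < p)%N)
    (P0 Q0 : G1Tmod k p)
    (P0_T1 : is_T1 0 P0) (Q0_T1 : is_T1 ((2 * p)%:Z - 2) Q0)
    (u0 : lin P0 Q0) (u1 : lin Q0 (twist pchark 2 P0))
    (u0_hom : is_hom u0) (u0_neq0 : u0 != 0)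
    (u1_hom : is_hom u1) (u1_neq0 : u1 != 0) :
  (* u0 and u1 are bases of the two spaces of homomorphisms *)
  (forall f : lin P0 Q0, is_hom f -> exists a : k, f = a *: u0) /\
  (forall f : lin Q0 (twist pchark 2 P0), is_hom f ->
     exists a : k, f = a *: u1) /\
  (* generation of P_1(0), for any choice of symmetric isomorphisms *)
  (forall M : G1Tmod k p, in_P10 M <->
     exists r : nat, exists x : 'I_r -> vertex,
       isomorphic M (vertex_sum pchark P0 Q0 x)) /\
  (forall phi : iso_family pchark P0 Q0, symmetric_isos phi ->
     forall (r s : nat) (x : 'I_r -> vertex) (y : 'I_s -> vertex)
            (f : lin (vertex_sum pchark P0 Q0 x) (vertex_sum pchark P0 Q0 y)),
       is_hom f <-> generated phi u0 u1 f) /\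
  (* the relations hold for a suitable choice of symmetric isomorphisms; for
     any choice they hold after rescaling u0 *)
  (exists phi : iso_family pchark P0 Q0,
     [/\ symmetric_isos phi, tens_compatible phi & relations phi u0 u1]) /\
  (forall phi : iso_family pchark P0 Q0,
     symmetric_isos phi -> tens_compatible phi ->
     exists2 a : k, a != 0 & relations phi (a *: u0) u1) /\
  (* u_2, d_2 and d_2 u_2 *)
  (forall phi : iso_family pchark P0 Q0,
     symmetric_isos phi -> tens_compatible phi ->
     let u_ := u_even pchark u0 in
     let d_ := d_even phi u0 in
     [/\ tens 1 (u_ 0) = u_ 1, tens 1 (d_ 0) = d_ 1 &
         tens 1 (v := vP 0) (w := vP 0) (d_ 0 *m u_ 0) = d_ 1 *m u_ 1]) /\
  (* they are defining relations *)
  (forall phi : iso_family pchark P0 Q0,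
     symmetric_isos phi -> tens_compatible phi -> relations phi u0 u1 ->
     forall (v w : vertex) (e1 e2 : expr k v w),
       eval_expr phi u0 u1 e1 = eval_expr phi u0 u1 e2 <-> expr_equiv e1 e2).
Proof.
have [zP [LP [bP _]]] := T1_basis pchark (rP_lt p_gt2) (laP_r k) P0_T1.
have [zQ [LQ [bQ _]]] := T1_basis pchark (rQ_lt pchark p_gt2) (laQ_r pchark p_gt2) Q0_T1.
split; first by move=> f hf; exact: (hom_P0Q0 pchark p_gt2 bP bQ u0_hom u0_neq0 hf).
split; first by move=> f hf; exact: (hom_Q0P1 p_gt2 bP bQ u1_hom u1_neq0 hf).
split; first by move=> M; exact: P10_vertex_sum.
split.
  move=> phi sphi r s x y f; split; last exact: generated_hom.
  exact: hom_generated.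
split; first exact: relations_exist.
split; first by move=> phi; exact: relations_rescale.
split; first by move=> phi; exact: u2_d2.
by move=> phi sphi tphi rels v w e1 e2; exact: eval_expr_eq.
Qed.
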